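(* Let $f\in\mathrm{LC}$, $F\in\mathrm{WTC}_\Theta(\mathbb R^{N\times N})$ and $h\in\mathrm{WTC}_\Theta(\mathbb R^N)$ all have $L^1_{loc}$-equicontinuous $m$-bounds, where $\Theta=\{\theta^I_j\}$ is given by $\theta^I_j(s)=\sup_{t\in\mathbb R}\int_t^{t+s}m^j(u)\,du$ for all rational intervals $I$, with $m^j(t)=\sup_{x\in B_j}|f(t,x)|$ the optimal $m$-bound of $f$ on $B_j$. Let $\mathcal H_1=\mathrm{Hull}_{(\mathrm{LC},\sigma_\Theta)}(f)$ and $\mathcal H=\mathrm{Hull}_{(\mathrm{LC}\times\mathrm{WTC}_\Theta(\mathbb R^{N\times N})\times\mathrm{WTC}_\Theta(\mathbb R^N),\ \sigma_\Theta\times\sigma_\Theta\times\sigma_\Theta)}(f,F,h)$. Then: (i) $\mathcal U_1=\{(t,g,x_0)\mid g\in\mathcal H_1,\ x_0\in\mathbb R^N,\ t\in I_{g,x_0}\}$ is open in $\mathbb R\times\mathcal H_1\times\mathbb R^N$ and $\Pi:\mathcal U_1\to\mathcal H_1\times\mathbb R^N$, $\Pi(t,g,x_0)=(g_t,x(t,g,x_0))$, is a continuous local skew-product flow on $\mathcal H_1\times\mathbb R^N$. (ii) $\mathcal U_2=\{(t,g,G,k,x_0,y_0)\mid (g,G,k)\in\mathcal H,\ x_0,y_0\in\mathbb R^N,\ t\in I_{g,x_0}\}$ is open in $\mathbb R\times\mathcal H\times\mathbb R^N\times\mathbb R^N$ and $\Psi:\mathcal U_2\to\mathcal H\times\mathbb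 R^N\times\mathbb R^N$, $\Psi(t,g,G,k,x_0,y_0)=(g_t,G_t,k_t,x(t,g,x_0),y(t,g,G,k,x_0,y_0))$, is a continuous local skew-product flow on $\mathcal H\times\mathbb R^N\times\mathbb R^N$.
   Context: Notation: $|\cdot|$ is the Euclidean norm on $\mathbb R^N$ and $B_j$ the closed ball of $\mathbb R^N$ of radius $j$ centered at $0$. $L^1_{loc}$ denotes real functions on $\mathbb R$ integrable on every compact interval. For $f$ and $t\in\mathbb R$, $f_t(s,x)=f(s+t,x)$. A function $f:\mathbb R\times\mathbb R^N\to\mathbb R^M$ satisfies (C1) if it is Borel measurable, and (C2) if for every compact $K\subset\mathbb R^N$ there is $m^K\in L^1_{loc}$ (an $m$-bound of $f$ on $K$) with $|f(t,x)|\le m^K(t)$ for all $x\in K$ and a.e. $t$. $\mathrm{LC}$ is the set of $f:\mathbb R\times\mathbb R^N\to\mathbb R^N$ satisfying (C1), (C2) and: for each compact $K$ there is $l^K\in L^1_{loc}$ with $|f(t,x)-f(t,y)|\le l^K(t)|x-y|$ for $x,y\in K$, a.e. $t$. A suitable set of moduli of continuity is a countable family $\Theta=\{\theta^I_j\mid j\in\mathbb N,\ I=[q_1,q_2],\ q_1<q_2,\ q_1,q_2\in\mathbb Q\}$ of nondecreasing continuous functions $\theta^I_j:\mathbb R^+\to\mathbb R^+$ with $\theta^I_j(0)=0$ and $\theta^{I_1}_{j_1}\le\theta^{I_2}_{j_2}$ whenever $I_1\subseteq I_2$ and $j_1\le j_2$. $\mathcal K^I_j$ is the set of continuous $x:I\to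 B_j$ admitting $\theta^I_j$ as modulus of continuity. $\mathrm{WTC}_\Theta(\mathbb R^M)$ is the set of $f:\mathbb R\times\mathbb R^N\to\mathbb R^M$ satisfying (C1), (C2) and (W): for each $j$ and $I=[q_1,q_2]$ with rational endpoints, if $x_n\in\mathcal K^I_j$ converge uniformly to $x\in\mathcal K^I_j$ then $\int_I f(t,x_n(t))dt\to\int_I f(t,x(t))dt$; functions differing only on a null subset of $\mathbb R^{1+N}$ are identified; $\mathrm{LC}\subset\mathrm{WTC}_\Theta(\mathbb R^N)$. $\sigma_\Theta$ is the topology generated by the seminorms $p_{I,j}(f)=\sup_{x\in\mathcal K^I_j}|\int_I f(t,x(t))\,dt|$. A set $S$ of nonnegative functions in $L^1_{loc}$ is $L^1_{loc}$-equicontinuous if for all $r,\varepsilon>0$ there is $\delta>0$ with $\sup_{m\in S}\int_s^t m<\varepsilon$ whenever $-r\le s\le t\le r$, $t-s<\delta$. A function $f$ has $L^1_{loc}$-equicontinuous $m$-bounds if for every $j\in\mathbb N$ there is an $L^1_{loc}$-equicontinuous set consisting of $m$-bounds on $B_j$ of the functions $f_t$, $t\in\mathbb R$ (one for each). The hull of $f$ (or of a tuple) in a topological space $(E,\sigma)$ is the closure in $(E,\sigma)$ of $\{f_t\mid t\in\mathbb R\}$ (with componentwise translation), with the induced topology. For $g\in\mathrm{LC}$, $x(\cdot,g,x_0)$ is the unique maximal solution of $\dot x=g(t,x)$, $x(0)=x_0$, on its maximal interval $I_{g,x_0}$; $y(\cdot,g,G,k,x_0,y_0)$ is the solution on $I_{g,x_0}$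 of $\dot y=G(t,x(t,g,x_0))y+k(t,x(t,g,x_0))$, $y(0)=y_0$. A local skew-product flow means: $\Pi(0,\cdot)$ is the identity and $\Pi(t+s,\cdot)=\Pi(t,\Pi(s,\cdot))$ wherever defined. *)

(* Defs.v *)
From HB Require Import structures.
From mathcomp Require Import all_boot all_order all_algebra.
From mathcomp Require Import all_classical all_reals all_analysis.
Set Implicit Arguments. Unset Strict Implicit. Unset Printing Implicit Defensive.
Import Order.TTheory GRing.Theory Num.Theory.
Import numFieldNormedType.Exports.
Local Open Scope classical_set_scope.
Local Open Scope ring_scope.

Section Defs.
Context {R : realType} {N : nat}.
Local Notation mu := (@lebesgue_measure R).
Local Notation vec := 'cV[R]_N.

Definition enorm {m n} (A : 'M[R]_(m, n)) : R :=
  Num.sqrt (\sum_(i < m) \sum_(j < n) A i j ^+ 2).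

Definition Bj (j : nat) : set vec := [set x | enorm x <= j%:R].

Definition Rint (a b : R) (u : R -> R) : R := Rintegral mu `[a, b] u.

Definition Mint {m n} (a b : R) (u : R -> 'M[R]_(m, n)) : 'M[R]_(m, n) :=
  \matrix_(i, j) Rint a b (fun s => u s i j).
Definition Mintegrable {m n} (a b : R) (u : R -> 'M[R]_(m, n)) : Prop :=
  forall i j, mu.-integrable `[a, b] (fun s => (u s i j)%:E).
Definition oMint {m n} (a b : R) (u : R -> 'M[R]_(m, n)) : 'M[R]_(m, n) :=
  if a <= b then Mint a b u else - Mint b a u.

Definition L1loc (u : R -> R) : Prop :=
  forall a b : R, mu.-integrable `[a, b] (EFin \o u).

Definition field m n := R -> vec -> 'M[R]_(m, n).

Definition trans {m n} (f : field m n) (t : R) : field m n :=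
  fun s x => f (s + t) x.
Definition fsub {m n} (f g : field m n) : field m n := fun s x => f s x - g s x.

Definition C1 {m n} (f : field m n) : Prop :=
  forall B : set 'M[R]_(m, n), <<s open >> B ->
    <<s open >> ((fun p : R * vec => f p.1 p.2) @^-1` B).

Definition mbound {m n} (f : field m n) (K : set vec) (mb : R -> R) : Prop :=
  L1loc mb /\ {ae mu, forall t, forall x, K x -> enorm (f t x) <= mb t}.

Definition C2 {m n} (f : field m n) : Prop :=
  forall K : set vec, compact K -> exists mb, mbound f K mb.

Definition LC (f : field N 1) : Prop :=
  C1 f /\ C2 f /\
  forall K : set vec, compact K -> exists l, L1loc l /\
    {ae mu, forall t, forall x y, K x -> K y ->
       enorm (f t x - f t y) <= l t * enorm (x - y)}.

(* a family of moduli theta^I_j, I = [q1,q2], indexed by j q1 q2 *)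
Definition Iq (q1 q2 : rat) : set R := `[(ratr q1 : R), ratr q2].

Definition moduli := nat -> rat -> rat -> R -> R.

(* K^I_j : continuous x : I -> B_j with modulus theta^I_j
   (represented by functions R -> R^N; values outside I are irrelevant) *)
Definition Kset (th : moduli) (j : nat) (q1 q2 : rat) : set (R -> vec) :=
  [set x | {within Iq q1 q2, continuous x} /\
    (forall t, Iq q1 q2 t -> Bj j (x t)) /\
    (forall s t, Iq q1 q2 s -> Iq q1 q2 t ->
        enorm (x t - x s) <= th j q1 q2 `|t - s|)].

Definition condW {m n} (th : moduli) (f : field m n) : Prop :=
  forall (j : nat) (q1 q2 : rat), q1 < q2 ->
  forall (xs : nat -> R -> vec) (x : R -> vec),
    (forall k, Kset th j q1 q2 (xs k)) -> Kset th j q1 q2 x ->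
    (forall e : R, 0 < e -> \forall k \near \oo,
        forall t, Iq q1 q2 t -> enorm (xs k t - x t) < e) ->
    (fun k => Mint (ratr q1 : R) (ratr q2) (fun t => f t (xs k t)))
      @ \oo --> Mint (ratr q1 : R) (ratr q2) (fun t => f t (x t)).

Definition WTC {m n} (th : moduli) (f : field m n) : Prop :=
  C1 f /\ C2 f /\ condW th f.

Definition seminorm {m n} (th : moduli) (j : nat) (q1 q2 : rat)
  (f : field m n) : R :=
  sup [set enorm (Mint (ratr q1 : R) (ratr q2) (fun t => f t (x t)))
      | x in Kset th j q1 q2].

(* basic sigma_Theta-neighbourhood of g (finite list ps of seminorms) *)
Definition nb {m n} (th : moduli) (ps : seq (nat * rat * rat)) (d : R)
  (g g' : field m n) : Prop :=
  forall j q1 q2, (j, q1, q2) \in ps -> q1 < q2 ->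
    seminorm th j q1 q2 (fsub g' g) < d.

Definition L1equi (ms : R -> R -> R) : Prop :=
  (forall tau t, 0 <= ms tau t) /\
  forall r e : R, 0 < r -> 0 < e -> exists2 d : R, 0 < d &
    forall tau s t, - r <= s -> s <= t -> t <= r -> t - s < d ->
      Rint s t (ms tau) < e.

Definition equi_mbounds {m n} (f : field m n) : Prop :=
  forall j : nat, exists ms : R -> R -> R,
    (forall tau, mbound (trans f tau) (Bj j) (ms tau)) /\ L1equi ms.

Definition mopt (f : field N 1) (j : nat) (t : R) : R :=
  sup [set enorm (f t x) | x in Bj j].
Definition Theta (f : field N 1) : moduli :=
  fun j _ _ s => sup [set Rint t (t + s) (mopt f j) | t in [set: R]].

Definition Hull1 (th : moduli) (f g : field N 1) : Prop :=
  LC g /\ forall ps d, 0 < d -> exists tau, nb th ps d g (trans f tau).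

Definition Hull3 (th : moduli) (f : field N 1) (F : field N N) (h : field N 1)
  (gGk : field N 1 * field N N * field N 1) : Prop :=
  LC gGk.1.1 /\ WTC th gGk.1.2 /\ WTC th gGk.2 /\
  forall ps d, 0 < d -> exists tau,
    [/\ nb th ps d gGk.1.1 (trans f tau), nb th ps d gGk.1.2 (trans F tau)
      & nb th ps d gGk.2 (trans h tau)].

Definition nb3 (th : moduli) ps d (p q : field N 1 * field N N * field N 1) :=
  [/\ nb th ps d p.1.1 q.1.1, nb th ps d p.1.2 q.1.2 & nb th ps d p.2 q.2].

Definition trans3 (p : field N 1 * field N N * field N 1) (t : R) :=
  (trans p.1.1 t, trans p.1.2 t, trans p.2 t).

Definition solves (g : field N 1) (x0 : vec) (J : set R) (x : R -> vec) :=
  is_interval J /\ J 0 /\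
  forall t, J t -> Mintegrable (Num.min 0 t) (Num.max 0 t) (fun s => g s (x s))
    /\ x t = x0 + oMint 0 t (fun s => g s (x s)).

Definition Imax (g : field N 1) (x0 : vec) : set R :=
  [set t | exists J x, solves g x0 J x /\ J t].
Definition xsol (g : field N 1) (x0 : vec) (t : R) : vec :=
  xget 0 [set v | exists J x, [/\ solves g x0 J x, J t & x t = v]].

Definition lsolves (g : field N 1) (G : field N N) (k : field N 1) (x0 y0 : vec)
  (y : R -> vec) : Prop :=
  forall t, Imax g x0 t ->
    let u := fun s => G s (xsol g x0 s) *m y s + k s (xsol g x0 s) in
    Mintegrable (Num.min 0 t) (Num.max 0 t) u /\ y t = y0 + oMint 0 t u.
Definition ysol g G k (x0 y0 : vec) (t : R) : vec :=
  xget 0 [set v | exists y, lsolves g G k x0 y0 y /\ y t = v].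

Definition U1 th f : set (R * field N 1 * vec) :=
  [set p | Hull1 th f p.1.2 /\ Imax p.1.2 p.2 p.1.1].
Definition Pi (p : R * field N 1 * vec) : field N 1 * vec :=
  (trans p.1.2 p.1.1, xsol p.1.2 p.2 p.1.1).

Definition open1 th f (U : set (R * field N 1 * vec)) : Prop :=
  forall p, U p -> exists ps d e, [/\ 0 < d, 0 < e &
    forall q, Hull1 th f q.1.2 -> `|q.1.1 - p.1.1| < e -> nb th ps d p.1.2 q.1.2 ->
      enorm (q.2 - p.2) < e -> U q].

Definition cont1 th f : Prop :=
  forall p, U1 th f p -> forall ps d e, 0 < d -> 0 < e ->
    exists ps' d' e', [/\ 0 < d', 0 < e' &
      forall q, U1 th f q -> `|q.1.1 - p.1.1| < e' -> nb th ps' d' p.1.2 q.1.2 ->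
        enorm (q.2 - p.2) < e' ->
        nb th ps d (Pi p).1 (Pi q).1 /\ enorm ((Pi q).2 - (Pi p).2) < e].

Definition flow1 th f : Prop :=
  (forall g x0, Hull1 th f g -> U1 th f (0, g, x0) /\ Pi (0, g, x0) = (g, x0)) /\
  (forall s t g x0, U1 th f (s, g, x0) -> U1 th f (t, (Pi (s, g, x0)).1, (Pi (s, g, x0)).2) ->
     U1 th f (t + s, g, x0) /\
     Pi (t + s, g, x0) = Pi (t, (Pi (s, g, x0)).1, (Pi (s, g, x0)).2)).

Definition U2 th f F h : set (R * (field N 1 * field N N * field N 1) * vec * vec) :=
  [set p | Hull3 th f F h p.1.1.2 /\ Imax p.1.1.2.1.1 p.1.2 p.1.1.1].
Definition Psi (p : R * (field N 1 * field N N * field N 1) * vec * vec)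
  : (field N 1 * field N N * field N 1) * vec * vec :=
  let: (t, (g, G, k), x0, y0) := p in
  (trans3 (g, G, k) t, xsol g x0 t, ysol g G k x0 y0 t).

Definition open2 th f F h (U : set (R * (field N 1 * field N N * field N 1) * vec * vec)) :=
  forall p, U p -> exists ps d e, [/\ 0 < d, 0 < e &
    forall q, Hull3 th f F h q.1.1.2 -> `|q.1.1.1 - p.1.1.1| < e ->
      nb3 th ps d p.1.1.2 q.1.1.2 ->
      enorm (q.1.2 - p.1.2) < e -> enorm (q.2 - p.2) < e -> U q].

Definition cont2 th f F h : Prop :=
  forall p, U2 th f F h p -> forall ps d e, 0 < d -> 0 < e ->
    exists ps' d' e', [/\ 0 < d', 0 < e' &
      forall q, U2 th f F h q -> `|q.1.1.1 - p.1.1.1| < e' ->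
        nb3 th ps' d' p.1.1.2 q.1.1.2 ->
        enorm (q.1.2 - p.1.2) < e' -> enorm (q.2 - p.2) < e' ->
        [/\ nb3 th ps d (Psi p).1.1 (Psi q).1.1,
            enorm ((Psi q).1.2 - (Psi p).1.2) < e &
            enorm ((Psi q).2 - (Psi p).2) < e]].

Definition flow2 th f F h : Prop :=
  (forall gGk x0 y0, Hull3 th f F h gGk ->
     U2 th f F h (0, gGk, x0, y0) /\ Psi (0, gGk, x0, y0) = (gGk, x0, y0)) /\
  (forall s t gGk x0 y0, U2 th f F h (s, gGk, x0, y0) ->
     let r := Psi (s, gGk, x0, y0) in
     U2 th f F h (t, r.1.1, r.1.2, r.2) ->
     U2 th f F h (t + s, gGk, x0, y0) /\
     Psi (t + s, gGk, x0, y0) = Psi (t, r.1.1, r.1.2, r.2)).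

End Defs.

(* Main.v *)
Require Import Defs.
From HB Require Import structures.
From mathcomp Require Import all_boot all_order all_algebra.
From mathcomp Require Import all_classical all_reals all_analysis.
From mathcomp Require Import measurable_realfun ring lra.
Import Order.TTheory GRing.Theory Num.Theory.
Import numFieldNormedType.Exports.
Local Open Scope classical_set_scope.
Local Open Scope ring_scope.
Set Implicit Arguments. Unset Strict Implicit. Unset Printing Implicit Defensive.

(* Composing a field g of the hull with the radial projection P onto B_j, which
   is 1-Lipschitz, makes it globally Lipschitz, so that x' = g(t, P x) has a
   solution X on the whole of [-T, T]. Approximating P X by step paths (constant
   paths belong to every K^I_j) and g by translates of f shows that X has modulus
   theta_j; hence P X is an admissible path for the seminorms of sigma_Theta.
   For two such solutions, the integral of (g' - g)(s, P X'(s)) is small over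
   rational intervals by closeness in sigma_Theta and over short ones by
   equicontinuity, and Gronwall's lemma bounds X' - X. As long as X stays inside
   B_j it is the solution of the original equation, so openness of the domain
   and continuity of the flow follow at once.

   For y' = G(t, x) y + k(t, x) the fields G, k are not Lipschitz in x. The L^1
   norm of G(s, x(s)) is recovered as the total variation of its primitive, which
   sigma_Theta controls on rational grids; this yields L^1 bounds that are uniform
   over the hull. Condition (W), made uniform on K^I_j by Arzela-Ascoli, yields
   convergence of the integrals along converging paths, and the y-solutions are
   again compared by Gronwall's lemma. *)

(* [Rint] also names a predicate of [mathcomp.reals]. *)
Local Notation Rint := Defs.Rint.

(** * The Euclidean norm *)

(** All tolerances must be fixed before the competing element of the hull is chosen, and no
    Lipschitz function common to the hull is at hand. This dictates how differences are split. For
    x, the defect (g' - g)(s, P X') is taken along the perturbed path, so that the remainder is a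
    difference of g alone and the Gronwall kernel is the Lipschitz function of the fixed g. For y
    the roles are reversed: the defect (G' - G) y is small only in a weak sense, so its continuous
    factor has to be the fixed solution y, whose modulus and bound are known in advance. The kernel
    is then |G'(s, x'(s))|, which varies; hence a Gronwall bound 2^n that depends only on a number
    of cells of mass at most 1/4, and this number can be chosen for the whole hull. Paths live on
    all of R, with time clamped to an interval where necessary, so that shifts, limits and restarts
    stay within one class of functions. *)

Section Enorm.
Context {R : realType}.

Definition mdot {m n} (A B : 'M[R]_(m, n)) : R := \sum_i \sum_j A i j * B i j.

Lemma mdotC m n (A B : 'M[R]_(m, n)) : mdot A B = mdot B A.
Proof. by apply: eq_bigr => i _; apply: eq_bigr => j _; rewrite mulrC. Qed.

Lemma mdotDl m n (A B C : 'M[R]_(m, n)) : mdot (A + B) C = mdot A C + mdot B C.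
Proof.
rewrite /mdot -big_split; apply: eq_bigr => i _ /=.
by rewrite -big_split; apply: eq_bigr => j _; rewrite mxE mulrDl.
Qed.

Lemma mdotZl m n a (A B : 'M[R]_(m, n)) : mdot (a *: A) B = a * mdot A B.
Proof.
rewrite /mdot big_distrr; apply: eq_bigr => i _ /=.
by rewrite big_distrr; apply: eq_bigr => j _ /=; rewrite mxE mulrA.
Qed.

Lemma mdotDr m n (A B C : 'M[R]_(m, n)) : mdot C (A + B) = mdot C A + mdot C B.
Proof. by rewrite mdotC mdotDl !(mdotC C). Qed.

Lemma mdotZr m n a (A B : 'M[R]_(m, n)) : mdot B (a *: A) = a * mdot B A.
Proof. by rewrite mdotC mdotZl mdotC. Qed.

Lemma mdotNl m n (A B : 'M[R]_(m, n)) : mdot (- A) B = - mdot A B.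
Proof. by rewrite -scaleN1r mdotZl mulN1r. Qed.

Lemma mdotNr m n (A B : 'M[R]_(m, n)) : mdot A (- B) = - mdot A B.
Proof. by rewrite mdotC mdotNl mdotC. Qed.

Lemma mdot_ge0 m n (A : 'M[R]_(m, n)) : 0 <= mdot A A.
Proof. by do 2!apply: sumr_ge0 => ? _; rewrite -expr2 sqr_ge0. Qed.

Lemma enormE m n (A : 'M[R]_(m, n)) : enorm A = Num.sqrt (mdot A A).
Proof.
by congr Num.sqrt; apply: eq_bigr => i _; apply: eq_bigr => j _; rewrite expr2.
Qed.

Lemma enorm_ge0 m n (A : 'M[R]_(m, n)) : 0 <= enorm A.
Proof. exact: sqrtr_ge0. Qed.

Lemma enorm_sqr m n (A : 'M[R]_(m, n)) : enorm A ^+ 2 = mdot A A.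
Proof. by rewrite enormE sqr_sqrtr// mdot_ge0. Qed.

Lemma le_enorm m n (A : 'M[R]_(m, n)) i j : `|A i j| <= enorm A.
Proof.
rewrite -ler_sqr ?nnegrE ?enorm_ge0// enorm_sqr /mdot (bigD1 i)//= (bigD1 j)//=.
rewrite real_normK ?num_real// -expr2 -addrA lerDl addr_ge0//.
  by apply: sumr_ge0 => ? _; rewrite -expr2 sqr_ge0.
by do 2!apply: sumr_ge0 => ? _; rewrite -expr2 sqr_ge0.
Qed.

Lemma enorm0 m n : enorm (0 : 'M[R]_(m, n)) = 0.
Proof.
rewrite enormE -[X in mdot X](scale0r (0 : 'M[R]_(m, n))) mdotZl mul0r.
exact: sqrtr0.
Qed.

Lemma enorm_eq0 m n (A : 'M[R]_(m, n)) : enorm A <= 0 -> A = 0.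
Proof.
move=> A0; apply/matrixP => i j; rewrite mxE; apply/normr0_eq0/le_anti.
by rewrite normr_ge0 (le_trans (le_enorm _ _ _)).
Qed.

Lemma mdot_CS m n (A B : 'M[R]_(m, n)) : mdot A B <= enorm A * enorm B.
Proof.
have [B0|B0] := leP (enorm B) 0.
  rewrite (enorm_eq0 B0) enorm0 mulr0 -[X in mdot _ X](scale0r A) mdotZr mul0r.
  exact: lexx.
have [/le_trans->//|AB0] := leP (mdot A B) 0.
  by rewrite mulr_ge0// enorm_ge0.
rewrite -ler_sqr ?nnegrE ?mulr_ge0 ?enorm_ge0 ?(ltW AB0)// exprMn !enorm_sqr.
have c0 : 0 < mdot B B by rewrite -enorm_sqr exprn_gt0.
have := mdot_ge0 (mdot B B *: A - mdot A B *: B).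
rewrite mdotDl !mdotDr !mdotNr !mdotNl !mdotZl !mdotZr (mdotC B A).
set a := mdot A A; set b := mdot A B; set c := mdot B B in c0 * => H.
by rewrite -subr_ge0 -(pmulr_rge0 _ c0); nra.
Qed.

Lemma ler_enormD m n (A B : 'M[R]_(m, n)) : enorm (A + B) <= enorm A + enorm B.
Proof.
rewrite -ler_sqr ?nnegrE ?addr_ge0 ?enorm_ge0// enorm_sqr mdotDl !mdotDr.
rewrite sqrrD !enorm_sqr (mdotC B A).
by have := mdot_CS A B; lra.
Qed.

Lemma enormN m n (A : 'M[R]_(m, n)) : enorm (- A) = enorm A.
Proof. by rewrite !enormE mdotNl mdotNr opprK. Qed.

Lemma enormB m n (A B : 'M[R]_(m, n)) : enorm (A - B) = enorm (B - A).
Proof. by rewrite -enormN opprB. Qed.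

Lemma enormZ m n a (A : 'M[R]_(m, n)) : enorm (a *: A) = `|a| * enorm A.
Proof.
by rewrite !enormE mdotZl mdotZr mulrA -expr2 sqrtrM ?sqr_ge0// sqrtr_sqr.
Qed.

Lemma ler_enorm_dist m n (B A C : 'M[R]_(m, n)) :
  enorm (A - C) <= enorm (A - B) + enorm (B - C).
Proof. by rewrite (le_trans _ (ler_enormD _ _))// subrKA. Qed.

Lemma ler_enorm_sum m n I (r : seq I) (P : pred I) (f : I -> 'M[R]_(m, n)) :
  enorm (\sum_(i <- r | P i) f i) <= \sum_(i <- r | P i) enorm (f i).
Proof.
elim/big_ind2 : _ => //; first by rewrite enorm0.
by move=> ? x ? y xl yl; rewrite (le_trans (ler_enormD _ _))// lerD.
Qed.

Lemma enorm_le_sum m n (A : 'M[R]_(m, n)) : enorm A <= \sum_i \sum_j `|A i j|.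
Proof.
rewrite -ler_sqr ?nnegrE ?enorm_ge0 ?sumr_ge0//; last first.
  by move=> i _; apply: sumr_ge0.
rewrite enorm_sqr /mdot expr2 big_distrl; apply: ler_sum => i _ /=.
rewrite big_distrl; apply: ler_sum => j _ /=.
rewrite (le_trans (ler_norm _))// normrM ler_wpM2l//.
rewrite (bigD1 i)//= (bigD1 j)//= -addrA lerDl addr_ge0// ?sumr_ge0// => k _.
by apply: sumr_ge0.
Qed.

(** The entrywise l^1 norm of A is kept on the right because its integral is what the hull estimates
    control. The sum of ones counts columns and equals 1 for a vector. *)
Lemma enorm_mulmx m n p (A : 'M[R]_(m, n)) (B : 'M[R]_(n, p)) :
  enorm (A *m B) <= (\sum_i \sum_j `|A i j|) * (\sum_(k < p) 1) * enorm B.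
Proof.
apply: (le_trans (enorm_le_sum _)); rewrite big_distrl big_distrl.
apply: ler_sum => i _ /=; rewrite big_distrr big_distrl; apply: ler_sum => k _ /=.
rewrite mxE mulr1 (le_trans (ler_norm_sum _ _ _))// big_distrl.
by apply: ler_sum => j _ /=; rewrite normrM ler_wpM2l// le_enorm.
Qed.

Lemma mx_norm_le_enorm m n (A : 'M[R]_(m, n)) : `|A| <= enorm A.
Proof.
rewrite [leLHS]/Num.norm /= mx_normrE; apply/bigmax_leP; split; first exact: enorm_ge0.
by move=> [i j] _; exact: le_enorm.
Qed.

Lemma enorm_le_mx_norm m n (A : 'M[R]_(m, n)) :
  enorm A <= (\sum_(i < m) \sum_(j < n) 1) * `|A|.
Proof.
rewrite (le_trans (enorm_le_sum _))// big_distrl ler_sum// => i _ /=.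
rewrite big_distrl ler_sum// => j _ /=.
rewrite mul1r [leRHS]/Num.norm /= mx_normrE; apply/bigmax_geP; right => /=.
by exists (i, j).
Qed.

Lemma enorm_cont m n (A : 'M[R]_(m, n)) e : 0 < e ->
  \forall B \near A, enorm (B - A) < e.
Proof.
move=> e0; pose C : R := (\sum_(i < m) \sum_(j < n) 1) + 1.
have C0 : 0 < C by rewrite ltr_pwDr// sumr_ge0// => i _; rewrite sumr_ge0.
apply/nbhs_normP; exists (e / C); first exact: divr_gt0.
move=> B /=; rewrite distrC ltr_pdivlMr// => /(le_lt_trans _); apply.
rewrite (le_trans (enorm_le_mx_norm _))// mulrC ler_wpM2l//.
by rewrite /C lerDl.
Qed.

Lemma nbhs_enorm m n (A : 'M[R]_(m, n)) (U : set 'M[R]_(m, n)) : nbhs A U ->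
  exists2 e, 0 < e & forall B, enorm (B - A) < e -> U B.
Proof.
move=> /nbhs_normP[e /= e0 eU]; exists e => // B BA; apply: eU => /=.
by rewrite distrC (le_lt_trans (mx_norm_le_enorm _)).
Qed.

(** The ambient topology of matrices comes from the maximum norm, which is equivalent to [enorm] up
    to the number of entries. *)
Lemma cvg_enormP m n T (F : set_system T) (FF : Filter F)
    (u : T -> 'M[R]_(m, n)) (A : 'M[R]_(m, n)) :
  u @ F --> A <-> forall e : R, 0 < e -> \forall t \near F, enorm (u t - A) < e.
Proof.
split=> [uA e e0|H].
  exact: uA (enorm_cont _ e0).
move=> U /nbhs_enorm[e e0 eU]; rewrite /nbhs/= .
by apply: filterS (H _ e0) => t; exact: eU.
Qed.

Lemma enorm_continuous m n : continuous (@enorm R m n).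
Proof.
move=> A; apply/(cvgrPdist_lt (FF := nbhs_filter A)) => e e0.
near=> B; have : enorm (B - A) < e by near: B; exact: enorm_cont.
apply: le_lt_trans; rewrite ler_norml.
have := ler_enormD (A - B) B; have := ler_enormD (B - A) A.
by rewrite !subrK (enormB A) => *; lra.
Unshelve. all: by end_near. Qed.

End Enorm.

(** * Compactness of the balls and the radial projection *)

Section Ball.
Context {R : realType} {N : nat}.
Local Notation vec := 'cV[R]_N.

Lemma enorm_tr m n (A : 'M[R]_(m, n)) : enorm A^T = enorm A.
Proof.
rewrite !enormE; congr Num.sqrt; rewrite /mdot exchange_big.
by apply: eq_bigr => k _; apply: eq_bigr => l _; rewrite !mxE.
Qed.

Lemma trmx_continuous m n : continuous (@trmx R m n).
Proof.
move=> A; apply/(cvg_enormP (nbhs_filter A)) => e e0.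
near=> B; rewrite -linearB enorm_tr; near: B; exact: enorm_cont.
Unshelve. all: by end_near. Qed.

(** [bounded_closed_compact] speaks of row vectors; transposition is continuous and preserves
    [enorm], so compactness is transported through it. *)
Lemma Bj_compact j : compact (@Bj R N j).
Proof.
have cBT : compact [set v : 'rV[R]_N | Bj j v^T].
  apply: bounded_closed_compact.
    exists j%:R; split => [|M jM v /= Bv]; first exact: num_real.
    by rewrite (le_trans (mx_norm_le_enorm _))// -enorm_tr (le_trans Bv)// ltW.
  rewrite (_ : [set v | _] = (enorm \o trmx) @^-1` [set x : R | x <= j%:R]) //.
  apply: closed_comp; last exact: closed_le.
  move=> v _; apply: continuous_comp; last exact: enorm_continuous.
  exact: trmx_continuous.
have -> : @Bj R N j = trmx @` [set v : 'rV[R]_N | Bj j v^T].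
  apply/seteqP; split => [v Bv|_ [v Bv <-]//].
  by exists v^T; rewrite /= trmxK.
by apply: continuous_compact cBT; apply: continuous_subspaceT => v; exact: trmx_continuous.
Qed.

Lemma Bj0 j : @Bj R N j 0.
Proof. by rewrite /Bj /= enorm0. Qed.

Definition bproj (j : nat) (x : vec) : vec :=
  if enorm x <= j%:R then x else (j%:R / enorm x) *: x.

Lemma bproj_id j x : Bj j x -> bproj j x = x.
Proof. by rewrite /Bj /bproj /= => ->. Qed.

Lemma bprojB j x : Bj j (bproj j x).
Proof.
rewrite /Bj /bproj /=; case: (leP (enorm x)) => // jx.
have x0 : 0 < enorm x by rewrite (le_lt_trans _ jx).
by rewrite enormZ ger0_norm ?divr_ge0 ?(ltW x0)// divfK// gt_eqF.
Qed.

(** The variational inequality of the nearest-point projection onto a convex set. Outside the ball x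
    - P x is a nonnegative multiple of x, and Cauchy-Schwarz concludes. *)
Lemma bproj_var j x z : Bj j z -> mdot (x - bproj j x) (z - bproj j x) <= 0.
Proof.
rewrite /Bj /bproj /= => zj; case: (leP (enorm x)) => [_|jx].
  by rewrite subrr -(scale0r (0 : vec)) mdotZl mul0r.
have x0 : 0 < enorm x by rewrite (le_lt_trans _ jx).
set c := j%:R / enorm x.
have c1 : 0 <= 1 - c by rewrite subr_ge0 ler_pdivrMr// mul1r ltW.
have -> : x - c *: x = (1 - c) *: x by rewrite scalerBl scale1r.
rewrite mdotZl mdotDr mdotNr mdotZr -enorm_sqr mulr_ge0_le0// subr_le0.
rewrite (le_trans (mdot_CS _ _))// expr2 mulrA mulrC ler_wpM2r ?enorm_ge0//.
by rewrite /c divfK ?gt_eqF.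
Qed.

(** Test the variational inequality at x with P y and at y with P x. In x - y = ((x - P x) - (y - P
    y)) + (P x - P y) the cross term is then nonnegative. *)
Lemma bproj_lip j x y : enorm (bproj j x - bproj j y) <= enorm (x - y).
Proof.
rewrite -ler_sqr ?nnegrE ?enorm_ge0// !enorm_sqr.
have := bproj_var x (bprojB j y); have := bproj_var y (bprojB j x).
set p := bproj j x; set q := bproj j y.
have := mdot_ge0 ((x - p) - (y - q)).
have -> : x - y = ((x - p) - (y - q)) + (p - q).
  by rewrite opprB addrACA -addrA; apply/matrixP => i k; rewrite !mxE; ring.
have -> : q - p = - (p - q) by rewrite opprB.
move: (x - p) (y - q) (p - q) => a b c.
rewrite !(mdotDl, mdotDr, mdotNl, mdotNr) (mdotC c a) (mdotC c b) (mdotC b a).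
by lra.
Qed.

End Ball.

(** * Integrals of locally integrable functions *)

Section Integration.
Context {R : realType}.
Local Notation mu := (@lebesgue_measure R).
Implicit Types (u v : R -> R) (a b c s t : R).

Lemma aeS (P Q : R -> Prop) : (forall s, P s -> Q s) ->
  {ae mu, forall s, P s} -> {ae mu, forall s, Q s}.
Proof. exact: (@filterS _ _ (ae_filter_ringOfSetsType mu)). Qed.

Lemma aeS2 (P Q S : R -> Prop) : (forall s, P s -> Q s -> S s) ->
  {ae mu, forall s, P s} -> {ae mu, forall s, Q s} -> {ae mu, forall s, S s}.
Proof. exact: (@filterS2 _ _ (ae_filter_ringOfSetsType mu)). Qed.

Lemma L1loc_measurable u : L1loc u -> measurable_fun setT u.
Proof.
move=> uL; have -> : [set: R] = \bigcup_n `[- n%:R, n%:R]%classic.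
  apply/seteqP; split => // x _; exists (Num.bound `|x|) => //=.
  by rewrite in_itv/= -ler_norml ltW// archi_boundP.
apply/measurable_fun_bigcup => // n.
by have /measurable_int/measurable_EFinP := uL (- n%:R) n%:R.
Qed.

Lemma L1locD u v : L1loc u -> L1loc v -> L1loc (fun s => u s + v s).
Proof. by move=> uL vL a b; apply: (integrableD _ (uL a b) (vL a b)). Qed.

Lemma L1locZ c u : L1loc u -> L1loc (fun s => c * u s).
Proof. by move=> uL a b; apply: (integrableZl _ c (uL a b)). Qed.

Lemma L1locN u : L1loc u -> L1loc (fun s => - u s).
Proof. by move=> uL a b; apply: (integrableN (uL a b)). Qed.

Lemma L1locB u v : L1loc u -> L1loc v -> L1loc (fun s => u s - v s).
Proof. by move=> uL /L1locN; exact: L1locD. Qed.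

Lemma L1loc_norm u : L1loc u -> L1loc (fun s => `|u s|).
Proof. by move=> uL a b; apply: integrable_norm. Qed.

Lemma L1loc0 : L1loc (fun=> 0 : R).
Proof. by move=> a b; apply: integrable0. Qed.

Lemma L1loc_sum I (r : seq I) (u : I -> R -> R) :
  (forall i, L1loc (u i)) -> L1loc (fun s => \sum_(i <- r) u i s).
Proof.
move=> uL; elim: r => [|i r IHr].
  by under eq_fun do rewrite big_nil; exact: L1loc0.
by under eq_fun do rewrite big_cons; exact: L1locD.
Qed.

Lemma L1loc_le u v : measurable_fun setT u -> L1loc v ->
  {ae mu, forall s, `|u s| <= v s} -> L1loc u.
Proof.
move=> mu_ vL uv a b; apply/integrableP; split.
  by apply/measurable_EFinP; exact: measurable_funTS.
have /integrableP[mv vfin] := vL a b.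
apply: le_lt_trans vfin; apply: ae_ge0_le_integral => //.
- do 2!apply: measurableT_comp => //; exact: measurable_funTS.
- exact: measurableT_comp.
- apply: aeS _ uv => s us _ /=.
  by rewrite lee_fin (le_trans us)// ler_norm.
Qed.

Lemma L1locM u v M : L1loc u -> measurable_fun setT v ->
  (forall s, `|v s| <= M) -> L1loc (fun s => u s * v s).
Proof.
move=> uL mv vM; apply: (L1loc_le (v := fun s => M * `|u s|)).
- by apply: measurable_funM => //; exact: L1loc_measurable.
- by apply: L1locZ; exact: L1loc_norm.
- by apply: aeW => s; rewrite normrM mulrC ler_wpM2r.
Qed.

Lemma L1loc_cst c : L1loc (fun=> c).
Proof.
move=> a b; apply: measurable_bounded_integrable => //.
- by rewrite /= lebesgue_measure_itv; case: ifP => //= _; rewrite -EFinD ltry.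
- by exists `|c|; split => [|x cx ? _ /=]; [exact: num_real|exact: ltW].
Qed.

Lemma Rint_eq a b u v : (forall s, a <= s <= b -> u s = v s) ->
  Rint a b u = Rint a b v.
Proof. by move=> uv; apply: eq_Rintegral => s; rewrite inE/= in_itv/=; exact: uv. Qed.

Lemma Rint_nil a u : Rint a a u = 0.
Proof. by rewrite /Rint set_itv1 Rintegral_set1. Qed.

Lemma RintD a b u v : L1loc u -> L1loc v ->
  Rint a b (fun s => u s + v s) = Rint a b u + Rint a b v.
Proof. by move=> uL vL; rewrite /Rint RintegralD. Qed.

Lemma RintB a b u v : L1loc u -> L1loc v ->
  Rint a b (fun s => u s - v s) = Rint a b u - Rint a b v.
Proof. by move=> uL vL; rewrite /Rint RintegralB. Qed.

Lemma RintZ a b c u : L1loc u -> Rint a b (fun s => c * u s) = c * Rint a b u.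
Proof. by move=> uL; rewrite /Rint RintegralZl. Qed.

Lemma Rint_sum I (r : seq I) (u : I -> R -> R) a b :
  (forall i, L1loc (u i)) ->
  Rint a b (fun s => \sum_(i <- r) u i s) = \sum_(i <- r) Rint a b (u i).
Proof.
move=> uL; elim: r => [|i r IHr].
  rewrite big_nil; under Rint_eq do rewrite big_nil.
  rewrite -[RHS](mul0r (Rint a b (fun=> 0))) -RintZ; last exact: L1loc0.
  by apply: Rint_eq => s _; rewrite mul0r.
rewrite big_cons -IHr -RintD//; last exact: L1loc_sum.
by apply: Rint_eq => s _; rewrite big_cons.
Qed.

Lemma Rint_ge0 a b u : L1loc u ->
  {ae mu, forall s, a <= s <= b -> 0 <= u s} -> 0 <= Rint a b u.
Proof.
move=> uL u0; rewrite /Rint /Rintegral.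
suff -> : (\int[mu]_(x in `[a, b]) (u x)%:E = \int[mu]_(x in `[a, b]) `|u x|%:E)%E.
  by rewrite fine_ge0// integral_ge0.
apply: ae_eq_integral => //.
- exact: measurable_int (uL a b).
- exact: measurable_int (L1loc_norm uL a b).
- by apply: aeS _ u0 => s /= us; rewrite in_itv/= => /us/ger0_norm ->.
Qed.

Lemma Rint_le a b u v : L1loc u -> L1loc v ->
  {ae mu, forall s, a <= s <= b -> u s <= v s} -> Rint a b u <= Rint a b v.
Proof.
move=> uL vL uv; rewrite -subr_ge0 -RintB//; apply: Rint_ge0; first exact: L1locB.
by apply: aeS _ uv => s us /us; rewrite subr_ge0.
Qed.

Lemma normr_Rint a b u : L1loc u -> `|Rint a b u| <= Rint a b (fun s => `|u s|).
Proof. by move=> uL; apply: le_normr_Rintegral. Qed.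

Lemma Rint_cat b a c u : L1loc u -> a <= b -> b <= c ->
  Rint a c u = Rint a b u + Rint b c u.
Proof.
move=> uL ab bc; apply/eqP; rewrite addrC -subr_eq; apply/eqP.
rewrite /Rint Rintegral_itvB// Rintegral_itv_obnd_cbnd//.
by apply: integrableS (uL b c) => //; exact: subset_itv_oc_cc.
Qed.

Lemma Rint_subset a b c d u : L1loc u -> {ae mu, forall s, 0 <= u s} ->
  a <= c -> c <= d -> d <= b -> Rint c d u <= Rint a b u.
Proof.
move=> uL u0 ac cd db; rewrite (@Rint_cat c a b)// ?(le_trans cd)//.
rewrite (@Rint_cat d c b)//.
have : 0 <= Rint a c u by apply: Rint_ge0 => //; apply: aeS _ u0.
have : 0 <= Rint d b u by apply: Rint_ge0 => //; apply: aeS _ u0.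
by lra.
Qed.

(** Absolute continuity of the integral, applied to u cut off outside [- T, T], which is integrable
    on the whole line. *)
Lemma Rint_small T u (e : R) : L1loc u -> 0 < e -> exists2 d, 0 < d &
  forall a b, - T <= a -> a <= b -> b <= T -> b - a < d ->
    Rint a b (fun s => `|u s|) < e.
Proof.
move=> uL e0; pose w := u \_ `[- T, T].
have wL : mu.-integrable setT (EFin \o w).
  rewrite (_ : EFin \o w = (EFin \o u) \_ `[- T, T]); last first.
    by apply/funext => s; rewrite /w /= /patch; case: ifP.
  by rewrite -integrable_mkcond.
have [d [d0 dA]] := integral_normr_continuous wL e0.
exists d => // a b Ta ab bT bad.
have := dA `[a, b]%classic; rewrite /Rint (@eq_Rintegral _ _ _ mu `[a, b]%classic (fun s => `|u s|) (fun s => `|w s|)).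
  apply => //; rewrite /= lebesgue_measure_itv/=.
  by case: ifP => _; rewrite -?EFinB lte_fin.
move=> s; rewrite inE /= in_itv/= => /andP[as_ sb]; rewrite /w patchE mem_set//=.
by rewrite in_itv/= (le_trans Ta)// (le_trans sb).
Qed.

Lemma shift_measurable t : measurable_fun [set: measurableTypeR R]
  (fun s : measurableTypeR R => (s + t : measurableTypeR R)).
Proof. exact: measurable_funD. Qed.

(** The pushforward under the shift agrees with Lebesgue measure on half-open intervals, and these
    determine the measure. *)
Lemma lebesgue_shift t (A : set R) : measurable A ->
  mu ((fun s : R => s + t) @^-1` A) = mu A.
Proof.
move=> mA; apply/esym.
have mphi := @shift_measurable t.
rewrite -[RHS]/(pushforward mu (fun s : measurableTypeR R => (s + t : measurableTypeR R)) A).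
apply: lebesgue_measure_unique => //.
move=> X /ocitvP[->|[[x y] /= xy ->]].
  by rewrite !measure0.
rewrite /pushforward.
have -> : (fun s => s + t) @^-1` `]x, y] = `]x - t, y - t]%classic.
  by apply/seteqP; split => s /=; rewrite !in_itv/= ltrBlDr lerBrDr.
rewrite !lebesgue_measure_itv /= !lte_fin ltrD2r; case: ifP => // _.
by rewrite -!EFinB; congr EFin; ring.
Qed.

Lemma ae_shift t (P : R -> Prop) : {ae mu, forall s, P s} ->
  {ae mu, forall s, P (s + t)}.
Proof.
move=> [A [mA A0 PA]]; exists ((fun s : R => s + t) @^-1` A); split.
- by rewrite -[X in measurable X]setTI; exact: shift_measurable.
- by rewrite -[RHS]A0; exact: lebesgue_shift.
- by move=> s; exact: PA.
Qed.

Lemma preimage_shift_itv a b t :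
  (fun s : R => s + t) @^-1` `[a + t, b + t] = `[a, b]%classic.
Proof. by apply/seteqP; split => s /=; rewrite !in_itv/= !lerD2r. Qed.

Lemma L1loc_shift u t : L1loc u -> L1loc (fun s => u (s + t)).
Proof.
move=> uL a b; have mphi := @shift_measurable t; have mu_ := L1loc_measurable uL.
apply/integrableP; split.
  apply/measurable_EFinP; apply: measurable_funTS; exact: measurableT_comp mphi.
have /integrableP[_] := uL (a + t) (b + t); apply: le_lt_trans.
rewrite le_eqVlt; apply/orP; left; apply/eqP.
rewrite -(preimage_shift_itv a b t).
rewrite -(@ge0_integral_pushforward _ _ _ _ _ _ mphi mu _ (fun s => `|u s|%:E))//.
  by apply: eq_measure_integral => A mA _; exact: lebesgue_shift.
by do 2!apply: measurableT_comp => //; exact: measurable_funTS.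
Qed.

Lemma Rint_shift a b u t : L1loc u ->
  Rint a b (fun s => u (s + t)) = Rint (a + t) (b + t) u.
Proof.
move=> uL; have mphi := @shift_measurable t; have mu_ := L1loc_measurable uL.
congr fine; rewrite -(preimage_shift_itv a b t).
rewrite -(@integral_pushforward _ _ _ _ _ _ mphi mu _ (fun s => (u s)%:E))//.
- by apply: eq_measure_integral => A mA _; exact: lebesgue_shift.
- exact/measurable_EFinP.
- by rewrite preimage_shift_itv; exact: L1loc_shift.
Qed.

End Integration.

(** * Integrals of functions that need not be measurable *)

Section LowerIntegral.
Import HBNNSimple.
Context {R : realType}.
Local Notation mu := (@lebesgue_measure R).
Implicit Types (u v w : R -> R) (a b c s t : R).

(* [integral] of a nonnegative function is a supremum over simple functions
   below it, hence monotone a.e. even without measurability of one side. [mopt] is a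
   supremum over an uncountable set and need not be Borel. *)
Lemma integral_lower_le (D : set R) (u v : R -> \bar R) : measurable D ->
  measurable_fun D v ->
  (forall s, D s -> 0 <= u s)%E -> (forall s, D s -> 0 <= v s)%E ->
  {ae mu, forall s, D s -> (u s <= v s)%E} ->
  (\int[mu]_(s in D) u s <= \int[mu]_(s in D) v s)%E.
Proof.
move=> mD mv u0 v0 uv; rewrite (ge0_integralE mu u0).
apply: ge_ereal_sup => _ [h /= hu <-].
rewrite -integralT_nnsfun [leRHS]integral_mkcond.
apply: ae_ge0_le_integral => //=.
- by move=> s _; rewrite lee_fin.
- exact/measurable_EFinP.
- by move=> s _; rewrite patchE; case: ifP => // /set_mem; exact: v0.
- by apply/(measurable_restrictT _ _).1.
- apply: aeS _ uv => s us _; rewrite (le_trans (hu s))//.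
  rewrite !patchE; case: ifP => // /set_mem; exact: us.
Qed.

(** Here the larger function is the possibly non-measurable one. A simple function below u lies
    below v only off the exceptional null set; since u is measurable, that set is first removed from
    the domain without changing the integral of u. *)
Lemma integral_le_lower (D : set R) (u v : R -> \bar R) : measurable D ->
  measurable_fun D u ->
  (forall s, D s -> 0 <= u s)%E -> (forall s, D s -> 0 <= v s)%E ->
  {ae mu, forall s, D s -> (u s <= v s)%E} ->
  (\int[mu]_(s in D) u s <= \int[mu]_(s in D) v s)%E.
Proof.
move=> mD mu_ u0 v0 [N [mN N0 uvN]].
rewrite (ge0_negligible_integral mN mD mu_ u0 N0).
rewrite (ge0_integralE mu v0) ge0_integralE; last by move=> s [/u0].
apply: le_ereal_sup => _ [h /= hu <-]; exists h => //= s.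
rewrite (le_trans (hu s))// !patchE; case: ifPn => [|_]; last first.
  by case: ifP => // /set_mem; exact: v0.
move=> /set_mem[Ds Ns]; rewrite mem_set//.
by have := contra_not (uvN s) Ns; move/contrapT; apply.
Qed.

Lemma Rint_lower_le a b u v : (forall s, 0 <= u s) -> L1loc v ->
  {ae mu, forall s, u s <= v s} -> Rint a b u <= Rint a b v.
Proof.
move=> u0 vL uv.
have -> : Rint a b v = Rint a b (fun s => `|v s|).
  apply/le_anti/andP; split; apply: Rint_le => //; try exact: L1loc_norm.
    by apply: aeW => s _; exact: ler_norm.
  by apply: aeS _ uv => s us _; rewrite ger0_norm// (le_trans (u0 s)).
have vL' := L1loc_norm vL a b; have /integrableP[mv vfin] := vL'.
have le : (\int[mu]_(s in `[a, b]) (u s)%:E <= \int[mu]_(s in `[a, b]) `|v s|%:E)%E.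
  apply: integral_lower_le => //; [by move=> s _; rewrite lee_fin|].
  by apply: aeS _ uv => s us _; rewrite lee_fin (le_trans us)// ler_norm.
rewrite /Rint /Rintegral; apply: fine_le => //.
  rewrite ge0_fin_numE; last by apply: integral_ge0 => s _; rewrite lee_fin.
  by rewrite (le_lt_trans le)// integrable_lty.
exact: integrable_fin_num.
Qed.

(** The majorant w keeps the integral of v finite: [fine] sends an infinite integral to 0, which
    would spoil the comparison. *)
Lemma Rint_le_lower a b u v w : L1loc u -> (forall s, 0 <= u s) ->
  (forall s, 0 <= v s) -> L1loc w -> {ae mu, forall s, v s <= w s} ->
  {ae mu, forall s, u s <= v s} -> Rint a b u <= Rint a b v.
Proof.
move=> uL u0 v0 wL vw uv.
have /integrableP[mw wfin] := L1loc_norm wL a b.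
have /integrableP[mu_ ufin] := uL a b.
have le : (\int[mu]_(s in `[a, b]) (v s)%:E <= \int[mu]_(s in `[a, b]) `|w s|%:E)%E.
  apply: integral_lower_le => //; [by move=> s _; rewrite lee_fin|].
  by apply: aeS _ vw => s us _; rewrite lee_fin (le_trans us)// ler_norm.
rewrite /Rint /Rintegral; apply: fine_le => //.
- exact: integrable_fin_num.
- rewrite ge0_fin_numE; last by apply: integral_ge0 => s _; rewrite lee_fin.
  by rewrite (le_lt_trans le)// integrable_lty//; exact: L1loc_norm.
- apply: integral_le_lower => //; try by move=> s _; rewrite lee_fin.
  by apply: aeS _ uv.
Qed.

Lemma Rint_lower_subset a b c d u w : (forall s, 0 <= u s) -> L1loc w ->
  {ae mu, forall s, u s <= w s} -> a <= c -> d <= b ->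
  Rint c d u <= Rint a b u.
Proof.
move=> u0 wL uw ac db.
have fin x y : (\int[mu]_(s in `[x, y]) (u s)%:E \is a fin_num)%E.
  rewrite ge0_fin_numE; last by apply: integral_ge0 => s _; rewrite lee_fin.
  have le : (\int[mu]_(s in `[x, y]) (u s)%:E <= \int[mu]_(s in `[x, y]) `|w s|%:E)%E.
    have /integrableP[mw _] := L1loc_norm wL x y.
    apply: integral_lower_le => //; [by move=> s _; rewrite lee_fin|].
    by apply: aeS _ uw => s us _; rewrite lee_fin (le_trans us)// ler_norm.
  by rewrite (le_lt_trans le)// integrable_lty//; exact: L1loc_norm.
apply: fine_le => //; rewrite !ge0_integralE; try by move=> s _; rewrite lee_fin.
apply: le_ereal_sup => _ [h /= hu <-]; exists h => //= s.
rewrite (le_trans (hu s))// !patchE; case: ifPn => [|_]; last first.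
  by case: ifP => // _; rewrite lee_fin.
rewrite !inE/= in_itv/= => /andP[cs sd]; rewrite mem_set//= in_itv/=.
by rewrite (le_trans ac)// (le_trans sd).
Qed.

End LowerIntegral.

(** * Matrix-valued and oriented integrals *)

Section MatrixIntegral.
Context {R : realType}.
Local Notation mu := (@lebesgue_measure R).
Implicit Types (a b c s t : R).

Definition ML1loc {m n} (u : R -> 'M[R]_(m, n)) : Prop :=
  forall i j, L1loc (fun s => u s i j).

Lemma ML1locD m n (u v : R -> 'M[R]_(m, n)) :
  ML1loc u -> ML1loc v -> ML1loc (fun s => u s + v s).
Proof.
by move=> uL vL i j; under eq_fun do rewrite mxE; exact: L1locD.
Qed.

Lemma ML1locB m n (u v : R -> 'M[R]_(m, n)) :
  ML1loc u -> ML1loc v -> ML1loc (fun s => u s - v s).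
Proof.
by move=> uL vL i j; under eq_fun do rewrite 2!mxE; exact: L1locB.
Qed.

Lemma ML1loc_shift m n (u : R -> 'M[R]_(m, n)) t :
  ML1loc u -> ML1loc (fun s => u (s + t)).
Proof. by move=> uL i j; exact: (L1loc_shift (u := fun s => u s i j)). Qed.

Lemma Mint_eq m n (u v : R -> 'M[R]_(m, n)) a b :
  (forall s, a <= s <= b -> u s = v s) -> Mint a b u = Mint a b v.
Proof.
by move=> uv; apply/matrixP => i j; rewrite !mxE; apply: Rint_eq => s /uv ->.
Qed.

Lemma MintD m n (u v : R -> 'M[R]_(m, n)) a b : ML1loc u -> ML1loc v ->
  Mint a b (fun s => u s + v s) = Mint a b u + Mint a b v.
Proof.
move=> uL vL; apply/matrixP => i j; rewrite !mxE -RintD//.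
by apply: Rint_eq => s _; rewrite mxE.
Qed.

Lemma MintB m n (u v : R -> 'M[R]_(m, n)) a b : ML1loc u -> ML1loc v ->
  Mint a b (fun s => u s - v s) = Mint a b u - Mint a b v.
Proof.
move=> uL vL; apply/matrixP => i j; rewrite !mxE -RintB//.
by apply: Rint_eq => s _; rewrite !mxE.
Qed.

Lemma Mint_nil m n (u : R -> 'M[R]_(m, n)) a : Mint a a u = 0.
Proof. by apply/matrixP => i j; rewrite !mxE Rint_nil. Qed.

Lemma Mint_cat b m n (u : R -> 'M[R]_(m, n)) a c : ML1loc u ->
  a <= b -> b <= c -> Mint a c u = Mint a b u + Mint b c u.
Proof.
by move=> uL ab bc; apply/matrixP => i j; rewrite !mxE (Rint_cat (b := b)).
Qed.

Lemma Mint_shift m n (u : R -> 'M[R]_(m, n)) a b t : ML1loc u ->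
  Mint a b (fun s => u (s + t)) = Mint (a + t) (b + t) u.
Proof.
move=> uL; apply/matrixP => i j; rewrite !mxE.
exact: (@Rint_shift _ a b (fun s => u s i j) t).
Qed.

(* Duality: |v|^2 = int <v, u> <= |v| int k for v = int u. *)
Lemma enorm_Mint_le m n (u : R -> 'M[R]_(m, n)) (k : R -> R) a b :
  ML1loc u -> L1loc k ->
  {ae mu, forall s, a <= s <= b -> enorm (u s) <= k s} ->
  enorm (Mint a b u) <= Rint a b k.
Proof.
move=> uL kL uk; set v := Mint a b u.
have [v0|v0] := leP (enorm v) 0.
  rewrite (le_trans v0)//; apply: Rint_ge0 => //.
  by apply: aeS _ uk => s us /us; apply: le_trans; exact: enorm_ge0.
rewrite -(ler_pM2l v0) -expr2 enorm_sqr.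
have -> : mdot v v = Rint a b (fun s => mdot v (u s)).
  rewrite /mdot Rint_sum => [|i]; last by apply: L1loc_sum => j; exact: L1locZ.
  apply: eq_bigr => i _; rewrite Rint_sum => [|j]; last exact: L1locZ.
  by apply: eq_bigr => j _; rewrite RintZ// [in X in _ * X = _]mxE.
rewrite -RintZ//; apply: Rint_le; [|exact: L1locZ|].
  by apply: L1loc_sum => i; apply: L1loc_sum => j; exact: L1locZ.
apply: aeS _ uk => s us /us {}us.
by rewrite (le_trans (mdot_CS _ _))// ler_wpM2l// ltW.
Qed.

Lemma oMint_ge m n (u : R -> 'M[R]_(m, n)) a b : a <= b ->
  oMint a b u = Mint a b u.
Proof. by rewrite /oMint => ->. Qed.

Lemma oMint_nil m n (u : R -> 'M[R]_(m, n)) a : oMint a a u = 0.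
Proof. by rewrite oMint_ge// Mint_nil. Qed.

Lemma oMint_eq m n (u v : R -> 'M[R]_(m, n)) a b :
  (forall s, Num.min a b <= s <= Num.max a b -> u s = v s) ->
  oMint a b u = oMint a b v.
Proof.
move=> uv; rewrite /oMint; case: (leP a b) uv => _ uv; first exact: Mint_eq.
by congr (- _); exact: Mint_eq.
Qed.

Lemma oMintD m n (u v : R -> 'M[R]_(m, n)) a b : ML1loc u -> ML1loc v ->
  oMint a b (fun s => u s + v s) = oMint a b u + oMint a b v.
Proof. by move=> uL vL; rewrite /oMint !MintD//; case: ifP => _ //; rewrite opprD. Qed.

Lemma oMintB m n (u v : R -> 'M[R]_(m, n)) a b : ML1loc u -> ML1loc v ->
  oMint a b (fun s => u s - v s) = oMint a b u - oMint a b v.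
Proof. by move=> uL vL; rewrite /oMint !MintB//; case: ifP => _ //; rewrite opprB opprK addrC. Qed.

Lemma oMint_cat b m n (u : R -> 'M[R]_(m, n)) a c : ML1loc u ->
  oMint a c u = oMint a b u + oMint b c u.
Proof.
move=> uL; apply/matrixP => i j; pose F x y := Mint x y u i j.
have cat x y z : x <= y -> y <= z -> F x z = F x y + F y z.
  by move=> xy yz; rewrite /F (@Mint_cat y)// mxE.
have E x y : oMint x y u i j = if x <= y then F x y else - F y x.
  by rewrite /oMint; case: ifP => _ //; rewrite [LHS]mxE.
rewrite [RHS]mxE !E.
case: (leP a b) => ab; case: (leP b c) => bc; case: (leP a c) => ac; try lra.
- exact: cat.
- by have := cat _ _ _ ac (ltW bc); lra.
- by have := cat _ _ _ (ltW ac) ab; lra.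
- by have := cat _ _ _ (ltW ab) ac; lra.
- by have := cat _ _ _ bc (ltW ac); lra.
- by have := cat _ _ _ (ltW bc) (ltW ab); lra.
Qed.

Lemma enorm_oMint m n (u : R -> 'M[R]_(m, n)) a b :
  enorm (oMint a b u) = enorm (Mint (Num.min a b) (Num.max a b) u).
Proof. by rewrite /oMint; case: leP => _ //; rewrite enormN. Qed.

Lemma enorm_oMint_le m n (u : R -> 'M[R]_(m, n)) (k : R -> R) a b :
  ML1loc u -> L1loc k ->
  {ae mu, forall s, Num.min a b <= s <= Num.max a b -> enorm (u s) <= k s} ->
  enorm (oMint a b u) <= Rint (Num.min a b) (Num.max a b) k.
Proof. by move=> uL kL uk; rewrite enorm_oMint; exact: enorm_Mint_le. Qed.

Lemma oMint_shift m n (u : R -> 'M[R]_(m, n)) a b t : ML1loc u ->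
  oMint a b (fun s => u (s + t)) = oMint (a + t) (b + t) u.
Proof. by move=> uL; rewrite /oMint !Mint_shift// lerD2r. Qed.

End MatrixIntegral.

(** * Measurability along a path *)

Section Borel.
Context {R : realType} {N : nat}.
Local Notation vec := 'cV[R]_N.

(** Good-sets argument: the sets with Borel preimage form a sigma-algebra that contains the open
    sets. *)
Lemma borel_preimage (X Y : topologicalType) (phi : X -> Y) (B : set Y) :
  continuous phi -> <<s open >> B -> <<s open >> (phi @^-1` B).
Proof.
move=> cphi; apply: (smallest_sub (X := [set B | <<s open >> (phi @^-1` B)])).
  split => /=.
  - by rewrite preimage_set0; exact: sigma_algebra0.
  - by move=> A mA; rewrite setTD -preimage_setC -setTD; exact: sigma_algebraCD.
  - by move=> A mA; rewrite preimage_bigcup; exact: sigma_algebra_bigcup.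
by move=> U oU; apply: sub_sigma_algebra; move/continuousP : cphi; exact.
Qed.

Lemma C1_comp_measurable m n (G : @field R N m n) (x : R -> vec)
    (psi : 'M[R]_(m, n) -> R) :
  C1 G -> continuous x -> continuous psi -> measurable_fun setT (fun s => psi (G s (x s))).
Proof.
move=> mG cx cpsi; apply: (measurability _ (RGenOpens.measurableE R)).
move=> _ [_ [a [b ->] <-]]; rewrite setTI.
have oG : <<s open >> ((fun p : R * vec => G p.1 p.2) @^-1` (psi @^-1` `]a, b[)).
  apply: mG; apply: borel_preimage => //.
  apply: sub_sigma_algebra; exact: interval_open.
have : <<s open >> ((fun s : R => (s, x s)) @^-1`
    ((fun p : R * vec => G p.1 p.2) @^-1` (psi @^-1` `]a, b[))).
  by apply: borel_preimage => // s; exact: (cvg_pair (@cvg_id _ (nbhs s)) (cx s)).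
apply: (smallest_sub (X := @measurable _ (measurableTypeR R))).
  exact: sigma_algebra_measurable.
exact: open_measurable.
Qed.

End Borel.

(** * Paths and primitives *)

Section Paths.
Context {R : realType} {N : nat}.
Local Notation vec := 'cV[R]_N.

(** Uniformity on all of R is available because the paths in use are frozen outside a bounded
    interval or have the modulus theta_j everywhere. Step-path approximation and uniform limits both
    rely on one [d] for all times. *)
Definition ucont (x : R -> vec) := forall e : R, 0 < e -> exists2 d : R, 0 < d &
  forall s t, `|t - s| < d -> enorm (x t - x s) < e.

Lemma ucont_continuous x : ucont x -> continuous x.
Proof.
move=> xu s; apply/(cvg_enormP (nbhs_filter s)) => e /xu[d d0 xd].
by apply/nbhs_normP; exists d => // t /= st; apply: xd; rewrite distrC.
Qed.

Lemma ucont_bproj j x : ucont x -> ucont (fun s => bproj j (x s)).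
Proof.
move=> xu e /xu[d d0 xd]; exists d => // s t /xd; apply: le_lt_trans.
exact: bproj_lip.
Qed.

(** The entrywise l^1 norm integrates coordinate by coordinate, which suits the scalar
    total-variation formula. *)
Definition lsum {m n} (u : R -> 'M[R]_(m, n)) (s : R) : R := \sum_i \sum_j `|u s i j|.

Lemma lsum_L1loc m n (u : R -> 'M[R]_(m, n)) : ML1loc u -> L1loc (lsum u).
Proof.
by move=> uL; do 2!(apply: L1loc_sum => ?); exact: L1loc_norm.
Qed.

Lemma lsum_ge0 m n (u : R -> 'M[R]_(m, n)) s : 0 <= lsum u s.
Proof. by rewrite sumr_ge0// => i _; rewrite sumr_ge0. Qed.

Lemma enorm_lsum m n (u : R -> 'M[R]_(m, n)) s : enorm (u s) <= lsum u s.
Proof. exact: enorm_le_sum. Qed.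

Lemma comp_ML1loc m n (G : @field R N m n) j mb x : C1 G -> mbound G (Bj j) mb ->
  ucont x -> (forall t, Bj j (x t)) -> ML1loc (fun s => G s (x s)).
Proof.
move=> mG [mbL Gmb] xu xj i k; apply: L1loc_le mbL _.
  apply: (C1_comp_measurable (psi := fun A : 'M[R]_(m, n) => A i k)) => //.
    exact: ucont_continuous.
  exact: coord_continuous.
by apply: aeS _ Gmb => s /(_ _ (xj s)); apply: le_trans; exact: le_enorm.
Qed.

Lemma comp_bproj_ML1loc m n (G : @field R N m n) j x : C1 G -> C2 G -> ucont x ->
  ML1loc (fun s => G s (bproj j (x s))).
Proof.
move=> mG /(_ _ (@Bj_compact R N j))[mb Gmb] xu.
apply: (@comp_ML1loc _ _ G j mb (fun s => bproj j (x s))) => //.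
- exact: ucont_bproj.
- by move=> t; exact: bprojB.
Qed.

Definition clamp (a b s : R) := Num.max a (Num.min b s).

Lemma clamp_id a b s : a <= s <= b -> clamp a b s = s.
Proof. by move=> /andP[as_ sb]; rewrite /clamp min_r// max_r. Qed.

Lemma clamp_itv a b s : a <= b -> a <= clamp a b s <= b.
Proof.
by move=> ab; rewrite /clamp le_max lexx/= ge_max ab ge_min lexx.
Qed.

Lemma clamp_lip a b s t : a <= b -> `|clamp a b t - clamp a b s| <= `|t - s|.
Proof.
move=> ab; wlog st : s t / s <= t.
  by move=> H; case: (leP s t) => [/H//|/ltW/H]; rewrite distrC [leRHS]distrC.
rewrite (ger0_norm (_ : 0 <= t - s)) ?subr_ge0// /clamp ler_norml.
apply/andP; split; case: (leP b s) => bs; case: (leP b t) => bt;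
  case: (leP a b) => ?; case: (leP a s) => ?; case: (leP a t) => ?; lra.
Qed.

Lemma primitive_lip (u : R -> vec) a b : ML1loc u ->
  enorm (oMint a b u) <= Rint (Num.min a b) (Num.max a b) (lsum u).
Proof.
move=> uL; apply: enorm_oMint_le => //; first exact: lsum_L1loc.
by apply: aeW => s _; exact: enorm_lsum.
Qed.

Lemma primitive_ucont (u : R -> vec) y0 T : 0 <= T -> ML1loc u ->
  ucont (fun t => y0 + oMint 0 (clamp (- T) T t) u).
Proof.
move=> T0 uL e e0.
have [d d0 ud] := Rint_small T (lsum_L1loc uL) e0.
exists d => // s t std.
have TT : - T <= T by lra.
have := clamp_lip s t TT; have := clamp_itv s TT; have := clamp_itv t TT.
set s' := clamp _ _ s; set t' := clamp _ _ t => /andP[? ?] /andP[? ?] s't'.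
rewrite opprD addrACA subrr add0r (@oMint_cat _ s' _ _ _ 0 t')//.
rewrite [X in X - _]addrC addrK (le_lt_trans (primitive_lip _ _ uL))//.
have -> : Rint (Num.min s' t') (Num.max s' t') (lsum u) =
    Rint (Num.min s' t') (Num.max s' t') (fun s => `|lsum u s|).
  by apply: Rint_eq => r _; rewrite ger0_norm// lsum_ge0.
have := le_lt_trans s't' std; rewrite ltr_norml => /andP[lo hi].
by case: (leP s' t') => st; apply: ud => //; lra.
Qed.

Lemma Rint_half_lsum m n (u : R -> 'M[R]_(m, n)) T t : ML1loc u -> `|t| <= T ->
  Rint (Num.min 0 t) (Num.max 0 t) (lsum u) <= Rint (- T) T (lsum u).
Proof.
move=> uL; rewrite ler_norml => /andP[Tt tT]; apply: Rint_subset.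
- exact: lsum_L1loc.
- by apply: aeW => s; exact: lsum_ge0.
- by case: (leP 0 t) => ?; lra.
- by case: (leP 0 t) => ?; lra.
- by case: (leP 0 t) => ?; lra.
Qed.

End Paths.

(** * Gronwall's lemma and Picard iteration *)

Section Gronwall.
Context {R : realType}.
Local Notation mu := (@lebesgue_measure R).
Implicit Types (l w : R -> R) (a b h s t T : R).

Lemma geo_small (C e : R) : 0 < e -> exists k, C * 2^-1 ^+ k < e.
Proof.
move=> e0; exists (Num.bound `|C / e|).
rewrite exprVn ltr_pdivrMr ?exprn_gt0// mulrC -ltr_pdivrMr//.
rewrite (le_lt_trans (ler_norm _))// (lt_trans (archi_boundP (normr_ge0 _)))//.
by rewrite -natrX ltr_nat ltn_expl.
Qed.

Lemma mesh_ex T d : 0 < d -> exists2 n : nat, (0 < n)%N & T / n%:R < d.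
Proof.
move=> d0; exists (Num.bound `|T / d|).+1 => //.
rewrite ltr_pdivrMr ?ltr0Sn// mulrC -ltr_pdivrMr//.
rewrite (le_lt_trans (ler_norm _))// (lt_trans (archi_boundP (normr_ge0 _)))//.
by rewrite ltr_nat.
Qed.

(* w jumps by a factor 2 on each cell of mass at most 1/4; for the norm weighted
   by w the integral operator with kernel l is a 1/2-contraction, which replaces
   the exponential in Gronwall's lemma and gives a bound depending only on n. *)
Lemma weight_ex n h l : 0 <= h -> L1loc l -> (forall s, 0 <= l s) ->
  (forall a b, - (n%:R * h) <= a -> a <= b -> b <= n%:R * h -> b - a <= h ->
    Rint a b l <= 4^-1) ->
  exists w, [/\ measurable_fun setT w, forall t, 1 <= w t <= 2 ^+ n &
    forall t, `|t| <= n%:R * h ->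
      Rint (Num.min 0 t) (Num.max 0 t) (fun s => l s * w s) <= w t / 2].
Proof.
move=> h0 lL l0; elim: n => [|n IHn] lh.
  exists (fun=> 1); split => // [t|t]; first by rewrite expr0 lexx.
  rewrite mul0r normr_le0 => /eqP ->; rewrite minxx maxxx Rint_nil.
  by rewrite divr_ge0.
have nS : n.+1%:R * h = n%:R * h + h by rewrite -natr1 mulrDl mul1r.
have nh0 : 0 <= n%:R * h by rewrite mulr_ge0.
have [|w [mw w1 wI]] := IHn.
  by move=> a b *; apply: lh => //; rewrite nS; lra.
pose W : R := 2 ^+ n.+1.
have W0 : 0 < W by rewrite exprn_gt0.
have W2 : 2 ^+ n = W / 2 by rewrite /W exprS mulrC mulKf.
pose w' t := if `|t| <= n%:R * h then w t else W.
have w'1 t : 1 <= w' t <= W.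
  rewrite /w'; case: ifP => _.
    by have /andP[-> /=] := w1 t; rewrite W2; lra.
  by rewrite lexx andbT exprn_ege1// ler1n.
have mw' : measurable_fun setT w'.
  apply: measurable_fun_ifT => //.
  by apply: measurable_fun_ler => //; exact: measurableT_comp.
have lwL : L1loc (fun s => l s * w' s).
  apply: (@L1locM _ l w' W) => // s.
  by have /andP[? ?] := w'1 s; rewrite ger0_norm//; lra.
exists w'; split => // t; rewrite nS => tS.
have wE a b : - (n%:R * h) <= a -> b <= n%:R * h ->
    Rint a b (fun s => l s * w' s) = Rint a b (fun s => l s * w s).
  move=> ? ?; apply: Rint_eq => s /andP[? ?].
  by rewrite /w' ifT// ler_norml; apply/andP; split; lra.
(* A cell of the new layer has mass at most 1/4 and weight at most W, hence contributes at most W /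
   4. The inner layers contribute at most 2 ^+ n / 2 = W / 4, and the sum is half the new weight. *)
have wW a b : - (n.+1%:R * h) <= a -> a <= b -> b <= n.+1%:R * h -> b - a <= h ->
    Rint a b (fun s => l s * w' s) <= W / 4.
  move=> ? ? ? ?; have H : W * Rint a b l <= W / 4 by rewrite ler_pM2l//; exact: lh.
  apply: le_trans H; rewrite -RintZ//; apply: Rint_le => //; first exact: L1locZ.
  by apply: aeW => s _; rewrite mulrC ler_wpM2r//; have /andP[] := w'1 s.
have [tn|tn] := leP `|t| (n%:R * h).
  rewrite wE; [|by move: tn; rewrite ler_norml; case: (leP 0 t) => ? /andP[]; lra|
                by move: tn; rewrite ler_norml; case: (leP 0 t) => ? /andP[]; lra].
  by rewrite /w' tn; exact: wI.
have -> : w' t = W by rewrite /w' leNgt tn.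
have [t0|t0] := leP 0 t.
  rewrite ger0_norm// in tn tS.
  rewrite (@Rint_cat _ (n%:R * h))//; last exact: ltW.
  have := wI (n%:R * h); rewrite ger0_norm// lexx min_l// max_r// => /(_ isT).
  rewrite -wE//; last lra.
  have := wW (n%:R * h) t; rewrite nS => H1 H2.
  have {}H1 := H1 ltac:(lra) ltac:(lra) ltac:(lra) ltac:(lra).
  have /andP[_] := w1 (n%:R * h); rewrite W2; lra.
rewrite ltr0_norm// in tn tS.
rewrite (@Rint_cat _ (- (n%:R * h)))//; [|lra|lra].
have := wI (- (n%:R * h)); rewrite normrN ger0_norm// lexx.
rewrite min_r ?max_l; [|lra|lra]; move=> /(_ isT).
rewrite -wE//.
have := wW t (- (n%:R * h)); rewrite nS => H1 H2.
have {}H1 := H1 ltac:(lra) ltac:(lra) ltac:(lra) ltac:(lra).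
have /andP[_] := w1 (- (n%:R * h)); rewrite W2; lra.
Qed.

(** Let S be the supremum of |u| / w, finite thanks to the a priori bound [B]. The weight yields |u|
    <= a + S w / 2, hence S <= a + S / 2 and S <= 2 a. The value of [B] does not enter the result,
    so it may depend on the solution at hand. *)
Lemma gronwall n h l p q (u phi : R -> 'M[R]_(p, q)) (a B al be : R) :
  0 <= h -> L1loc l -> (forall s, 0 <= l s) ->
  (forall a b, - (n%:R * h) <= a -> a <= b -> b <= n%:R * h -> b - a <= h ->
    Rint a b l <= 4^-1) ->
  - (n%:R * h) <= al -> al <= 0 -> 0 <= be -> be <= n%:R * h -> 0 <= a ->
  ML1loc phi ->
  (forall t, al <= t <= be -> enorm (u t) <= B) ->
  (forall t, al <= t <= be -> enorm (u t) <= a + enorm (oMint 0 t phi)) ->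
  {ae mu, forall s, al <= s <= be -> enorm (phi s) <= l s * enorm (u s)} ->
  forall t, al <= t <= be -> enorm (u t) <= 2 * a * 2 ^+ n.
Proof.
move=> h0 lL l0 lh nal al0 be0 ben a0 phiL uB ua uphi.
have [w [mw w1 wI]] := weight_ex h0 lL l0 lh.
have w0 t : 0 < w t by have /andP[? _] := w1 t; lra.
pose E := [set enorm (u t) / w t | t in [set t | al <= t <= be]].
have Eub : ubound E B.
  move=> _ [t /= tab <-]; rewrite ler_pdivrMr// (le_trans (uB _ tab))//.
  have := enorm_ge0 (u t); have := uB _ tab; have /andP[w1t _] := w1 t.
  by move=> *; rewrite ler_peMr//; lra.
have E0 : has_sup E.
  by split; [exists (enorm (u 0) / w 0); exists 0 => //=; lra|exists B].
set S := sup E.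
have uS t : al <= t <= be -> enorm (u t) <= S * w t.
  by move=> tab; rewrite -ler_pdivrMr//; apply: ub_le_sup; [exists B|exists t].
have lwL : L1loc (fun s => l s * w s).
  apply: (@L1locM _ l w (2 ^+ n)) => // s.
  by have /andP[? ?] := w1 s; rewrite ger0_norm//; lra.
have S0 : 0 <= S.
  rewrite -(pmulr_lge0 _ (w0 0)) (le_trans (enorm_ge0 (u 0)))//; apply: uS.
  by rewrite al0 be0.
have step t : al <= t <= be -> enorm (u t) <= a + S * (w t / 2).
  move=> /[dup] tab /andP[alt tbe]; rewrite (le_trans (ua _ tab))// lerD2l.
  have tn : `|t| <= n%:R * h by rewrite ler_norml; apply/andP; split; lra.
  apply: (le_trans _ (ler_wpM2l S0 (wI _ tn))); rewrite -RintZ//.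
  apply: enorm_oMint_le => //; first exact: L1locZ.
  apply: aeS _ uphi => s us sab.
  have {}sab : al <= s <= be.
    by move: sab; case: (leP 0 t) => ? /andP[? ?]; apply/andP; split; lra.
  rewrite (le_trans (us sab))// mulrCA ler_wpM2l//; exact: uS.
have S2 : S <= a + S / 2.
  apply: ge_sup; first by case: E0.
  move=> _ [t /= tab <-]; rewrite ler_pdivrMr// (le_trans (step _ tab))//.
  have /andP[w1t _] := w1 t.
  have -> : (a + S / 2) * w t = a * w t + S * (w t / 2) by field.
  by rewrite lerD2r ler_peMr.
move=> t tab; rewrite (le_trans (uS _ tab))//.
have /andP[w1t w2t] := w1 t.
by apply: ler_pM => //; lra.
Qed.

Lemma geo_lim p q (v : nat -> 'M[R]_(p, q)) C :
  (forall k, enorm (v k.+1 - v k) <= C * 2^-1 ^+ k) ->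
  exists z, forall k, enorm (z - v k) <= 2 * C * 2^-1 ^+ k.
Proof.
move=> vC.
have C0 : 0 <= C by have := vC 0; rewrite expr0 mulr1; apply: le_trans; exact: enorm_ge0.
have pk k : 0 <= 2^-1 ^+ k :> R by rewrite exprn_ge0// invr_ge0.
(* The bound is the exact partial sum of the geometric series, which lets the induction on i
   close. *)
have vi k i : enorm (v (k + i)%N - v k) <= 2 * C * (2^-1 ^+ k - 2^-1 ^+ (k + i)).
  elim: i => [|i IHi]; first by rewrite addn0 !subrr mulr0 enorm0.
  rewrite addnS (le_trans (ler_enorm_dist (v (k + i)%N) _ _))//.
  have := vC (k + i)%N; rewrite exprS; move: IHi.
  by set X := 2^-1 ^+ (k + i); set Y := 2^-1 ^+ k; lra.
have vi2 k n : (k <= n)%N -> enorm (v n - v k) <= 2 * C * 2^-1 ^+ k.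
  move=> kn; have := vi k (n - k)%N; rewrite subnKC// => /le_trans; apply.
  by rewrite ler_wpM2l ?mulr_ge0// gerBl.
have : cvg (v @ \oo).
  apply/cauchy_cvgP/cauchy_exP => e e0.
  have [k ke] := geo_small (2 * C) e0.
  exists (v k); exists k => // n /= kn.
  rewrite -ball_normE /= distrC.
  by rewrite (le_lt_trans (mx_norm_le_enorm _))// (le_lt_trans (vi2 _ _ kn)).
move=> /cvg_ex[z vz]; exists z => k; apply/ler_addgt0Pl => e e0.
have /cvg_enormP/(_ _ e0)[n _ vn] := vz.
rewrite (le_trans (ler_enorm_dist (v (maxn k n)) _ _))// lerD//.
  by rewrite enormB ltW//; apply: vn => /=; exact: leq_maxr.
by apply: vi2; exact: leq_maxl.
Qed.

End Gronwall.

Section Picard.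
Context {R : realType} {N : nat}.
Local Notation vec := 'cV[R]_N.
Local Notation mu := (@lebesgue_measure R).
Implicit Types (l : R -> R) (T s t : R).

(** Absolute continuity provides the cells of mass at most 1/4 from which the weight is built. *)
Lemma L1loc_mesh l T : L1loc l -> (forall s, 0 <= l s) -> 0 <= T ->
  exists n : nat, exists h, [/\ 0 <= h, n%:R * h = T & forall a b, - (n%:R * h) <= a ->
    a <= b -> b <= n%:R * h -> b - a <= h -> Rint a b l <= 4^-1].
Proof.
move=> lL l0 T0; have [|d d0 ld] := @Rint_small _ T l 4^-1 lL; first by rewrite invr_gt0.
have [n n0 nd] := mesh_ex T d0.
have nT : n%:R * (T / n%:R) = T by rewrite mulrC divfK// pnatr_eq0 -lt0n.
exists n, (T / n%:R); rewrite nT; split => //; first by rewrite divr_ge0.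
move=> a b Ta ab bT bah; rewrite ltW//; have := ld a b Ta ab bT (le_lt_trans bah nd).
by apply: le_lt_trans; apply: Rint_le => //; [exact: L1loc_norm|
  apply: aeW => s _; exact: ler_norm].
Qed.

Lemma ucont_cst (c : vec) : ucont (fun=> c).
Proof. by move=> e e0; exists 1 => // s t _; rewrite subrr enorm0. Qed.

Lemma ucont_lim (Y : nat -> R -> vec) (y : R -> vec) C :
  (forall k, ucont (Y k)) -> (forall k t, enorm (y t - Y k t) <= C * 2^-1 ^+ k) ->
  ucont y.
Proof.
move=> Yu yY e e0; have e30 : 0 < e / 3 by rewrite divr_gt0.
have [k kC] := geo_small C e30; have [d d0 Yd] := Yu k _ e30.
exists d => // s t std.
have := ler_enorm_dist (Y k t) (y t) (y s).
have := ler_enorm_dist (Y k s) (Y k t) (y s).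
have := yY k t; have := yY k s; rewrite (enormB (y s)); have := Yd s t std.
by lra.
Qed.

(** Clamping time makes every iterate a uniformly continuous path on R, so integrability of phi is
    asked along such paths only. In the norm weighted by w the differences of successive iterates
    halve; as the iterates are frozen outside [- T, T], they converge uniformly on R. *)
Lemma picard T l (phi : R -> vec -> vec) (y0 : vec) : 0 <= T ->
  L1loc l -> (forall s, 0 <= l s) ->
  (forall y, ucont y -> ML1loc (fun s => phi s (y s))) ->
  {ae mu, forall s, forall y y', enorm (phi s y - phi s y') <= l s * enorm (y - y')} ->
  exists2 y, ucont y &
    forall t, y t = y0 + oMint 0 (clamp (- T) T t) (fun s => phi s (y s)).
Proof.
move=> T0 lL l0 phiL philip.
have [n [h [h0 nhT lh]]] := L1loc_mesh lL l0 T0.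
have [w [mw w1 wI]] := weight_ex h0 lL l0 lh.
have w0 t : 0 < w t by have /andP[? _] := w1 t; lra.
rewrite nhT in wI.
have TT : - T <= T by lra.
pose A (y : R -> vec) t := y0 + oMint 0 (clamp (- T) T t) (fun s => phi s (y s)).
pose Y := fix Y k := if k is k'.+1 then A (Y k') else fun=> y0.
have Au y : ucont y -> ucont (A y) by move=> yu; exact: primitive_ucont (phiL _ yu).
have Yu k : ucont (Y k) by elim: k => [|k IHk]; [exact: ucont_cst|exact: Au].
have clampK t : clamp (- T) T (clamp (- T) T t) = clamp (- T) T t.
  by rewrite clamp_id//; exact: clamp_itv.
have lwL : L1loc (fun s => l s * w s).
  apply: (@L1locM _ l w (2 ^+ n)) => // s.
  by have /andP[? ?] := w1 s; rewrite ger0_norm//; lra.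
have Adiff y y' t : ucont y -> ucont y' ->
    A y t - A y' t = oMint 0 (clamp (- T) T t) (fun s => phi s (y s) - phi s (y' s)).
  move=> yu yu'; rewrite /A opprD addrACA subrr add0r oMintB//; exact: phiL.
pose M := Rint (- T) T (lsum (fun s => phi s y0)).
have M0 : 0 <= M.
  apply: Rint_ge0; first exact/lsum_L1loc/phiL/ucont_cst.
  by apply: aeW => s _; exact: lsum_ge0.
have D0 t : enorm (Y 1 t - Y 0 t) <= M.
  rewrite /= /A addrAC subrr add0r.
  have phi0 := phiL _ (ucont_cst y0).
  apply: (le_trans (primitive_lip _ _ phi0)); apply: Rint_half_lsum => //.
  by rewrite ler_norml; exact: clamp_itv.
have Dk k t : `|t| <= T -> enorm (Y k.+1 t - Y k t) <= M * 2^-1 ^+ k * w t.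
  elim: k t => [|k IHk] t tT.
    rewrite expr0 mulr1 (le_trans (D0 t))// ler_peMr//; have /andP[] := w1 t => //.
  have tcl : clamp (- T) T t = t by rewrite clamp_id// -ler_norml.
  rewrite [Y k.+2]/(A (Y k.+1)) {2}[Y k.+1]/(A (Y k)) Adiff// tcl.
  have -> : M * 2^-1 ^+ k.+1 * w t = M * 2^-1 ^+ k * (w t / 2).
    by rewrite exprS; field.
  have Mk : 0 <= M * 2^-1 ^+ k by rewrite mulr_ge0// exprn_ge0// invr_ge0.
  apply: (le_trans _ (ler_wpM2l Mk (wI _ tT))); rewrite -RintZ//.
  apply: enorm_oMint_le; [by apply: ML1locB; exact: phiL|exact: L1locZ|].
  apply: aeS _ philip => s phis sab; rewrite (le_trans (phis _ _))//.
  rewrite mulrCA ler_wpM2l// IHk//; move: sab tT; rewrite !ler_norml.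
  by case: (leP 0 t) => ? /andP[? ?] /andP[? ?]; apply/andP; split; lra.
have YclE k t : Y k t = Y k (clamp (- T) T t).
  by case: k => [//|k] /=; rewrite /A clampK.
have Dk' k t : enorm (Y k.+1 t - Y k t) <= M * 2 ^+ n * 2^-1 ^+ k.
  rewrite (YclE k) (YclE k.+1) (le_trans (Dk _ _ _))//.
    by rewrite ler_norml; exact: clamp_itv.
  rewrite [leRHS]mulrAC ler_wpM2l//; first by rewrite mulr_ge0// exprn_ge0// invr_ge0.
  by have /andP[] := w1 (clamp (- T) T t).
set C := M * 2 ^+ n in Dk'.
have /choice[y yY] : forall t, exists z, forall k, enorm (z - Y k t) <= 2 * C * 2^-1 ^+ k.
  by move=> t; apply: geo_lim => k; exact: Dk'.
have yu : ucont y by apply: (ucont_lim Yu) => k t; exact: yY.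
exists y => // t; apply/eqP; rewrite -subr_eq0; apply/eqP/enorm_eq0.
apply/ler_addgt0Pl => e e0; rewrite addr0 -/(A y t).
pose L := Rint (- T) T l.
(* The error of Y k.+1 is at most 2 C 2^-k, and the integral operator with kernel l turns the error
   of Y k into at most L times that bound. *)
have [k kC] := geo_small (2 * C * (1 + L)) e0.
have C0 : 0 <= C by rewrite mulr_ge0// exprn_ge0.
have pk : 0 <= 2^-1 ^+ k :> R by rewrite exprn_ge0// invr_ge0.
apply: le_trans (ltW kC); apply: (le_trans (ler_enorm_dist (Y k.+1 t) _ _)).
rewrite mulrDr mulr1 mulrDl; apply: lerD.
  rewrite (le_trans (yY t k.+1))// exprS ler_wpM2l ?mulr_ge0//.
  by rewrite ler_piMl// invf_le1// ler1n.
rewrite [Y k.+1]/(A (Y k)) Adiff//.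
have cT : - T <= clamp (- T) T t <= T by exact: clamp_itv.
set c := clamp (- T) T t in cT *; have /andP[c1 c2] := cT.
pose K := 2 * C * 2^-1 ^+ k.
have K0 : 0 <= K by rewrite !mulr_ge0.
have H : enorm (oMint 0 c (fun s => phi s (Y k s) - phi s (y s))) <=
    Rint (Num.min 0 c) (Num.max 0 c) (fun s => K * l s).
  apply: enorm_oMint_le; [by apply: ML1locB; exact: phiL|exact: L1locZ|].
  apply: aeS _ philip => s phis _; rewrite (le_trans (phis _ _))// mulrC ler_wpM2r//.
  by rewrite enormB yY.
apply: (le_trans H); rewrite RintZ// [leRHS]mulrAC ler_wpM2l//.
apply: Rint_subset => //; first exact: aeW.
all: by case: (leP 0 c) => ?; lra.
Qed.

End Picard.

(** * Moduli of continuity and seminorms *)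

Section EquiBounds.
Context {R : realType}.

(** Cut [a, b] into pieces shorter than the d that belongs to mass 1: their number does not depend
    on tau. *)
Lemma L1equi_bounded (ms : R -> R -> R) T : (forall tau, L1loc (ms tau)) ->
  L1equi ms -> exists C, forall tau a b, - T <= a -> a <= b -> b <= T ->
    Rint a b (ms tau) <= C.
Proof.
move=> msL [ms0 msE].
have [||d d0 msd] := msE (`|T| + 1) 1; [by rewrite ltr_wpDl|by []|].
have [n n0 nd] := mesh_ex (2 * `|T|) d0.
set h := _ / _ in nd; have TT := ler_norm T.
have h0 : 0 <= h by rewrite divr_ge0// mulr_ge0.
have step k tau a b : - T <= a -> a <= b -> b <= T -> b - a <= k%:R * h ->
    Rint a b (ms tau) <= k%:R.
  elim: k a b => [|k IHk] a b Ta ab bT.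
    rewrite mul0r => ba; have -> : a = b by lra.
    by rewrite Rint_nil.
  rewrite -natr1 mulrDl mul1r => bak.
  have [bah|bah] := leP (b - a) h.
    apply: (@le_trans _ _ 1); last by rewrite lerDr.
    by rewrite ltW//; apply: msd; lra.
  rewrite (@Rint_cat _ (b - h))//; [|lra|lra].
  apply: lerD; first by apply: IHk; lra.
  by rewrite ltW//; apply: msd; lra.
exists n%:R => tau a b Ta ab bT; apply: step => //.
by rewrite /h mulrC divfK ?pnatr_eq0 -?lt0n//; lra.
Qed.

End EquiBounds.

Section Moduli.
Context {R : realType} {N : nat} (f : @field R N N 1).
Local Notation vec := 'cV[R]_N.
Local Notation mu := (@lebesgue_measure R).
Hypothesis fE : equi_mbounds f.
Local Notation theta j := (Theta f j 0 0).

Lemma mopt_ge0 j t : 0 <= mopt f j t.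
Proof.
rewrite /mopt; set E := [set _ | _ in _].
have [hE|hE] := pselect (has_ubound E).
  apply: (@le_trans _ _ (enorm (f t 0))); first exact: enorm_ge0.
  by apply: ub_le_sup => //; exists 0 => //; exact: Bj0.
(* By convention [sup] is 0 on a set without an upper bound. *)
by rewrite sup_out// => -[].
Qed.

Lemma equi_mbound m n (F : @field R N m n) j : equi_mbounds F ->
  exists mb, mbound F (Bj j) mb.
Proof.
move=> /(_ j)[ms [/(_ 0) mF _]]; exists (ms 0).
by move: mF; rewrite /mbound /trans; under eq_near do rewrite addr0.
Qed.

Lemma mopt_le j mb : mbound f (Bj j) mb -> {ae mu, forall t, mopt f j t <= mb t}.
Proof.
move=> [mbL fmb]; apply: aeS _ fmb => t ft; apply: ge_sup.
  by exists (enorm (f t 0)); exists 0 => //; exact: Bj0.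
by move=> _ [x Bx <-]; exact: ft.
Qed.

Lemma le_mopt j : {ae mu, forall t, forall x, Bj j x -> enorm (f t x) <= mopt f j t}.
Proof.
have [mb [mbL fmb]] := equi_mbound j fE.
apply: aeS _ fmb => t ft x Bx; apply: ub_le_sup; last by exists x.
by exists (mb t) => _ [z Bz <-]; exact: ft.
Qed.

(** Shifted back by t, the bound [ms t] of f_t is an m-bound of f, so the optimal bound lies below
    it almost everywhere. A window at any t is thus reduced to [0, s], where equicontinuity
    applies. *)
Lemma Rint_mopt_le j ms t s : (forall tau, mbound (trans f tau) (Bj j) (ms tau)) ->
  Rint t (t + s) (mopt f j) <= Rint 0 s (ms t).
Proof.
move=> /(_ t)[mL fm].
have -> : Rint 0 s (ms t) = Rint t (t + s) (fun u => ms t (u - t)).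
  by rewrite (Rint_shift _ _ (- t) mL) subrr addrAC subrr add0r.
apply: Rint_lower_le; [exact: mopt_ge0|exact: L1loc_shift|].
apply: mopt_le; split; first exact: L1loc_shift.
by apply: aeS _ (ae_shift (- t) fm) => u; rewrite /trans subrK.
Qed.

Lemma theta_has_sup j s : 0 <= s ->
  has_sup [set Rint t (t + s) (mopt f j) | t in [set: R]].
Proof.
move=> s0; split; first by exists (Rint 0 (0 + s) (mopt f j)); exists 0.
have [ms [fms msE]] := fE j.
have [|C HC] := @L1equi_bounded _ ms s _ msE; first by move=> tau; case: (fms tau).
exists C => _ [t _ <-]; apply: (le_trans (Rint_mopt_le t s fms)).
by apply: HC; lra.
Qed.

Lemma Rint_mopt_theta j a b : a <= b -> Rint a b (mopt f j) <= theta j (b - a).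
Proof.
move=> ab; have ba0 : 0 <= b - a by lra.
apply: ub_le_sup; first by have [] := theta_has_sup j ba0.
by exists a => //; congr (Rint _ _ _); lra.
Qed.

Lemma theta_ge0 j s : 0 <= s -> 0 <= theta j s.
Proof.
move=> s0; have := @Rint_mopt_theta j 0 s s0; rewrite subr0; apply: le_trans.
by apply: Rintegral_ge0 => t _; exact: mopt_ge0.
Qed.

Lemma theta_mono j s s' : 0 <= s -> s <= s' -> theta j s <= theta j s'.
Proof.
move=> s0 ss'; have [mb mbf] := equi_mbound j fE.
apply: ge_sup; first by have [] := @theta_has_sup j s s0.
move=> _ [t _ <-]; have [mbL _] := mbf.
apply: (@le_trans _ _ (Rint t (t + s') (mopt f j))).
  by apply: Rint_lower_subset mbL (mopt_le mbf) _ _ => //; [exact: mopt_ge0|lra].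
by apply: ub_le_sup; [have [] := @theta_has_sup j s' (le_trans s0 ss')|exists t].
Qed.

(** All windows reduce to [0, s]; for s < 1 these lie in [- 1, 1], where equicontinuity gives one d
    for all translates. *)
Lemma theta_small j (e : R) : 0 < e ->
  exists2 d : R, 0 < d & forall s, 0 <= s -> s < d -> theta j s <= e.
Proof.
move=> e0; have [ms [fms [ms0 msE]]] := fE j.
have [d d0 msd] := msE 1 e ltr01 e0.
exists (Num.min d 1); first by rewrite lt_min d0 ltr01.
move=> s s0; rewrite lt_min => /andP[sd s1]; apply: ge_sup.
  by have [] := @theta_has_sup j s s0.
move=> _ [t _ <-]; apply: (le_trans (Rint_mopt_le t s fms)); apply: ltW.
by apply: msd; lra.
Qed.

(* Unlike the paper's K^I_j, the paths are defined on all of R: a path on I is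
   extended by its end values, i.e. composed with [clamp]. *)
Definition GK (j : nat) (x : R -> vec) := (forall t, Bj j (x t)) /\
  forall s t, enorm (x t - x s) <= theta j `|t - s|.

Lemma GK_ucont j x : GK j x -> ucont x.
Proof.
move=> [_ xth] e e0; have e20 : 0 < e / 2 by rewrite divr_gt0.
have [d d0 thd] := @theta_small j _ e20.
exists d => // s t std; rewrite (le_lt_trans (xth _ _))//.
by rewrite (le_lt_trans (thd _ _ std))//; lra.
Qed.

Lemma GK_Kset j x q1 q2 : GK j x -> Kset (Theta f) j q1 q2 x.
Proof.
move=> xK; split; first exact/continuous_subspaceT/ucont_continuous/(GK_ucont xK).
by case: xK => xj xth; split => // s t _ _; exact: xth.
Qed.

Lemma Kset_GK j x q1 q2 : q1 < q2 -> Kset (Theta f) j q1 q2 x ->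
  GK j (fun s => x (clamp (ratr q1) (ratr q2) s)).
Proof.
move=> q12 [_ [xj xth]].
have q12' : (ratr q1 : R) <= ratr q2 by rewrite ler_rat ltW.
have cI s : Iq q1 q2 (clamp (ratr q1 : R) (ratr q2) s).
  by rewrite /Iq /= in_itv/=; exact: clamp_itv.
split=> [t|s t]; first exact: xj.
apply: (le_trans (xth _ _ (cI s) (cI t))).
by apply: theta_mono; rewrite ?normr_ge0//; exact: clamp_lip.
Qed.

Lemma GK_cst j c : Bj j c -> GK j (fun=> c).
Proof. by move=> jc; split=> // s t; rewrite subrr enorm0 theta_ge0. Qed.

Lemma GK_shift j x r : GK j x -> GK j (fun s => x (s + r)).
Proof.
move=> [xj xth]; split=> [t|s t]; first exact: xj.
by rewrite (le_trans (xth _ _))// opprD addrACA subrr addr0.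
Qed.

(** The common part of LC and WTC: it gives integrability along paths and is stable under
    translation. *)
Definition good {m n} (G : @field R N m n) := C1 G /\ C2 G.

Lemma GK_ML1loc m n (G : @field R N m n) j x : good G -> GK j x ->
  ML1loc (fun s => G s (x s)).
Proof.
move=> [mG /(_ _ (@Bj_compact R N j))[mb Gmb]] xK.
by apply: (comp_ML1loc mG Gmb (GK_ucont xK)); case: xK.
Qed.

Lemma Mint_clamp m n (G : @field R N m n) q1 q2 x :
  Mint (ratr q1) (ratr q2) (fun t => G t (x t)) =
  Mint (ratr q1) (ratr q2) (fun t => G t (x (clamp (ratr q1) (ratr q2) t))).
Proof. by apply: Mint_eq => s sI; rewrite clamp_id. Qed.

(** A [sup] dominates its members only if the set is bounded above; the m-bounds of G and G' on B_j
    provide the bound. *)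
Lemma seminorm_ge m n (G G' : @field R N m n) j q1 q2 x : good G -> good G' ->
  q1 < q2 -> GK j x ->
  enorm (Mint (ratr q1) (ratr q2) (fun t => G' t (x t) - G t (x t))) <=
    seminorm (Theta f) j q1 q2 (fsub G' G).
Proof.
move=> gG gG' q12 xK; apply: ub_le_sup; last first.
  by exists x => //; exact: GK_Kset.
have [mG /(_ _ (@Bj_compact R N j))[mb Gmb]] := gG.
have [mG' /(_ _ (@Bj_compact R N j))[mb' Gmb']] := gG'.
exists (Rint (ratr q1) (ratr q2) mb' + Rint (ratr q1) (ratr q2) mb).
move=> _ [z /(Kset_GK q12) zK <-]; rewrite Mint_clamp /fsub.
have zL := GK_ML1loc gG zK; have zL' := GK_ML1loc gG' zK.
rewrite MintB// (le_trans (ler_enormD _ _))// enormN.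
have [mbL Gb] := Gmb; have [mbL' Gb'] := Gmb'; case: zK => zj _.
by apply: lerD; apply: enorm_Mint_le => //;
  [apply: aeS _ Gb'|apply: aeS _ Gb] => s /(_ _ (zj s)).
Qed.

Lemma seminorm_le m n (G : @field R N m n) j q1 q2 c : q1 < q2 ->
  (forall x, GK j x -> enorm (Mint (ratr q1) (ratr q2) (fun t => G t (x t))) <= c) ->
  seminorm (Theta f) j q1 q2 G <= c.
Proof.
move=> q12 Gc; apply: ge_sup.
  (* [ge_sup] asks for a nonempty set; the zero path is admissible for every j. *)
  eexists; exists (fun=> 0); last reflexivity.
  exact/GK_Kset/GK_cst/Bj0.
by move=> _ [x /(Kset_GK q12) xK <-]; rewrite Mint_clamp; exact: Gc.
Qed.

Lemma nb_GK m n (G G' : @field R N m n) ps d j q1 q2 x : good G -> good G' ->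
  nb (Theta f) ps d G G' -> (j, q1, q2) \in ps -> q1 < q2 -> GK j x ->
  enorm (Mint (ratr q1) (ratr q2) (fun t => G' t (x t) - G t (x t))) < d.
Proof.
move=> gG gG' GG' jq q12 xK.
by rewrite (le_lt_trans (seminorm_ge gG gG' q12 xK))//; exact: GG'.
Qed.

End Moduli.

(** * Bounds on the hull *)

Section TotalVariation.
Context {R : realType}.
Local Notation mu := (@lebesgue_measure R).
Implicit Types (u v : R -> R) (a b : R).

Lemma heine v a b (e : R) : continuous v -> 0 < e -> exists2 d : R, 0 < d &
  forall s t, a <= s <= b -> `|t - s| < d -> `|v t - v s| < e.
Proof.
move=> cv e0; have e20 : 0 < e / 2 by rewrite divr_gt0.
have /compact_near_coveringP/(_ R 0^'+
  (fun d s => forall t, `|t - s| < d -> `|v t - v s| < e)) : compact `[a, b].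
  exact: segment_compact.
case=> [x _|d /= d0 dP].
  have /cvgrPdist_lt/(_ _ e20)/nbhs_normP[r /= r0 rv] := cv x.
  have r20 : 0 < r / 2 by rewrite divr_gt0.
  exists (ball x (r / 2), ball (0 : R) (r / 2) `&` [set d | 0 < d]); first split => /=.
  - exact: nbhsx_ballx.
  - near=> d; split; last by rewrite /=; near: d; exact: nbhs_right_gt.
    near: d; apply: cvg_within; exact: nbhsx_ballx.
  - move=> [s d] /= [xs [d0r d0]] t tsd.
    have sx : `|s - x| < r / 2 by rewrite distrC.
    have dr : d < r / 2 by move: d0r; rewrite /ball/= sub0r normrN gtr0_norm.
    have /= := rv s; have /= := rv t.
    have tx : `|x - t| < r.
      rewrite distrC -(subrKA s) (le_lt_trans (ler_normD _ _))//; lra.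
    move=> /(_ tx) vt /(_ _) vs.
    have {}vs := vs ltac:(by rewrite distrC; lra).
    rewrite -(subrKA (v x)) (le_lt_trans (ler_normD _ _))//.
    by rewrite [`|v t - _|]distrC; lra.
near (0 : R)^'+ => c.
exists c; first by near: c; exact: nbhs_right_gt.
move=> s t sab; have : `[a, b] `<=` [set s | forall t, `|t - s| < c -> `|v t - v s| < e].
  by near: c; exists d.
by apply; rewrite /= in_itv.
Unshelve. all: by end_near. Qed.

Lemma L1loc_continuous v : continuous v -> L1loc v.
Proof.
move=> cv a b; apply: continuous_compact_integrable; first exact: segment_compact.
exact: continuous_subspaceT.
Qed.

Lemma L1_approx u a b (e : R) : L1loc u -> 0 < e ->
  exists2 v, continuous v & Rint a b (fun s => `|u s - v s|) < e.
Proof.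
move=> uL e0.
have fin : (mu `[a, b] < +oo)%E.
  by rewrite /= lebesgue_measure_itv; case: ifP => //= _; rewrite -EFinB ltry.
have [//|g [gc gL /fine_cvgP[_ gu]]] :=
  @approximation_continuous_integrable R `[a, b]%classic u _ fin (uL a b).
have /cvgrPdist_lt/(_ _ e0)[n _ /(_ n (leqnn n))] := gu.
rewrite /= sub0r normrN => ge; exists (g n) => //.
by rewrite (le_lt_trans (ler_norm _)).
Qed.

Lemma Rint_cst a b c : a <= b -> Rint a b (fun=> c) = c * (b - a).
Proof.
move=> ab; rewrite /Rint Rintegral_cst//; congr (_ * _).
rewrite /= lebesgue_measure_itv/=; case: ifPn => [_|]; first by rewrite -EFinB.
by rewrite lte_fin -leNgt => ba /=; lra.
Qed.

Lemma Rint_grid u (r : nat -> R) n : L1loc u -> (forall i, r i <= r i.+1) ->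
  Rint (r 0) (r n) u = \sum_(i < n) Rint (r i) (r i.+1) u.
Proof.
move=> uL rm; have r0 k : r 0 <= r k by elim: k => // k IHk; exact: le_trans (rm k).
elim: n => [|n IHn]; first by rewrite big_ord0 Rint_nil.
by rewrite big_ord_recr /= -IHn (@Rint_cat _ (r n)).
Qed.

Lemma Mint_grid m n (u : R -> 'M[R]_(m, n)) (r : nat -> R) k : ML1loc u ->
  (forall i, r i <= r i.+1) ->
  Mint (r 0) (r k) u = \sum_(i < k) Mint (r i) (r i.+1) u.
Proof.
move=> uL rm; apply/matrixP => i j; rewrite summxE mxE (Rint_grid _ (uL i j) rm).
by apply: eq_bigr => l _; rewrite mxE.
Qed.

(** Subdivisions are formed in [rat] because the seminorms only see rational endpoints. *)
Definition qgrid (p q : rat) (n i : nat) : rat := p + (q - p) * i%:R / n%:R.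

Lemma qgrid0 p q n : qgrid p q n 0 = p.
Proof. by rewrite /qgrid mulr0 mul0r addr0. Qed.

Lemma qgridn p q n : (0 < n)%N -> qgrid p q n n = q.
Proof. by move=> n0; rewrite /qgrid mulfK ?pnatr_eq0 -?lt0n// addrC subrK. Qed.

Lemma qgrid_lt p q n i : (0 < n)%N -> p < q -> qgrid p q n i < qgrid p q n i.+1.
Proof.
move=> n0 pq; rewrite /qgrid ltrD2l ltr_pM2r ?invr_gt0 ?ltr0n//.
by rewrite ltr_pM2l ?subr_gt0// ltr_nat.
Qed.

Lemma qgrid_step p q n i :
  ratr (qgrid p q n i.+1) - ratr (qgrid p q n i) = (ratr q - ratr p) / n%:R :> R.
Proof.
rewrite -rmorphB /= -[RHS](_ : ratr ((q - p) / n%:R) = _); last first.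
  by rewrite fmorph_div rmorphB /= ratr_nat.
by congr ratr; rewrite /qgrid opprD addrACA subrr add0r -mulrBl -mulrBr -natrB// subSnn mulr1.
Qed.

(** Take a continuous v at L^1 distance less than e / 4 from u and a mesh on which v oscillates by
    less than k = e / 4 / (b - a). On a cell, u is compared with the constant v (r i): the integral
    of |u| exceeds |int u| by at most 2 int |u - v| + 2 k times the length. Summed up, the error is
    at most e / 2 + e / 2. *)
Lemma Rint_variation u p q (e : R) : L1loc u -> p < q -> 0 < e ->
  exists2 n : nat, (0 < n)%N &
    Rint (ratr p) (ratr q) (fun s => `|u s|) <= \sum_(i < n)
      `|Rint (ratr (qgrid p q n i)) (ratr (qgrid p q n i.+1)) u| + e.
Proof.
move=> uL pq e0; set a : R := ratr p; set b : R := ratr q.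
have ab : a < b by rewrite ltr_rat.
have e40 : 0 < e / 4 by rewrite divr_gt0.
have [v cv uv] := @L1_approx u a b _ uL e40.
pose k := e / 4 / (b - a).
have k0 : 0 < k by rewrite divr_gt0// subr_gt0.
have [d d0 vd] := @heine v a b k cv k0.
have [n n0 nd] := mesh_ex (b - a) d0; exists n => //.
pose r i : R := ratr (qgrid p q n i).
have rlt i : r i < r i.+1 by rewrite ltr_rat; exact: qgrid_lt.
have rle i : r i <= r i.+1 by rewrite ltW.
have rS i : r i.+1 - r i = (b - a) / n%:R by exact: qgrid_step.
have ra : r 0%N = a by rewrite /r qgrid0.
have rb : r n = b by rewrite /r qgridn.
have mono i i' : (i <= i')%N -> r i <= r i'.
  by move=> /subnK <-; elim: (i' - i)%N => // l IHl; rewrite addSn (le_trans IHl).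
have vL := L1loc_continuous cv; have uvL := L1locB uL vL.
have piece (i : 'I_n) : Rint (r i) (r i.+1) (fun s => `|u s|) <=
    `|Rint (r i) (r i.+1) u| + 2 * Rint (r i) (r i.+1) (fun s => `|u s - v s|)
      + 2 * k * (r i.+1 - r i).
  have ri : a <= r i <= b by rewrite -ra -rb !mono// ltnW.
  have vr s : r i <= s <= r i.+1 -> `|v s - v (r i)| < k.
    move=> /andP[s1 s2]; apply: vd => //; rewrite ger0_norm ?subr_ge0//.
    by apply: le_lt_trans nd; rewrite -(rS i); lra.
  have H1 : Rint (r i) (r i.+1) (fun s => `|u s|) <=
      Rint (r i) (r i.+1) (fun s => `|u s - v s| + (`|v (r i)| + k)).
    apply: Rint_le; [exact: L1loc_norm|apply: L1locD; [exact: L1loc_norm|exact: L1loc_cst]|].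
    apply: aeW => s /vr vs; have := ler_normD (u s - v s) (v s).
    by have := ler_normD (v s - v (r i)) (v (r i)); rewrite !subrK; lra.
  rewrite RintD ?Rint_cst// in H1; [|exact: L1loc_norm|exact: L1loc_cst].
  have H2 : `|v (r i)| * (r i.+1 - r i) <= `|Rint (r i) (r i.+1) u| +
      Rint (r i) (r i.+1) (fun s => `|u s - v s| + k).
    have -> : `|v (r i)| * (r i.+1 - r i) = `|Rint (r i) (r i.+1) (fun=> v (r i))|.
      by rewrite Rint_cst// normrM (ger0_norm (_ : 0 <= r i.+1 - r i)) ?subr_ge0.
    rewrite -lerBlDl (le_trans (lerB_dist _ _))//.
    rewrite -RintB//; last exact: L1loc_cst.
    have wL : L1loc (fun s => v (r i) - u s) by apply: L1locB => //; exact: L1loc_cst.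
    apply: (le_trans (normr_Rint _ _ wL)).
    apply: Rint_le; [exact: L1loc_norm|apply: L1locD; [exact: L1loc_norm|exact: L1loc_cst]|].
    apply: aeW => s /vr vs; rewrite -(subrKA (v s)) (le_trans (ler_normD _ _))// addrC.
    by rewrite [`|v s - u s|]distrC lerD2l distrC ltW.
  rewrite RintD ?Rint_cst// in H2; [|exact: L1loc_norm|exact: L1loc_cst].
  by lra.
have uaL := L1loc_norm uL; have uvaL := L1loc_norm uvL.
rewrite -ra -rb (Rint_grid _ uaL rle) (le_trans (ler_sum _ (fun i _ => piece i)))//.
rewrite !big_split /= -addrA lerD2l -!big_distrr /= -(Rint_grid _ uvaL rle) ra rb.
have -> : \sum_(i < n) (r i.+1 - r i) = b - a.
  under eq_bigr do rewrite rS.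
  by rewrite sumr_const card_ord -[LHS]mulr_natr divfK// pnatr_eq0 -lt0n.
have -> : 2 * k * (b - a) = e / 2 by rewrite /k; field; rewrite subr_eq0 gt_eqF.
by lra.
Qed.

(** Real intervals are reached by a rational one inside and two short end pieces. Keeping k below
    half the length ensures p < q. *)
Lemma rat_inside a b (h : R) : a < b -> 0 < h -> exists p q : rat,
  [/\ p < q, a < ratr p, ratr q < b, ratr p - a < h & b - ratr q < h].
Proof.
move=> ab h0; pose k := Num.min h ((b - a) / 2).
have k0 : 0 < k by rewrite lt_min h0 divr_gt0// subr_gt0.
have [|p] := @rat_in_itvoo _ a (a + k); first lra.
rewrite in_itv/= => /andP[p1 p2].
have [|q] := @rat_in_itvoo _ (b - k) b; first lra.
rewrite in_itv/= => /andP[q1 q2].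
have kh : k <= h by rewrite ge_min lexx.
have kba : k <= (b - a) / 2 by rewrite ge_min lexx orbT.
by exists p, q; rewrite -(ltr_rat R); split; lra.
Qed.

End TotalVariation.

(** * Uniform L^1 bounds along admissible paths *)

Section HullBounds.
Context {R : realType} {N : nat} (f : @field R N N 1).
Local Notation vec := 'cV[R]_N.
Hypothesis fE : equi_mbounds f.
Local Notation th := (Theta f).

Lemma C1_trans m n (G : @field R N m n) t : C1 G -> C1 (trans G t).
Proof.
move=> mG B /mG oB.
apply: (@borel_preimage _ _ (fun p : R * vec => (p.1 + t, p.2)) _ _ oB) => p.
apply: (@cvg_pair _ _ _ _ (nbhs (p.1 + t)) (nbhs p.2)); last exact: cvg_snd.
by apply: cvgD; [exact: cvg_fst|exact: cvg_cst].
Qed.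

Lemma mbound_trans m n (G : @field R N m n) K mb t : mbound G K mb ->
  mbound (trans G t) K (fun s => mb (s + t)).
Proof.
by move=> [mbL Gmb]; split; [exact: L1loc_shift|exact: (ae_shift t Gmb)].
Qed.

Lemma good_trans m n (G : @field R N m n) t : good G -> good (trans G t).
Proof.
move=> [mG bG]; split; first exact: C1_trans.
by move=> K /bG[mb Gmb]; exists (fun s => mb (s + t)); exact: mbound_trans.
Qed.

(** G lies in the sigma_Theta-closure of the orbit of F. Stated for one component and apart from the
    class of G, so that f, F and h are treated alike. *)
Definition tapprox {m n} (F G : @field R N m n) :=
  forall ps d, 0 < d -> exists tau, nb th ps d G (trans F tau).

(* sigma_Theta only controls integrals over rational intervals; the total
   variation formula turns this into an L^1 bound along the path. *)
Lemma hull_L1_rat m n (F G : @field R N m n) j ms z p q c i l :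
  good F -> good G -> tapprox F G ->
  (forall tau, mbound (trans F tau) (Bj j) (ms tau)) -> GK f j z -> p < q ->
  (forall tau, Rint (ratr p) (ratr q) (ms tau) <= c) ->
  Rint (ratr p) (ratr q) (fun s => `|G s (z s) i l|) <= c.
Proof.
move=> gF gG FG Fms zK pq msc; apply/ler_addgt0Pr => e e0.
have e20 : 0 < e / 2 by rewrite divr_gt0.
have GzL := GK_ML1loc fE gG zK.
have [k k0 uk] := Rint_variation (GzL i l) pq e20.
apply: (le_trans uk); set r := fun i : nat => qgrid p q k i.
(* One translate must serve all k cells, so they form a single list of seminorms, each with the
   share e / 2 / k of the error. *)
have d0 : 0 < e / 2 / k%:R by rewrite divr_gt0// ltr0n.
have [tau FGt] := FG [seq (j, r i, r i.+1) | i <- iota 0 k] _ d0.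
have gFt := good_trans tau gF; have FzL := GK_ML1loc fE gFt zK.
have rlt v : r v < r v.+1 by exact: qgrid_lt.
have rle v : ratr (r v) <= ratr (r v.+1) :> R by rewrite ler_rat ltW.
have [msL Fmst] := Fms tau; have zj := zK.1.
have piece (v : 'I_k) : `|Rint (ratr (r v)) (ratr (r v.+1)) (fun s => G s (z s) i l)| <=
    Rint (ratr (r v)) (ratr (r v.+1)) (ms tau) + e / 2 / k%:R.
  have -> : Rint (ratr (r v)) (ratr (r v.+1)) (fun s => G s (z s) i l) =
    Mint (ratr (r v)) (ratr (r v.+1)) (fun s => G s (z s)) i l by rewrite mxE.
  apply: (le_trans (le_enorm _ _ _)).
  set A := Mint _ _ _; rewrite -[A](subrK (Mint (ratr (r v)) (ratr (r v.+1))
     (fun s => trans F tau s (z s)))).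
  rewrite (le_trans (ler_enormD _ _))// addrC lerD//.
    apply: enorm_Mint_le => //; apply: aeS _ Fmst => s /(_ _ (zj s)) //.
  rewrite enormB /A -MintB// ltW//; apply: (nb_GK fE gG gFt FGt _ (rlt v) zK).
  by apply/mapP; exists (v : nat); rewrite ?mem_iota//=.
have -> : c + e = c + e / 2 + e / 2 by lra.
rewrite lerD2r (le_trans (ler_sum _ (fun v _ => piece v)))// big_split /=.
rewrite -(Rint_grid (r := fun v => ratr (r v)) _ msL rle) /r qgrid0 qgridn//.
rewrite sumr_const card_ord -[X in _ + X <= _]mulr_natr divfK ?pnatr_eq0 -?lt0n//.
by rewrite lerD2r.
Qed.

(** Absolute continuity for the individual G absorbs the two end pieces. The threshold d depends on
    G and z, but the resulting bound c does not. *)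
Lemma hull_L1 m n (F G : @field R N m n) j ms z a b c i l :
  good F -> good G -> tapprox F G ->
  (forall tau, mbound (trans F tau) (Bj j) (ms tau)) ->
  (forall tau s, 0 <= ms tau s) -> GK f j z -> a <= b ->
  (forall tau, Rint a b (ms tau) <= c) ->
  Rint a b (fun s => `|G s (z s) i l|) <= c.
Proof.
move=> gF gG FG Fms ms0 zK; rewrite le_eqVlt => /predU1P[->|ab] msc.
  by have := msc 0; rewrite !Rint_nil.
apply/ler_addgt0Pr => e e0; have e20 : 0 < e / 2 by rewrite divr_gt0.
have GzL := GK_ML1loc fE gG zK i l; have GzaL := L1loc_norm GzL.
have [d d0 Gd] := Rint_small (Num.max `|a| `|b|) GzL e20.
have [p [q [pq ap qb pd qd]]] := rat_inside ab d0.
have pq' : ratr p < ratr q :> R by rewrite ltr_rat.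
rewrite (@Rint_cat _ (ratr p))//; [|lra|lra].
rewrite (@Rint_cat _ (ratr q) (ratr p))//; [|lra|lra].
have aM : - Num.max `|a| `|b| <= a.
  by rewrite lerNl (le_trans (ler_norm _))// normrN le_max lexx.
have bM : b <= Num.max `|a| `|b|.
  by rewrite (le_trans (ler_norm _))// le_max lexx orbT.
have H1 := Gd a (ratr p) aM (ltW ap) ltac:(lra) pd.
have H2 := Gd (ratr q) b ltac:(lra) (ltW qb) bM qd.
have H3 := @hull_L1_rat m n F G j ms z p q c i l gF gG FG Fms zK pq.
have {}H3 : Rint (ratr p) (ratr q) (fun s : R => `|G s (z s) i l|) <= c.
  apply: H3 => tau; apply: le_trans (msc tau).
  by apply: Rint_subset; [case: (Fms tau)|exact: aeW|lra|lra|lra].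
by move: H1 H2 H3; lra.
Qed.

Lemma hull_lsum m n (F G : @field R N m n) j ms z a b c :
  good F -> good G -> tapprox F G ->
  (forall tau, mbound (trans F tau) (Bj j) (ms tau)) ->
  (forall tau s, 0 <= ms tau s) -> GK f j z -> a <= b ->
  (forall tau, Rint a b (ms tau) <= c) ->
  Rint a b (lsum (fun s => G s (z s))) <= (\sum_(i < m) \sum_(k < n) 1) * c.
Proof.
move=> gF gG FG Fms ms0 zK ab msc; have GzL := GK_ML1loc fE gG zK.
rewrite /lsum Rint_sum => [|i]; last by apply: L1loc_sum => k; exact: L1loc_norm.
rewrite big_distrl; apply: ler_sum => i _ /=.
rewrite Rint_sum => [|k]; last exact: L1loc_norm.
rewrite big_distrl; apply: ler_sum => k _ /=; rewrite mul1r.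
exact: hull_L1 gF gG FG Fms ms0 zK ab msc.
Qed.

(** The order of quantifiers is the point: [d] is chosen from F alone and serves every G in the hull
    and every admissible path. The summand 1 in C keeps it positive even for empty matrices. *)
Lemma hull_small m n (F : @field R N m n) j T (e : R) : good F -> equi_mbounds F ->
  0 < e -> exists2 d : R, 0 < d & forall G z a b, good G -> tapprox F G -> GK f j z ->
    - T <= a -> a <= b -> b <= T -> b - a < d ->
    Rint a b (lsum (fun s => G s (z s))) <= e.
Proof.
move=> gF /(_ j)[ms [Fms [ms0 msE]]] e0.
pose C : R := (\sum_(i < m) \sum_(k < n) 1) + 1.
have C0 : 0 < C by rewrite ltr_pwDr// sumr_ge0// => i _; rewrite sumr_ge0.
have eC0 : 0 < e / C by rewrite divr_gt0.
have [|d d0 msd] := msE (`|T| + 1) (e / C) _ eC0; first by rewrite ltr_wpDl.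
exists d => // G z a b gG FG zK Ta ab bT bad.
have TT := ler_norm T.
have msc tau : Rint a b (ms tau) <= e / C by rewrite ltW//; apply: msd; lra.
apply: (le_trans (hull_lsum gF gG FG Fms ms0 zK ab msc)).
by rewrite mulrA ler_pdivrMr// mulrC ler_wpM2l ?(ltW e0)// lerDl.
Qed.

Lemma hull_bounded m n (F : @field R N m n) j T : good F -> equi_mbounds F ->
  exists2 C : R, 0 <= C & forall G z a b, good G -> tapprox F G -> GK f j z ->
    - T <= a -> a <= b -> b <= T -> Rint a b (lsum (fun s => G s (z s))) <= C.
Proof.
move=> gF /(_ j)[ms [Fms [ms0 msE]]].
have [|C HC] := @L1equi_bounded _ ms T _ (conj ms0 msE).
  by move=> tau; case: (Fms tau).
exists `|(\sum_(i < m) \sum_(k < n) 1) * C| => //.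
move=> G z a b gG FG zK Ta ab bT.
have msc tau := HC tau a b Ta ab bT.
by apply: (le_trans (hull_lsum gF gG FG Fms ms0 zK ab msc)); exact: ler_norm.
Qed.

End HullBounds.

(** * Compactness of the admissible paths and continuity of translation *)

Section Translation.
Context {R : realType} {N : nat} (f : @field R N N 1).
Local Notation vec := 'cV[R]_N.
Hypothesis fE : equi_mbounds f.
Local Notation th := (Theta f).

(** The product over all real times is in general not metrizable, so no subsequence is extracted:
    closeness is obtained for arbitrarily large k at any finite list of times. *)
Lemma ptws_cluster j (x : nat -> R -> vec) : (forall k t, Bj j (x k t)) ->
  exists2 y : R -> vec, (forall t, Bj j (y t)) & forall (ts : seq R) (e : R) n, 0 < e ->
    exists2 k, (n <= k)%N & forall t, t \in ts -> enorm (x k t - y t) < e.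
Proof.
move=> xj.
pose W := prod_topology (fun _ : R => vec).
have cK : @compact W [set g : W | forall t, Bj j (g t)].
  by apply: (@tychonoff R (fun=> vec) (fun=> Bj j)) => _; exact: Bj_compact.
have [|y [yj ycl]] := cK ((x : nat -> W) @ \oo) _.
  by exists 0%N => // k _ /=; exact: xj.
exists y => // ts e n e0.
have Fn : ((x : nat -> W) @ \oo) [set x k | k in [set k | (n <= k)%N]].
  by exists n => // k /= nk; exists k.
have nbh : nbhs (y : W) [set g : W | forall t, t \in ts -> enorm (g t - y t) < e].
  elim: ts => [|t ts IHts]; first by apply: filterS filterT => g _ t.
  have nt : nbhs (y : W) [set g : W | enorm (g t - y t) < e].
    have := @proj_continuous R (fun=> vec) t y.
    move=> /(_ [set v | enorm (v - y t) < e]); apply; exact: enorm_cont.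
  apply: filterS (filterI nt IHts) => g [gt gts] s.
  by rewrite in_cons => /predU1P[->//|]; exact: gts.
by have [_ [[k nk <-] kts]] := ycl _ _ Fn nbh; exists k.
Qed.

Lemma grid_point (a h t : R) n : a <= t -> t <= a + n%:R * h -> 0 <= h ->
  exists2 i, (i <= n)%N & a + i%:R * h <= t <= a + i%:R * h + h.
Proof.
move=> at_ + h0; elim: n => [|n IHn] tn.
  by exists 0%N => //; move: tn; rewrite mul0r addr0 => ?; apply/andP; split; lra.
have [/IHn[i ni ti]|nt] := leP t (a + n%:R * h); first by exists i => //; exact: leqW.
exists n => //; rewrite (ltW nt)/=; move: tn; rewrite -natr1 mulrDl mul1r; lra.
Qed.

(* Arzela-Ascoli: Tychonoff gives a pointwise cluster point, and the common
   modulus upgrades closeness on a finite grid to uniform closeness. *)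
Lemma GK_cluster j (x : nat -> R -> vec) : (forall k, GK f j (x k)) ->
  exists2 y, GK f j y & forall (a b e : R) n, 0 < e ->
    exists2 k, (n <= k)%N & forall t, a <= t <= b -> enorm (x k t - y t) < e.
Proof.
move=> xK; have [y yj ycl] := ptws_cluster (fun k => (xK k).1).
have yK : GK f j y.
  split => // s t; apply/ler_addgt0Pr => e e0; have e20 : 0 < e / 2 by rewrite divr_gt0.
  have [k _ xy] := ycl [:: s; t] _ 0%N e20.
  have := xy s; have := xy t; rewrite !inE !eqxx orbT => /(_ isT) xt /(_ isT) xs.
  have := ler_enorm_dist (x k t) (y t) (y s).
  have := ler_enorm_dist (x k s) (x k t) (y s).
  by have := (xK k).2 s t; rewrite (enormB (y t) (x k t)); lra.
exists y => // a b e n e0; have e40 : 0 < e / 4 by rewrite divr_gt0.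
have [d d0 thd] := theta_small fE j e40.
have [l l0 ld] := mesh_ex (b - a) d0.
have [ab|ba] := leP a b; last first.
  by exists n => // t /andP[? ?]; lra.
set h := _ / _ in ld; have h0 : 0 <= h by rewrite divr_ge0// subr_ge0.
have [k nk xy] := ycl [seq a + i%:R * h | i <- iota 0 l.+1] _ n e40.
exists k => // t /andP[at_ tb].
have [|i il /andP[it ti]] := @grid_point a h t l at_ _ h0.
  by rewrite /h mulrC divfK ?pnatr_eq0 -?lt0n// addrC subrK.
set r := a + i%:R * h in it ti.
have xyr : enorm (x k r - y r) < e / 4.
  by apply: xy; apply/mapP; exists i; rewrite ?mem_iota//.
have := ler_enorm_dist (x k r) (x k t) (y t).
have := ler_enorm_dist (y r) (x k r) (y t).
have tr : `|t - r| = t - r by rewrite ger0_norm// subr_ge0.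
have thr : Theta f j 0 0 (t - r) <= e / 4 by apply: thd; lra.
have := (xK k).2 r t; have := yK.2 r t; rewrite tr (enormB (y t) (y r)).
by lra.
Qed.

(** Condition (W) is sequential; compactness makes it uniform. Otherwise there are pairs with |x_k -
    z_k| <= 1 / (k + 1) whose integrals stay e apart. Along suitable indices the x_k approach a
    cluster path y, hence so do the z_k, and (W) at y sends both integrals to the same limit. *)
Lemma condW_uniform m n (G : @field R N m n) j q1 q2 (e : R) : condW th G ->
  q1 < q2 -> 0 < e -> exists2 d : R, 0 < d & forall x z, GK f j x -> GK f j z ->
    (forall t, enorm (x t - z t) <= d) ->
    enorm (Mint (ratr q1) (ratr q2) (fun s => G s (x s)) -
           Mint (ratr q1) (ratr q2) (fun s => G s (z s))) < e.
Proof.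
move=> GW q12 e0; apply: contrapT => H.
have pk k : 0 < k.+1%:R^-1 :> R by rewrite invr_gt0.
have /choice[xz xzP] : forall k : nat, exists xz : (R -> vec) * (R -> vec),
   [/\ GK f j xz.1, GK f j xz.2, forall t, enorm (xz.1 t - xz.2 t) <= k.+1%:R^-1 &
   ~ enorm (Mint (ratr q1) (ratr q2) (fun s => G s (xz.1 s)) -
           Mint (ratr q1) (ratr q2) (fun s => G s (xz.2 s))) < e].
  move=> k; apply: contrapT => K; apply: H; exists k.+1%:R^-1 => // x z xK zK xz.
  by apply: contrapT => L; apply: K; exists (x, z).
have [y yK ycl] := @GK_cluster j (fun k => (xz k).1) (fun k => let: And4 p _ _ _ := xzP k in p).
have /choice[nk nkP] : forall k : nat, exists i, (k <= i)%N /\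
    forall t, Iq q1 q2 t -> enorm ((xz i).1 t - y t) < k.+1%:R^-1.
  move=> k; have [i ki xi] := ycl (ratr q1) (ratr q2) _ k (pk k).
  by exists i; split => // t; rewrite /Iq /= in_itv/=; exact: xi.
have yKs := GK_Kset fE q1 q2 yK.
have cvg1 : (fun k => Mint (ratr q1 : R) (ratr q2) (fun t => G t ((xz (nk k)).1 t)))
      @ \oo --> Mint (ratr q1 : R) (ratr q2) (fun t => G t (y t)).
  apply: (GW j q1 q2 q12) => // [k|d d0].
    by apply: GK_Kset => //; case: (xzP (nk k)).
  have [i i0 id] := mesh_ex 1 d0; exists i => // k /= ik t tI.
  have [_ ny] := nkP k; apply: (lt_le_trans (ny t tI)); apply: le_trans (ltW id).
  by rewrite mul1r lef_pV2 ?posrE ?ltr0n// ler_nat; exact: leqW.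
have cvg2 : (fun k => Mint (ratr q1 : R) (ratr q2) (fun t => G t ((xz (nk k)).2 t)))
      @ \oo --> Mint (ratr q1 : R) (ratr q2) (fun t => G t (y t)).
  apply: (GW j q1 q2 q12) => // [k|d d0].
    by apply: GK_Kset => //; case: (xzP (nk k)).
  have d20 : 0 < d / 2 by rewrite divr_gt0.
  have [i i0 id] := mesh_ex 1 d20; exists i => // k /= ik t tI.
  have kd : k.+1%:R^-1 < d / 2.
    apply: le_lt_trans id.
    by rewrite mul1r lef_pV2 ?posrE ?ltr0n// ler_nat; exact: leqW.
  have [kn ny] := nkP k; have := ny t tI.
  have [_ _ /(_ t) xzt _] := xzP (nk k).
  have nkk : (nk k).+1%:R^-1 <= k.+1%:R^-1 :> R by rewrite lef_pV2 ?posrE ?ltr0n// ler_nat.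
  have := ler_enorm_dist ((xz (nk k)).1 t) ((xz (nk k)).2 t) (y t).
  rewrite (enormB ((xz (nk k)).2 t) ((xz (nk k)).1 t)).
  by move: nkk kd xzt; move: (_^-1) (_^-1) => b a; lra.
have e20 : 0 < e / 2 by rewrite divr_gt0.
have [i1 _ /(_ (maxn _ _) (leq_maxl _ _)) H1] := (cvg_enormP _ _ _).1 cvg1 _ e20.
have [i2 _ /(_ (maxn _ _) (leq_maxr _ _)) H2] := (cvg_enormP _ _ _).1 cvg2 _ e20.
have [_ _ _] := xzP (nk (maxn i1 i2)); apply.
have := H1 i2; have := H2 i1; set X := Mint _ _ _; set Y := Mint _ _ (fun t => G t (y t)).
move=> HY HX; apply: (le_lt_trans (ler_enorm_dist Y _ _)).
by rewrite (enormB Y) /=; lra.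
Qed.

(** Six errors: two end pieces for each of two integrals, and on the middle piece a change of field
    followed by a change of path. *)
Lemma enorm_telescope m n (M1 M2 M3 M4 M5 M6 M7 : 'M[R]_(m, n)) (e : R) :
  enorm M1 <= e -> enorm M2 <= e -> enorm M3 <= e -> enorm M4 <= e ->
  enorm (M5 - M6) <= e -> enorm (M6 - M7) <= e ->
  enorm (M1 + (M5 + M2) - (M3 + (M7 + M4))) <= 6 * e.
Proof.
have -> : M1 + (M5 + M2) - (M3 + (M7 + M4)) = M1 + M2 - M3 - M4 + ((M5 - M6) + (M6 - M7)).
  by apply/matrixP => i l; rewrite !mxE; ring.
have := ler_enormD (M1 + M2 - M3 - M4) ((M5 - M6) + (M6 - M7)).
have := ler_enormD (M5 - M6) (M6 - M7).
have := ler_enormD (M1 + M2 - M3) (- M4).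
have := ler_enormD (M1 + M2) (- M3); have := ler_enormD M1 M2.
by rewrite !enormN; lra.
Qed.

(** Integrating G_t along x over [q1, q2] is integrating G along x(. - t) over [q1 + t, q2 + t],
    whose endpoints need not be rational. On a rational [p, q] inside, one seminorm handles the
    change from G to G', and uniform (W) handles the change of shift, since x(. - t') and x(. - t)
    differ by at most theta_j(|t' - t|). The end pieces are short, hence small uniformly over the
    hull. *)
Lemma trans_continuous m n (F G : @field R N m n) j q1 q2 t (e : R) :
  good F -> equi_mbounds F -> WTC th G -> tapprox f F G -> q1 < q2 -> 0 < e ->
  exists ps, exists d, exists h, [/\ 0 < d, 0 < h &
    forall G' t', good G' -> tapprox f F G' -> `|t' - t| < h -> nb th ps d G G' ->
    forall x, GK f j x ->
    enorm (Mint (ratr q1) (ratr q2) (fun s => trans G' t' s (x s) - trans G t s (x s))) <= e].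
Proof.
move=> gF FE [GC1 [GC2 GW]] FG q12 e0.
have gG : good G by split.
have e60 : 0 < e / 6 by rewrite divr_gt0.
have q12' : ratr q1 < ratr q2 :> R by rewrite ltr_rat.
pose T := `|ratr q1| + `|ratr q2| + `|t| + 1 : R.
have [k k0 small] := hull_small fE j T gF FE e60.
have k20 : 0 < k / 2 by rewrite divr_gt0.
have [|p [q [pq tp qt pk qk]]] := @rat_inside _ (ratr q1 + t) (ratr q2 + t) _ _ k20.
  by rewrite ltrD2r.
have pq' : ratr p < ratr q :> R by rewrite ltr_rat.
have [d2 d20 Gd2] := condW_uniform j GW pq e60.
have [d3 d30 thd3] := theta_small fE j d20.
(* The entries keep [p, q] inside the interval shifted by t', keep the two shifted paths within d2,
   keep the end pieces shorter than k / 2 + k / 2, and keep everything inside [- T, T]. *)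
pose h : R := Num.min (Num.min (ratr p - (ratr q1 + t)) (ratr q2 + t - ratr q))
  (Num.min (Num.min d3 (k / 2)) 1).
exists [:: (j, p, q)], (e / 6), h; split => //.
  by rewrite !lt_min !subr_gt0 tp qt d30 k20 ltr01.
move=> G' t' gG' FG' + GG' x xK.
rewrite !lt_min => /andP[/andP[t1 t2] /andP[/andP[t3 t4] t5]].
have [c1 c2 c3 c4] : [/\ ratr q1 + t' < ratr p, ratr q < ratr q2 + t',
    ratr p - (ratr q1 + t') < k & ratr q2 + t' - ratr q < k].
  move: t1 t2 t4; rewrite !ltr_norml => /andP[r1 r2] /andP[r3 r4] /andP[r5 r6].
  by clear - pk qk k0 r1 r2 r3 r4 r5 r6; split; lra.
have [c5 c6] : ratr p - (ratr q1 + t) < k /\ ratr q2 + t - ratr q < k.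
  by clear - pk qk k0; split; lra.
have [d1 d5] : - T <= ratr q1 + t - 1 /\ ratr q2 + t + 1 <= T.
  have := ler_norm (ratr q2 : R); have := ler_norm t.
  have := ler_norm (- ratr q1 : R); have := ler_norm (- t); rewrite !normrN /T.
  have := normr_ge0 (ratr q2 : R); have := normr_ge0 (ratr q1 : R).
  by clear; split; lra.
have [d4 d6 d7 d8] : [/\ - T <= ratr q1 + t', ratr q2 + t' <= T, - T <= ratr q1 + t
    & ratr q2 + t <= T].
  move: t5; rewrite !ltr_norml => /andP[r1 r2].
  by clear - d1 d5 r1 r2; split; lra.
have [pT qT] : ratr p <= T /\ - T <= ratr q.
  by clear - pq' d8 qt d7 tp; split; lra.
have xt1 : GK f j (fun s => x (s - t')) by exact: GK_shift.
have xt : GK f j (fun s => x (s - t)) by exact: GK_shift.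
have L1 := GK_ML1loc fE gG' xt1; have L2 := GK_ML1loc fE gG xt.
have L3 := GK_ML1loc fE gG xt1.
have E1 : Mint (ratr q1) (ratr q2) (fun s => trans G' t' s (x s)) =
    Mint (ratr q1 + t') (ratr q2 + t') (fun s => G' s (x (s - t'))).
  by rewrite -Mint_shift//; apply: Mint_eq => s _; rewrite addrK.
have E2 : Mint (ratr q1) (ratr q2) (fun s => trans G t s (x s)) =
    Mint (ratr q1 + t) (ratr q2 + t) (fun s => G s (x (s - t))).
  by rewrite -Mint_shift//; apply: Mint_eq => s _; rewrite addrK.
have LG' : ML1loc (fun s => trans G' t' s (x s)).
  by apply: GK_ML1loc xK => //; exact: good_trans.
have LG : ML1loc (fun s => trans G t s (x s)).
  by apply: GK_ML1loc xK => //; exact: good_trans.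
rewrite MintB// E1 E2.
have cat u c d : ML1loc u -> c < ratr p -> ratr q < d -> Mint c d u =
    Mint c (ratr p) u + (Mint (ratr p) (ratr q) u + Mint (ratr q) d u) :> 'M[R]_(m, n).
  move=> uL /ltW cp /ltW qd; rewrite -(@Mint_cat _ (ratr q))// ?(ltW pq')//.
  by rewrite -Mint_cat// (le_trans (ltW pq')).
rewrite (cat _ (ratr q1 + t'))// (cat _ (ratr q1 + t))//.
have bnd G0 z a b : good G0 -> tapprox f F G0 -> GK f j z ->
    - T <= a -> a <= b -> b <= T -> b - a < k ->
    enorm (Mint a b (fun s => G0 s (z s))) <= e / 6.
  move=> gG0 FG0 zK ? ? ? ?; have zL := GK_ML1loc fE gG0 zK.
  apply: (@le_trans _ _ (Rint a b (lsum (fun s => G0 s (z s))))).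
    apply: enorm_Mint_le => //; first exact: lsum_L1loc.
    by apply: aeW => s _; exact: enorm_lsum.
  exact: small.
have B1 := bnd G' _ (ratr q1 + t') (ratr p) gG' FG' xt1 d4 (ltW c1) pT c3.
have B2 := bnd G' _ (ratr q) (ratr q2 + t') gG' FG' xt1 qT (ltW c2) d6 c4.
have B3 := bnd G _ (ratr q1 + t) (ratr p) gG FG xt d7 (ltW tp) pT c5.
have B4 := bnd G _ (ratr q) (ratr q2 + t) gG FG xt qT (ltW qt) d8 c6.
have B5 : enorm (Mint (ratr p) (ratr q) (fun s => G' s (x (s - t'))) -
                 Mint (ratr p) (ratr q) (fun s => G s (x (s - t')))) <= e / 6.
  by rewrite -MintB// ltW//; apply: (nb_GK fE gG gG' GG' _ pq xt1); rewrite inE.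
have B6 : enorm (Mint (ratr p) (ratr q) (fun s => G s (x (s - t'))) -
                 Mint (ratr p) (ratr q) (fun s => G s (x (s - t)))) <= e / 6.
  apply/ltW/(Gd2 _ _ xt1 xt) => s; apply: (le_trans (xK.2 _ _)).
  have -> : s - t' - (s - t) = - (t' - t) by ring.
  rewrite normrN.
  exact: thd3.
have -> : e = 6 * (e / 6) by rewrite mulrC divfK.
exact: enorm_telescope B1 B2 B3 B4 B5 B6.
Qed.

End Translation.

(** * Invariance under translation and the modulus of trajectories *)

Section HullInvariance.
Context {R : realType} {N : nat} (f : @field R N N 1).
Local Notation mu := (@lebesgue_measure R).
Hypothesis fE : equi_mbounds f.
Local Notation th := (Theta f).

Lemma nb_sub m n ps ps' d d' (G G' : @field R N m n) : {subset ps <= ps'} ->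
  d' <= d -> nb th ps' d' G G' -> nb th ps d G G'.
Proof.
move=> pps dd nbG j q1 q2 jps q12; apply: lt_le_trans dd.
by apply: nbG => //; exact: pps.
Qed.

Lemma WTC_good m n (G : @field R N m n) : WTC th G -> good G.
Proof. by case=> ? []. Qed.

Lemma LC_good (g : @field R N N 1) : LC g -> good g.
Proof. by case=> ? []. Qed.

Lemma nb_trans_continuous m n (F G : @field R N m n) t ps (e : R) :
  good F -> equi_mbounds F -> WTC th G -> tapprox f F G -> 0 < e ->
  exists ps', exists d, exists h, [/\ 0 < d, 0 < h & forall G' t',
    good G' -> tapprox f F G' -> `|t' - t| < h -> nb th ps' d G G' ->
    nb th ps e (trans G t) (trans G' t')].
Proof.
move=> gF FE GW FG e0; elim: ps => [|[[j q1] q2] ps [ps1 [d1 [h1 [d10 h10 H1]]]]].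
  by exists [::], 1, 1; split.
(* An entry with q2 <= q1 imposes nothing in [nb]. *)
have [q12|q21] := ltP q1 q2; last first.
  exists ps1, d1, h1; split => // G' t' gG' FG' tt' nbG j' p q.
  rewrite in_cons => /predU1P[[-> -> ->]|]; first by rewrite ltNge q21.
  exact: H1 gG' FG' tt' nbG _ _ _.
have e20 : 0 < e / 2 by rewrite divr_gt0.
have [ps2 [d2 [h2 [d20 h20 H2]]]] :=
  trans_continuous fE j t gF FE GW FG q12 e20.
exists (ps1 ++ ps2), (Num.min d1 d2), (Num.min h1 h2); split.
- by rewrite lt_min d10.
- by rewrite lt_min h10.
move=> G' t' gG' FG'; rewrite lt_min => /andP[tt1 tt2] nbG j' p q.
have nb1 : nb th ps1 d1 G G'.
  apply: nb_sub nbG; last by rewrite ge_min lexx.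
  by move=> x xps; rewrite mem_cat xps.
have nb2 : nb th ps2 d2 G G'.
  apply: nb_sub nbG; last by rewrite ge_min lexx orbT.
  by move=> x xps; rewrite mem_cat xps orbT.
rewrite in_cons => /predU1P[[-> -> ->] _|]; last exact: H1 gG' FG' tt1 nb1 _ _ _.
apply: (@le_lt_trans _ _ (e / 2)); last by rewrite gtr_pMr// invf_lt1// ltr1n.
by apply: seminorm_le => // x; exact: H2 gG' FG' tt2 nb2 x.
Qed.

Lemma mbound_Mint m n (G : @field R N m n) j mb z a b : good G -> mbound G (Bj j) mb ->
  GK f j z -> enorm (Mint a b (fun s => G s (z s))) <= Rint a b mb.
Proof.
move=> gG [mbL Gmb] zK; have zL := GK_ML1loc fE gG zK; have zj := zK.1.
by apply: enorm_Mint_le => //; apply: aeS _ Gmb => s /(_ _ (zj s)).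
Qed.

(** A real shift moves rational endpoints to real ones, so (W) for G is applied on a rational
    interval inside, and an m-bound of G makes the end pieces small for all paths at once. *)
Lemma condW_trans m n (G : @field R N m n) t : good G -> condW th G ->
  condW th (trans G t).
Proof.
move=> gG GW j q1 q2 q12 xs x xsK xK xsx; apply/cvg_enormP => e e0.
have q12' : ratr q1 < ratr q2 :> R by rewrite ltr_rat.
pose cl : R -> R := clamp (ratr q1) (ratr q2).
have xs1 k : GK f j (fun s => xs k (cl (s - t))).
  exact: (GK_shift (- t) (Kset_GK fE q12 (xsK k))).
have x1 : GK f j (fun s => x (cl (s - t))).
  exact: (GK_shift (- t) (Kset_GK fE q12 xK)).
have [mb Gmb] : exists mb, mbound G (Bj j) mb.
  by case: gG => _ /(_ _ (@Bj_compact R N j)).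
have [mbL _] := Gmb.
(* Six errors of size e / 7 stay strictly below e. *)
have e70 : 0 < e / 7 by rewrite divr_gt0.
pose T := Num.max `|ratr q1 + t| `|ratr q2 + t|.
have [k k0 small] := Rint_small T mbL e70.
have [|p [q [pq tp qt pk qk]]] := @rat_inside _ (ratr q1 + t) (ratr q2 + t) _ _ k0.
  by rewrite ltrD2r.
have pq' : ratr p < ratr q :> R by rewrite ltr_rat.
have T1 : - T <= ratr q1 + t.
  by rewrite lerNl (le_trans (ler_norm _))// normrN le_max lexx.
have T2 : ratr q2 + t <= T.
  by rewrite (le_trans (ler_norm _))// le_max lexx orbT.
have [pT qT] : ratr p <= T /\ - T <= ratr q.
  by clear - T1 T2 pq' qt tp; split; lra.
have bnd z a b : GK f j z -> - T <= a -> a <= b -> b <= T -> b - a < k ->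
    enorm (Mint a b (fun s => G s (z s))) <= e / 7.
  move=> zK Ta ab bT bak; apply: (le_trans (mbound_Mint _ _ gG Gmb zK)).
  apply/ltW/(le_lt_trans _ (small a b Ta ab bT bak)); apply: Rint_le => //.
    exact: L1loc_norm.
  by apply: aeW => s _; exact: ler_norm.
have E z : GK f j (fun s => z (cl (s - t))) ->
    Mint (ratr q1) (ratr q2) (fun s => trans G t s (z s)) =
    Mint (ratr q1 + t) (ratr p) (fun s => G s (z (cl (s - t)))) +
    (Mint (ratr p) (ratr q) (fun s => G s (z (cl (s - t)))) +
     Mint (ratr q) (ratr q2 + t) (fun s => G s (z (cl (s - t))))).
  move=> zK; have zL := GK_ML1loc fE gG zK.
  rewrite -(@Mint_cat _ (ratr q))// ?(ltW pq') ?(ltW qt)// -Mint_cat//; last 2 first.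
  - exact: ltW.
  - by rewrite (le_trans (ltW pq')) ?(ltW qt).
  rewrite -Mint_shift//; apply: Mint_eq => s sI.
  by rewrite addrK /cl clamp_id.
have /cvg_enormP/(_ _ e70) : (fun k => Mint (ratr p : R) (ratr q)
      (fun s => G s (xs k (cl (s - t))))) @ \oo -->
    Mint (ratr p : R) (ratr q) (fun s => G s (x (cl (s - t)))).
  apply: (GW j p q pq) => [k'||e' /xsx]; [exact: GK_Kset|exact: GK_Kset|].
  apply: filterS => k' H s _; apply: H; rewrite /Iq/= in_itv/=.
  by apply: clamp_itv; exact: ltW.
apply: filterS => k' Hk.
have B1 := bnd _ (ratr q1 + t) (ratr p) (xs1 k') T1 (ltW tp) pT pk.
have B2 := bnd _ (ratr q) (ratr q2 + t) (xs1 k') qT (ltW qt) T2 qk.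
have B3 := bnd _ (ratr q1 + t) (ratr p) x1 T1 (ltW tp) pT pk.
have B4 := bnd _ (ratr q) (ratr q2 + t) x1 qT (ltW qt) T2 qk.
rewrite (E _ (xs1 k')) (E _ x1).
apply: (@le_lt_trans _ _ (6 * (e / 7))); last by clear - e0; lra.
apply: (enorm_telescope B1 B2 B3 B4 (ltW Hk)).
by rewrite subrr enorm0 ltW.
Qed.

Lemma WTC_trans m n (G : @field R N m n) t : WTC th G -> WTC th (trans G t).
Proof.
move=> /[dup] GW [_ [_ cW]]; have gG := WTC_good GW.
have [? ?] := good_trans t gG; split => //; split => //; exact: condW_trans.
Qed.

Lemma LC_trans (g : @field R N N 1) t : LC g -> LC (trans g t).
Proof.
move=> /[dup] /LC_good/(good_trans t)[gC1 gC2] [_ [_ gL]]; split => //; split => //.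
move=> K /gL[l [lL gl]]; exists (fun s => l (s + t)); split; first exact: L1loc_shift.
exact: (ae_shift t gl).
Qed.

Lemma LC_lip (g : @field R N N 1) j : LC g -> exists l, [/\ L1loc l,
  forall s, 0 <= l s & {ae mu, forall s, forall x y, Bj j x -> Bj j y ->
    enorm (g s x - g s y) <= l s * enorm (x - y)}].
Proof.
move=> [_ [_ /(_ _ (@Bj_compact R N j))[l [lL gl]]]].
exists (fun s => `|l s|); split => //; first exact: L1loc_norm.
apply: aeS _ gl => s gl x y jx jy; apply: (le_trans (gl _ _ jx jy)).
by rewrite ler_wpM2r ?enorm_ge0// ler_norm.
Qed.

(** This makes the statements built on (W) available for the first component of the hull as well. *)
Lemma LC_WTC (g : @field R N N 1) : LC g -> WTC th g.
Proof.
move=> gLC; have gg := LC_good gLC; have [gC1 gC2] := gg.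
split => //; split => // j q1 q2 q12 xs x xsK xK xsx; apply/cvg_enormP => e e0.
have [l [lL l0 gl]] := LC_lip j gLC.
have q12' : ratr q1 < ratr q2 :> R by rewrite ltr_rat.
pose L := Rint (ratr q1) (ratr q2) l.
have L0 : 0 <= L by apply: Rint_ge0 => //; exact: aeW.
have eL : 0 < e / (L + 1) by rewrite divr_gt0// ltr_wpDl.
apply: filterS (xsx _ eL) => k xsk.
have xK' := Kset_GK fE q12 xK; have xsK' := Kset_GK fE q12 (xsK k).
rewrite [X in X - _]Mint_clamp [X in _ - X]Mint_clamp.
have xL := GK_ML1loc fE gg xK'; have xsL := GK_ML1loc fE gg xsK'.
rewrite -MintB//; apply: (@le_lt_trans _ _ (Rint (ratr q1) (ratr q2)
    (fun s => e / (L + 1) * l s))).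
  apply: enorm_Mint_le; [exact: ML1locB|exact: L1locZ|].
  apply: aeS _ gl => s gls _; apply: (le_trans (gls _ _ (xsK'.1 s) (xK'.1 s))).
  rewrite mulrC ler_wpM2r// ltW//; apply: xsk.
  by rewrite /Iq/= in_itv/=; apply: clamp_itv; exact: ltW.
rewrite RintZ// mulrAC ltr_pdivrMr; last by rewrite ltr_wpDl.
by rewrite ltr_pM2l// ltrDl.
Qed.

Lemma measurable_bigmax I (r : seq I) (u : I -> R -> R) :
  (forall i, measurable_fun setT (u i)) ->
  measurable_fun setT (fun s => \big[Num.max/0]_(i <- r) u i s).
Proof.
move=> mu_; elim: r => [|i r IHr]; first by under eq_fun do rewrite big_nil; exact: measurable_cst.
by under eq_fun do rewrite big_cons; exact: measurable_maxr.
Qed.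

Lemma tapprox_refl m n (F : @field R N m n) tau : good F -> tapprox f F (trans F tau).
Proof.
move=> gF ps d d0; exists tau => j q1 q2 _ q12.
apply: (le_lt_trans _ d0); apply: seminorm_le => // x xK.
suff -> : Mint (ratr q1) (ratr q2) (fun t => fsub (trans F tau) (trans F tau) t (x t)) = 0.
  by rewrite enorm0.
have xL := GK_ML1loc fE (good_trans tau gF) xK.
by rewrite /fsub MintB// subrr.
Qed.

(* Approximate x by a step path on a rational grid: constant paths belong to
   every K_j^I, so each piece is controlled by a seminorm. *)
Lemma hull_theta_rat (g : @field R N N 1) j x p q : good f -> LC g -> tapprox f f g ->
  ucont x -> (forall t, Bj j (x t)) -> p < q ->
  enorm (Mint (ratr p) (ratr q) (fun s => g s (x s))) <=
    Theta f j 0 0 (ratr q - ratr p).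
Proof.
move=> gf gLC fg xu xj pq; apply/ler_addgt0Pr => e e0.
have gg := LC_good gLC.
have pq' : ratr p < ratr q :> R by rewrite ltr_rat.
have [l [lL l0 gl]] := LC_lip j gLC.
pose L := Rint (ratr p) (ratr q) l.
have L0 : 0 <= L by apply: Rint_ge0 => //; exact: aeW.
(* Half of e pays for freezing x on the cells, through the Lipschitz mass L; the other half is
   shared by the n seminorms. *)
have w0 : 0 < e / 2 / (L + 1) by rewrite !divr_gt0// ltr_wpDl.
have [d d0 xd] := xu _ w0.
have [n n0 nd] := mesh_ex (ratr q - ratr p) d0.
pose r i := qgrid p q n i.
have rlt i : r i < r i.+1 by exact: qgrid_lt.
have rle i : ratr (r i) <= ratr (r i.+1) :> R by rewrite ler_rat ltW.
have rS i : ratr (r i.+1) - ratr (r i) = (ratr q - ratr p) / n%:R :> R by exact: qgrid_step.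
pose c i := x (ratr (r i)).
have cK i : GK f j (fun=> c i) by apply: GK_cst => //; exact: xj.
have en0 : 0 < e / 2 / n%:R by rewrite !divr_gt0// ltr0n.
have [tau fgt] := fg [seq (j, r i, r i.+1) | i <- iota 0 n] _ en0.
have gft := good_trans tau gf.
have [mb gmb] : exists mb, mbound g (Bj j) mb.
  by case: gg => _ /(_ _ (@Bj_compact R N j)).
have gxL : ML1loc (fun s => g s (x s)) by case: gg => gC1 _; exact: comp_ML1loc gC1 gmb xu xj.
(* A Borel stand-in for [mopt]: it dominates |f| at the finitely many values of the step path, stays
   below [mopt] almost everywhere, and its integral is additive over the cells. *)
pose phi s := \big[Num.max/0]_(i < n) enorm (f s (c i)).
have phi0 s : 0 <= phi s by exact: bigmax_ge_id.
have phic s (i : 'I_n) : enorm (f s (c i)) <= phi s.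
  exact: (le_bigmax _ (fun i : 'I_n => enorm (f s (c i)))).
have phim : {ae mu, forall s, phi s <= mopt f j s}.
  apply: aeS _ (le_mopt fE j) => s fs; apply/bigmax_leP; split; first exact: mopt_ge0.
  by move=> i _; apply: fs; exact: xj.
have [mf fmf] := equi_mbound j fE; have [mfL _] := fmf.
have phiL : L1loc phi.
  apply: L1loc_le mfL _.
    apply: measurable_bigmax => i; apply: (C1_comp_measurable (x := fun=> c i)).
    - by case: gf.
    - by move=> s; exact: cvg_cst.
    - exact: enorm_continuous.
  by apply: aeS2 _ phim (mopt_le fmf) => s; rewrite ger0_norm//; exact: le_trans.
have piece (i : 'I_n) : enorm (Mint (ratr (r i)) (ratr (r i.+1)) (fun s => g s (x s))) <=
    e / 2 / (L + 1) * Rint (ratr (r i)) (ratr (r i.+1)) l + e / 2 / n%:R +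
    Rint (ratr (r i)) (ratr (r i.+1)) (fun s => phi (s + tau)).
  set A := Mint _ _ _.
  pose B := Mint (ratr (r i)) (ratr (r i.+1)) (fun s => g s (c i)).
  pose C := Mint (ratr (r i)) (ratr (r i.+1)) (fun s => trans f tau s (c i)).
  have gcL := GK_ML1loc fE gg (cK i); have fcL := GK_ML1loc fE gft (cK i).
  have -> : A = (A - B) + (B - C) + C by rewrite subrKA subrK.
  apply: (le_trans (ler_enormD _ _)); apply: lerD.
    apply: (le_trans (ler_enormD _ _)); apply: lerD.
      rewrite /A /B -MintB// -RintZ//; apply: enorm_Mint_le; [exact: ML1locB|exact: L1locZ|].
      apply: aeS _ gl => s gls /andP[s1 s2].
      apply: (le_trans (gls _ _ (xj _) (xj _))).
      rewrite mulrC ler_wpM2r// ltW//; apply: xd.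
      rewrite ger0_norm ?subr_ge0//; apply: (le_lt_trans _ nd).
      by rewrite -(rS i) lerD2r.
    rewrite enormB /B /C -MintB// ltW//; apply: (nb_GK fE gg gft fgt _ (rlt i) (cK i)).
    by apply/mapP; exists (i : nat); rewrite ?mem_iota//=.
  apply: enorm_Mint_le => //; first exact: L1loc_shift.
  by apply: aeW => s _; exact: phic.
pose rr i : R := ratr (r i).
have -> : Mint (ratr p) (ratr q) (fun s => g s (x s)) =
    \sum_(i < n) Mint (rr i) (rr i.+1) (fun s => g s (x s)).
  by rewrite -(Mint_grid _ gxL rle) /r qgrid0 qgridn.
apply: (le_trans (ler_enorm_sum _ _ _)).
apply: (le_trans (ler_sum _ (fun i _ => piece i))).
have phisL := L1loc_shift tau phiL.
rewrite !big_split /= -big_distrr /= -(Rint_grid (r := rr) _ lL rle).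
rewrite -(Rint_grid (r := rr) _ phisL rle) /rr /r qgrid0 qgridn// -/L.
rewrite sumr_const card_ord -[X in _ + X + _ <= _]mulr_natr divfK ?pnatr_eq0 -?lt0n//.
rewrite Rint_shift//.
(* theta_j is a supremum over all windows of the given length, so the unknown tau drops out. *)
have H1 : Rint (ratr p + tau) (ratr q + tau) phi <= Theta f j 0 0 (ratr q - ratr p).
  have -> : ratr q - ratr p = (ratr q + tau) - (ratr p + tau) :> R by rewrite opprD addrACA subrr addr0.
  apply: (le_trans _ (Rint_mopt_theta fE j _)); last by rewrite lerD2r ltW.
  by apply: Rint_le_lower mfL (mopt_le fmf) phim => //; exact: mopt_ge0.
have H2 : e / 2 / (L + 1) * L <= e / 2.
  rewrite mulrAC ler_pdivrMr ?ltr_wpDl// ler_wpM2l ?divr_ge0 ?(ltW e0)//.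
  by rewrite lerDl.
by move: H1 H2; clear; move: (Rint _ _ phi) (_ * L) => u v; lra.
Qed.

(** The path is only assumed uniformly continuous with values in B_j, not admissible. This allows
    admissibility of a trajectory to be deduced from the estimate without circularity. *)
Lemma hull_theta (g : @field R N N 1) j x a b : good f -> LC g -> tapprox f f g ->
  ucont x -> (forall t, Bj j (x t)) -> a <= b ->
  enorm (Mint a b (fun s => g s (x s))) <= Theta f j 0 0 (b - a).
Proof.
move=> gf gLC fg xu xj; rewrite le_eqVlt => /predU1P[->|ab].
  by rewrite Mint_nil enorm0 theta_ge0// subrr.
have gg := LC_good gLC.
have [mb gmb] : exists mb, mbound g (Bj j) mb.
  by case: gg => _ /(_ _ (@Bj_compact R N j)).
have gxL : ML1loc (fun s => g s (x s)) by case: gg => gC1 _; exact: comp_ML1loc gC1 gmb xu xj.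
have [mbL mbP] := gmb.
apply/ler_addgt0Pr => e e0; have e20 : 0 < e / 2 by rewrite divr_gt0.
pose T := Num.max `|a| `|b|.
have [k k0 small] := Rint_small T mbL e20.
have [p [q [pq tp qt pk qk]]] := rat_inside ab k0.
have pq' : ratr p < ratr q :> R by rewrite ltr_rat.
have T1 : - T <= a by rewrite lerNl (le_trans (ler_norm _))// normrN le_max lexx.
have T2 : b <= T by rewrite (le_trans (ler_norm _))// le_max lexx orbT.
have [pT qT] : ratr p <= T /\ - T <= ratr q.
  by clear - T1 T2 pq' qt tp; split; lra.
have bnd c d : - T <= c -> c <= d -> d <= T -> d - c < k ->
    enorm (Mint c d (fun s => g s (x s))) <= e / 2.
  move=> Tc cd dT dck; apply/ltW/(le_lt_trans _ (small c d Tc cd dT dck)).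
  apply: enorm_Mint_le => //; first exact: L1loc_norm.
  apply: aeS _ mbP => s /(_ _ (xj s)) H _; apply: (le_trans H); exact: ler_norm.
have B1 := bnd a (ratr p) T1 (ltW tp) pT pk.
have B2 := bnd (ratr q) b qT (ltW qt) T2 qk.
have B3 := hull_theta_rat gf gLC fg xu xj pq.
have B4 : Theta f j 0 0 (ratr q - ratr p) <= Theta f j 0 0 (b - a).
  by apply: theta_mono => //; clear - pq' qt tp; lra.
rewrite (@Mint_cat _ (ratr p) _ _ _ a)//; [|exact: ltW|by rewrite (le_trans (ltW pq'))// ltW].
rewrite (@Mint_cat _ (ratr q) _ _ _ (ratr p))//; [|exact: ltW|exact: ltW].
set M1 := Mint _ _ _ in B1 *; set M2 := Mint _ _ _ in B2 *; set M3 := Mint _ _ _ in B3 *.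
have := ler_enormD M1 (M3 + M2); have := ler_enormD M3 M2.
by move: B1 B2 B3 B4; clear; lra.
Qed.

End HullInvariance.

(** * Truncated equations *)

Section UniformIntegrals.
Context {R : realType} {N : nat} (f : @field R N N 1).
Hypothesis fE : equi_mbounds f.
Local Notation th := (Theta f).

(** Every subinterval of [- T, T] is short or splits into a grid interval and two short ends, hence
    the factor 3. The finite list [ps] depends on T and d only and serves all u. *)
Lemma grid_bound (T : nat) (d : R) : 0 < d -> exists ps : seq (rat * rat),
  forall m n (u : R -> 'M[R]_(m, n)) (e : R), ML1loc u ->
  (forall a b, - T%:R <= a -> a <= b -> b <= T%:R -> b - a < d ->
    enorm (Mint a b u) <= e) ->
  (forall p q, (p, q) \in ps -> p < q -> enorm (Mint (ratr p) (ratr q) u) <= e) ->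
  forall a b, - T%:R <= a -> a <= b -> b <= T%:R -> enorm (Mint a b u) <= 3 * e.
Proof.
move=> d0; have d20 : 0 < d / 2 by rewrite divr_gt0.
(* With mesh below d / 2, an interval that meets at most two neighbouring cells is still short. *)
have [n n0 nd] := mesh_ex (2 * T%:R) d20.
set h := _ / _ in nd.
have h0 : 0 <= h by rewrite divr_ge0// mulr_ge0.
(* A natural T makes the grid points rational. *)
pose r i : rat := - T%:R + 2 * T%:R * i%:R / n%:R.
have rE i : ratr (r i) = - T%:R + i%:R * h :> R.
  rewrite /r /h rmorphD rmorphN /= ratr_nat fmorph_div !rmorphM /= !ratr_nat.
  by rewrite [in RHS]mulrA [in RHS](mulrC i%:R).
exists [seq (r i, r k) | i <- iota 0 n.+2, k <- iota 0 n.+2].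
move=> m l u e uL small grid a b Ta ab bT.
have e0 : 0 <= e.
  apply: le_trans (small a a Ta (lexx a) (le_trans ab bT) _); first exact: enorm_ge0.
  by rewrite subrr.
have nh : - T%:R + n%:R * h = T%:R.
  rewrite /h [n%:R * _]mulrC divfK ?pnatr_eq0 -?lt0n//; lra.
have [h00|hN0] := eqVneq h 0.
  move: nh; rewrite h00 mulr0 addr0 => nh; have -> : a = b by lra.
  by rewrite Mint_nil enorm0; lra.
have [|i il /andP[i1 i2]] := @grid_point _ (- T%:R) h a n Ta _ h0.
  by rewrite nh (le_trans ab).
have [|k kl /andP[k1 k2]] := @grid_point _ (- T%:R) h b n (le_trans Ta ab) _ h0.
  by rewrite nh.
have [ik|ki] := ltnP i.+1 k; last first.
  apply: (@le_trans _ _ e); last by clear - e0; lra.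
  apply: small => //; have : k%:R <= i%:R + 1 :> R by rewrite natr1 ler_nat.
  move=> /(ler_wpM2r h0); rewrite mulrDl mul1r => H.
  by clear - i1 k2 nd H; lra.
have i2' : a <= ratr (r i.+1) by rewrite rE -natr1 mulrDl mul1r addrA.
have k1' : ratr (r k) <= b by rewrite rE.
have ik' : ratr (r i.+1) < ratr (r k) :> R.
  rewrite !rE ltrD2l ltr_pM2r ?ltr_nat//.
  by rewrite lt_neqAle h0 andbT eq_sym.
have B1 : enorm (Mint a (ratr (r i.+1)) u) <= e.
  apply: small => //; first by rewrite (le_trans (ltW ik'))// (le_trans k1').
  by rewrite rE -natr1 mulrDl mul1r; clear - i1 nd d0; lra.
have B2 : enorm (Mint (ratr (r k)) b u) <= e.
  apply: small => //; first by rewrite (le_trans _ (ltW ik'))// (le_trans Ta).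
  by rewrite rE; clear - k2 nd d0; lra.
have B3 : enorm (Mint (ratr (r i.+1)) (ratr (r k)) u) <= e.
  apply: grid; last by rewrite -(ltr_rat R).
  by apply/allpairsP; exists (i.+1, k); rewrite !mem_iota/= !add0n; split => //;
    rewrite ltnS ?ltnS// ltnW// ltnS.
rewrite (@Mint_cat _ (ratr (r i.+1)) _ _ _ a)//; last by rewrite (le_trans (ltW ik')).
rewrite (@Mint_cat _ (ratr (r k)) _ _ _ (ratr (r i.+1)))//; last exact: ltW.
set M1 := Mint _ _ _ in B1 *; set M2 := Mint _ _ _ in B2 *; set M3 := Mint _ _ _ in B3 *.
have := ler_enormD M1 (M3 + M2); have := ler_enormD M3 M2.
by move: B1 B2 B3; clear; lra.
Qed.

(** Integrals over all subintervals converge jointly in the field and the path. Short intervals are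
    handled by the uniform smallness over the hull, applied to G' and G; on the finitely many grid
    intervals a seminorm changes the field and uniform (W) changes the path. Each case costs e / 6 +
    e / 6 = e / 3, which the grid triples. *)
Lemma GK_int_small m n (F G : @field R N m n) j (T : nat) (e : R) : good F ->
  equi_mbounds F -> WTC th G -> tapprox f F G -> 0 < e ->
  exists ps, exists d, exists h, [/\ 0 < d, 0 < h & forall G', good G' ->
    tapprox f F G' -> nb th ps d G G' -> forall x z, GK f j x -> GK f j z ->
    (forall t, enorm (x t - z t) <= h) -> forall a b, - T%:R <= a -> a <= b ->
    b <= T%:R -> enorm (Mint a b (fun s => G' s (x s) - G s (z s))) <= e].
Proof.
move=> gF FE GW FG e0; have gG := WTC_good GW; have [_ [_ cW]] := GW.
have e60 : 0 < e / 6 by rewrite divr_gt0.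
have [d d0 small] := hull_small fE j T%:R gF FE e60.
have [ps grid] := grid_bound T d0.
have [h h0 Wh] : exists2 h : R, 0 < h & forall x z, GK f j x -> GK f j z ->
    (forall t, enorm (x t - z t) <= h) -> forall p q, (p, q) \in ps -> p < q ->
    enorm (Mint (ratr p) (ratr q) (fun s => G s (x s)) -
           Mint (ratr p) (ratr q) (fun s => G s (z s))) < e / 6.
  elim: ps {grid} => [|[p q] ps [h h0 IH]]; first by exists 1.
  have [pq|qp] := ltP p q; last first.
    exists h => // x z xK zK xz p' q'; rewrite in_cons => /predU1P[[-> ->]|].
      by rewrite ltNge qp.
    exact: IH.
  have [h' h'0 IH'] := condW_uniform fE j cW pq e60.
  exists (Num.min h h'); first by rewrite lt_min h0.
  move=> x z xK zK xz p' q'; rewrite in_cons => /predU1P[[-> ->] _|].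
    by apply: IH' => // t; apply: le_trans (xz t) _; rewrite ge_min lexx orbT.
  by apply: IH => // t; apply: le_trans (xz t) _; rewrite ge_min lexx.
exists [seq (j, pq.1, pq.2) | pq <- ps], (e / 6), h; split => //.
move=> G' gG' FG' GG' x z xK zK xz a b Ta ab bT.
have L1 := GK_ML1loc fE gG' xK; have L2 := GK_ML1loc fE gG zK.
have L3 := GK_ML1loc fE gG xK.
have -> : e = 3 * (e / 3) by rewrite mulrC divfK.
apply: (grid _ _ _ _ (ML1locB L1 L2)) => // [c k Tc ck kT kcd|p q pqps pq].
  have bnd G0 w : good G0 -> tapprox f F G0 -> GK f j w ->
      enorm (Mint c k (fun s => G0 s (w s))) <= e / 6.
    move=> gG0 FG0 wK; apply: (le_trans _ (small _ _ _ _ gG0 FG0 wK Tc ck kT kcd)).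
    have wL := GK_ML1loc fE gG0 wK; apply: enorm_Mint_le => //; first exact: lsum_L1loc.
    by apply: aeW => s _; exact: enorm_lsum.
  rewrite MintB//; apply: (le_trans (ler_enormD _ _)); rewrite enormN.
  have := bnd _ _ gG' FG' xK; have := bnd _ _ gG FG zK.
  by clear; lra.
have H1 := Wh x z xK zK xz p q pqps pq.
have H2 : enorm (Mint (ratr p) (ratr q) (fun t => G' t (x t) - G t (x t))) < e / 6.
  apply: (nb_GK fE gG gG' GG' _ pq xK).
  by apply/mapP; exists (p, q).
rewrite MintB// in H2; rewrite MintB//.
apply: (le_trans (ler_enorm_dist (Mint (ratr p) (ratr q) (fun s => G s (x s))) _ _)).
by move: H1 H2; clear; lra.
Qed.

End UniformIntegrals.

(** * Solutions of the truncated equation and their comparison *)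

Section Truncated.
Context {R : realType} {N : nat} (f : @field R N N 1).
Local Notation vec := 'cV[R]_N.
Local Notation mu := (@lebesgue_measure R).
Hypotheses (fE : equi_mbounds f) (gf : good f).
Local Notation th := (Theta f).
Implicit Types (g k : @field R N N 1) (G : @field R N N N) (j T : nat).

(** The integral equation on [- T, T], with the solution frozen outside so that it is a uniformly
    continuous path on R. *)
Definition isol T (phi : R -> vec -> vec) (y0 : vec) (y : R -> vec) :=
  ucont y /\ forall t, y t = y0 +
    oMint 0 (clamp (- T%:R) T%:R t) (fun s => phi s (y s)).

Lemma opp_nat_le T : - T%:R <= T%:R :> R.
Proof. by rewrite lerNl (le_trans _ (ler0n _ T))// oppr_le0. Qed.

Lemma isol_clamp T phi y0 y t : isol T phi y0 y -> y (clamp (- T%:R) T%:R t) = y t.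
Proof.
move=> [_ yE]; rewrite yE [RHS]yE; congr (_ + oMint _ _ _); rewrite clamp_id//.
exact/clamp_itv/opp_nat_le.
Qed.

Lemma isol_eq T phi y0 y t : isol T phi y0 y -> - T%:R <= t <= T%:R ->
  y t = y0 + oMint 0 t (fun s => phi s (y s)).
Proof. by move=> [_ yE] tT; rewrite [LHS]yE clamp_id. Qed.

Lemma isol_bounded T phi y0 y : isol T phi y0 y -> ML1loc (fun s => phi s (y s)) ->
  exists2 M : R, 0 <= M & forall t, enorm (y t) <= M.
Proof.
move=> [_ yE] phiL.
exists (enorm y0 + Rint (- T%:R) T%:R (lsum (fun s => phi s (y s)))).
  rewrite addr_ge0 ?enorm_ge0//; apply: Rint_ge0; first exact: lsum_L1loc.
  by apply: aeW => s _; exact: lsum_ge0.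
move=> t; rewrite [y t]yE; apply: (le_trans (ler_enormD _ _)); rewrite lerD2l.
apply: (le_trans (primitive_lip _ _ phiL)); apply: Rint_half_lsum => //.
by rewrite ler_norml; exact/clamp_itv/opp_nat_le.
Qed.

Definition tphi g j : R -> vec -> vec := fun s y => g s (bproj j y).
Definition lphi G k (z : R -> vec) : R -> vec -> vec :=
  fun s y => G s (z s) *m y + k s (z s).

Lemma tphi_ML1loc g j x : good g -> ucont x -> ML1loc (fun s => tphi g j s (x s)).
Proof. by move=> [gC1 gC2] xu; exact: comp_bproj_ML1loc. Qed.

Lemma tphi_lip g j : LC g -> exists l, [/\ L1loc l, forall s, 0 <= l s &
  {ae mu, forall s, forall x y, enorm (tphi g j s x - tphi g j s y) <= l s * enorm (x - y)}].
Proof.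
move=> gLC; have [l [lL l0 gl]] := LC_lip j gLC; exists l; split => //.
apply: aeS _ gl => s gls x y; apply: (le_trans (gls _ _ (bprojB j x) (bprojB j y))).
by rewrite ler_wpM2l// bproj_lip.
Qed.

Lemma tsol_ex g j T x0 : LC g -> exists x, isol T (tphi g j) x0 x.
Proof.
move=> gLC; have [l [lL l0 gl]] := tphi_lip j gLC; have gg := LC_good gLC.
have [|x xu xE] := picard x0 (ler0n R T) lL l0 _ gl.
  by move=> y yu; exact: tphi_ML1loc.
by exists x.
Qed.

(** An increment of x is an integral of g along P x, which is uniformly continuous with values in
    B_j, so [hull_theta] applies. Neither P nor the clamping of time enlarges the modulus. *)
Lemma tsol_GK g j T x0 x : LC g -> tapprox f f g -> isol T (tphi g j) x0 x ->
  GK f j (fun s => bproj j (x s)).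
Proof.
move=> gLC fg xS; have [xu xE] := xS; split=> [t|s t]; first exact: bprojB.
wlog st : s t / s <= t.
  move=> H; have [/H//|/ltW/H] := leP s t; by rewrite enormB distrC.
apply: (le_trans (bproj_lip _ _ _)).
pose cl : R -> R := clamp (- T%:R) T%:R.
have clst : cl s <= cl t.
  rewrite /cl /clamp; have := opp_nat_le T; move: (T%:R : R) st => r.
  by clear; case: (leP r s) => ?; case: (leP r t) => ?; move=> *;
     case: (leP (- r) s) => ?; case: (leP (- r) t) => ?; case: (leP (- r) r) => ?; lra.
have xL := tphi_ML1loc j (LC_good gLC) xu.
have -> : x t - x s = Mint (cl s) (cl t) (fun u => g u (bproj j (x u))).
  rewrite xE [in X in _ - X]xE opprD addrACA subrr add0r -(oMint_ge _ clst) -/cl.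
  by rewrite (@oMint_cat _ (cl s) _ _ _ 0 (cl t))// addrAC subrr add0r.
have H : enorm (Mint (cl s) (cl t) (fun u => g u (bproj j (x u)))) <= Theta f j 0 0 (cl t - cl s).
  apply: (@hull_theta _ _ f fE g j (fun u => bproj j (x u))) => //.
    exact: ucont_bproj.
  by move=> u; exact: bprojB.
apply: (le_trans H).
apply: theta_mono => //; first by rewrite subr_ge0.
apply: le_trans (clamp_lip s t (opp_nat_le T)); exact: ler_norm.
Qed.

(** The defect g' - g is integrated along P x' alone, so closeness of the paths is not presupposed.
    What remains is a difference of values of g, governed by the Lipschitz function of g; [ps], [d]
    and [h] are therefore fixed before g'. *)
Lemma tsol_compare g j T x0 (e : R) : LC g -> tapprox f f g -> 0 < e ->
  exists ps, exists d, exists h, [/\ 0 < d, 0 < h & forall g' x0' x x', LC g' ->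
    tapprox f f g' -> nb th ps d g g' -> enorm (x0' - x0) < h ->
    isol T (tphi g j) x0 x -> isol T (tphi g' j) x0' x' ->
    forall t, enorm (x' t - x t) <= e].
Proof.
move=> gLC fg e0; have gg := LC_good gLC.
have [l [lL l0 gl]] := tphi_lip j gLC.
have [n [hh [hh0 nhT lh]]] := L1loc_mesh lL l0 (ler0n R T).
(* The initial values and the defect cost h each, and Gronwall's lemma gives 2 (h + h) 2^n = e. *)
pose h : R := e / 4 / 2 ^+ n.
have p2n : 0 < 2 ^+ n :> R by rewrite exprn_gt0.
have h0 : 0 < h by rewrite !divr_gt0.
have [ps [d [h' [d0 h'0 small]]]] :=
  GK_int_small fE j T gf fE (LC_WTC fE gLC) fg h0.
exists ps, d, h; split => // g' x0' x x' gLC' fg' gg'n x00 xS xS'.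
have gg' := LC_good gLC'.
have [xu xE] := xS; have [xu' xE'] := xS'.
have xL := tphi_ML1loc j gg xu; have xL' := tphi_ML1loc j gg' xu'.
have xL2 := tphi_ML1loc j gg xu'.
have z'K := tsol_GK gLC' fg' xS'.
have [M M0 xM] := isol_bounded xS xL; have [M' M'0 xM'] := isol_bounded xS' xL'.
pose phi s := tphi g j s (x' s) - tphi g j s (x s).
have phiL : ML1loc phi by exact: ML1locB.
have main t : - T%:R <= t <= T%:R -> enorm (x' t - x t) <= 2 * (h + h) * 2 ^+ n.
  apply: (@gronwall _ n hh l _ _ (fun t => x' t - x t) phi (h + h) (M' + M)
    (- T%:R) T%:R) => //; rewrite ?nhT ?oppr_le0//.
  - by rewrite addr_ge0// ltW.
  - move=> s _; apply: (le_trans (ler_enormD _ _)); rewrite enormN.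
    by rewrite lerD.
  - move=> s sT; rewrite (isol_eq xS sT) (isol_eq xS' sT) oMintB//.
    set A' := oMint _ _ _; set A := oMint _ _ _; set B := oMint _ _ _.
    have H : enorm (A' - B) <= h.
      rewrite -oMintB// enorm_oMint; move/andP : sT => [sT1 sT2].
      apply: (small _ gg' fg' gg'n _ _ z'K z'K).
      - by move=> r; rewrite subrr enorm0 ltW.
      - by rewrite le_min oppr_le0 ler0n.
      - by rewrite ge_min le_max lexx.
      - by rewrite ge_max ler0n.
    have -> : x0' + A' - (x0 + A) = (x0' - x0) + (A' - B) + (B - A).
      by apply/matrixP => r r'; rewrite !mxE; ring.
    apply: (le_trans (ler_enormD _ _)); rewrite lerD2r.
    by apply: (le_trans (ler_enormD _ _)); rewrite lerD// ltW.
  - by apply: aeS _ gl => s gls _; exact: gls.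
move=> t; rewrite -(isol_clamp t xS) -(isol_clamp t xS').
apply: (le_trans (main _ (clamp_itv _ (opp_nat_le T)))).
rewrite /h le_eqVlt; apply/orP; left; apply/eqP; field.
by rewrite gt_eqF.
Qed.

End Truncated.

(** * The linear equation along an admissible path *)

Section Linear.
Context {R : realType} {N : nat} (f : @field R N N 1).
Local Notation vec := 'cV[R]_N.
Hypothesis fE : equi_mbounds f.
Local Notation th := (Theta f).
Implicit Types (g k : @field R N N 1) (G : @field R N N N) (j T : nat).

(** v is bounded on [a, b]; clamping its argument to that interval produces a globally bounded
    measurable factor. *)
Lemma L1locM_continuous (u v : R -> R) : L1loc u -> continuous v ->
  L1loc (fun s => u s * v s).
Proof.
move=> uL cv a b; have [ab|ba] := leP a b; last first.
  by rewrite set_itv_ge ?bnd_simp -?ltNge//; exact: integrable_set0.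
have [M [Mr vM]] : bounded_set (v @` `[a, b]).
  apply: compact_bounded; apply: continuous_compact; last exact: segment_compact.
  exact: continuous_subspaceT.
have mv : measurable_fun setT (fun s => v (clamp a b s)).
  apply: measurableT_comp; first exact: continuous_measurable_fun.
  by apply: measurable_maxr => //; exact: measurable_minr.
have bv s : `|v (clamp a b s)| <= M + 1.
  apply: vM; first by rewrite ltrDl.
  by exists (clamp a b s) => //=; rewrite in_itv/=; exact: clamp_itv.
apply: eq_integrable (L1locM uL mv bv a b) => // s.
by rewrite inE/= in_itv/= => sab; rewrite /= clamp_id.
Qed.

Lemma ucont_coord (y : R -> vec) i : ucont y -> continuous (fun s => y s i 0).
Proof.
move=> yu s; apply: (@continuous_comp _ _ _ y (fun A : vec => A i 0) s).
  exact: ucont_continuous.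
exact: coord_continuous.
Qed.

Lemma mulmx_ML1loc (A : R -> 'M[R]_N) (y : R -> vec) : ML1loc A -> ucont y ->
  ML1loc (fun s => A s *m y s).
Proof.
move=> AL yu i o; rewrite (ord1 o); under eq_fun do rewrite mxE.
by apply: L1loc_sum => l; apply: L1locM_continuous => //; exact: ucont_coord.
Qed.

Lemma enorm_mulmx_lsum (A : R -> 'M[R]_N) (y : vec) s :
  enorm (A s *m y) <= lsum A s * enorm y.
Proof. by have := enorm_mulmx (A s) y; rewrite big_ord1 mulr1. Qed.

Lemma lphi_ML1loc G k z y : ML1loc (fun s => G s (z s)) -> ML1loc (fun s => k s (z s)) ->
  ucont y -> ML1loc (fun s => lphi G k z s (y s)).
Proof. by move=> GL kL yu; apply: ML1locD => //; exact: mulmx_ML1loc. Qed.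

Lemma lsol_ex G k z T y0 : ML1loc (fun s => G s (z s)) -> ML1loc (fun s => k s (z s)) ->
  exists y, isol T (lphi G k z) y0 y.
Proof.
move=> GL kL; have lL := lsum_L1loc GL.
have [| |y yu yE] := @picard R N T%:R _ (lphi G k z) y0 (ler0n R T) lL
  (fun s => lsum_ge0 _ s); last by exists y.
  by move=> y yu; exact: lphi_ML1loc.
apply: aeW => s y y'; rewrite /lphi opprD addrACA subrr addr0 -mulmxBr.
exact: (enorm_mulmx_lsum (fun s => G s (z s))).
Qed.

Lemma Mint_mulmx (A : R -> 'M[R]_N) (c : vec) a b : ML1loc A ->
  Mint a b (fun s => A s *m c) = Mint a b A *m c.
Proof.
move=> AL; apply/matrixP => i o; rewrite !mxE.
under [LHS]Rint_eq do rewrite mxE.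
rewrite Rint_sum => [|l].
  apply: eq_bigr => l _; rewrite mxE mulrC -RintZ//.
  by apply: Rint_eq => s _; rewrite mulrC.
under eq_fun do rewrite mulrC.
exact: L1locZ.
Qed.

Lemma sum_abs_enorm (A : 'M[R]_N) :
  \sum_i \sum_l `|A i l| <= (\sum_(i < N) \sum_(l < N) 1) * enorm A.
Proof.
rewrite big_distrl; apply: ler_sum => i _ /=; rewrite big_distrl.
by apply: ler_sum => l _ /=; rewrite mul1r le_enorm.
Qed.

(* Weak convergence against a continuous factor: freeze y on short intervals. *)
Lemma Mint_mulmx_small (D : R -> 'M[R]_N) (y : R -> vec) (T w len M e : R) (n : nat) :
  ML1loc D -> ucont y -> 0 <= len -> 0 <= M -> 0 <= w ->
  (forall s t, `|t - s| <= len -> enorm (y t - y s) <= w) ->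
  (forall t, enorm (y t) <= M) ->
  (forall a b, - T <= a -> a <= b -> b <= T -> enorm (Mint a b D) <= e) ->
  forall a b, - T <= a -> a <= b -> b <= T -> b - a <= n%:R * len ->
  enorm (Mint a b (fun s => D s *m y s)) <=
    n%:R * ((\sum_(i < N) \sum_(l < N) 1) * e * M) + w * Rint a b (lsum D).
Proof.
move=> DL yu len0 M0 w0 yw yM De; have DyL := mulmx_ML1loc DL yu.
have lL := lsum_L1loc DL.
set K : R := \sum_(i < N) _.
have K0 : 0 <= K by rewrite sumr_ge0// => i _; rewrite sumr_ge0.
have one a b : - T <= a -> a <= b -> b <= T -> b - a <= len ->
    enorm (Mint a b (fun s => D s *m y s)) <= K * e * M + w * Rint a b (lsum D).
  move=> Ta ab bT bal.
  have cL : ML1loc (fun s => D s *m y a) by apply: mulmx_ML1loc => //; exact: ucont_cst.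
  rewrite -(subrK (Mint a b (fun s => D s *m y a)) (Mint a b (fun s => D s *m y s))).
  rewrite -MintB// addrC; apply: (le_trans (ler_enormD _ _)); apply: lerD.
    rewrite Mint_mulmx//; apply: (le_trans (enorm_mulmx _ _)); rewrite big_ord1 mulr1.
    apply: ler_pM => //; [by rewrite sumr_ge0// => i _; rewrite sumr_ge0|exact: enorm_ge0|].
    by apply: (le_trans (sum_abs_enorm _)); rewrite ler_wpM2l// De.
  rewrite -RintZ//; apply: enorm_Mint_le; [exact: ML1locB|exact: L1locZ|].
  apply: aeW => s /andP[as_ sb]; rewrite -mulmxBr.
  apply: (le_trans (enorm_mulmx_lsum _ _ _)); rewrite mulrC ler_wpM2r ?lsum_ge0//.
  by apply: yw; rewrite ger0_norm ?subr_ge0//; clear - bal sb as_; lra.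
elim: n => [|n IHn] a b Ta ab bT.
  rewrite mul0r => ba; have -> : a = b by clear - ab ba; lra.
  by rewrite Mint_nil Rint_nil enorm0 mul0r mulr0 addr0.
rewrite -natr1 !mulrDl !mul1r => ban.
have Ke : 0 <= K * e * M.
  by rewrite !mulr_ge0//; apply: le_trans (De a b Ta ab bT); exact: enorm_ge0.
have [bal|bal] := leP (b - a) len.
  apply: (le_trans (one a b Ta ab bT bal)); rewrite lerD2r lerDr.
  by rewrite mulr_ge0.
have c1 : a <= b - len by clear - bal; lra.
have c2 : b - len <= b by clear - len0; lra.
have c3 : b - len - a <= n%:R * len by clear - ban; lra.
have c4 : b - (b - len) <= len by clear - len0; lra.
rewrite (@Mint_cat _ (b - len))// (@Rint_cat _ (b - len))//.
apply: (le_trans (ler_enormD _ _)).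
have H1 := IHn a (b - len) Ta c1 (le_trans c2 bT) c3.
have H2 := one (b - len) b (le_trans Ta c1) c2 bT c4.
move: H1 H2; clear - len0; move: (enorm _) (enorm _) (Rint _ _ _) (Rint _ _ _) => *.
by lra.
Qed.

Lemma lsol_compare (F : @field R N N N) (h : @field R N N 1) G k j T z y0 y (e : R) :
  good F -> equi_mbounds F -> good h -> equi_mbounds h ->
  WTC th G -> tapprox f F G -> WTC th k -> tapprox f h k -> GK f j z ->
  isol T (lphi G k z) y0 y -> 0 < e ->
  exists ps, exists d, exists r, [/\ 0 < d, 0 < r & forall G' k' z' y0' y',
    good G' -> tapprox f F G' -> good k' -> tapprox f h k' -> GK f j z' ->
    nb th ps d G G' -> nb th ps d k k' -> (forall t, enorm (z' t - z t) <= r) ->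
    enorm (y0' - y0) < r -> isol T (lphi G' k' z') y0' y' ->
    forall t, enorm (y' t - y t) <= e].
Proof.
move=> gF FE gh hE GW FG kW hk zK yS e0.
have gG := WTC_good GW; have gk := WTC_good kW.
have GL := GK_ML1loc fE gG zK; have kL := GK_ML1loc fE gk zK.
have [yu yE] := yS; have yL := lphi_ML1loc GL kL yu.
have [M M0 yM] := isol_bounded yS yL.
have q0 : 0 < 4^-1 :> R by rewrite invr_gt0.
(* Cells of mass at most 1/4 for every G' in the hull and every admissible z' at once: n, and with
   it the Gronwall constant, does not depend on G'. *)
have [d1 d10 small] := hull_small fE j T%:R gF FE q0.
have [n n0 nd] := mesh_ex T%:R d10.
pose hh : R := T%:R / n%:R.
have hh0 : 0 <= hh by rewrite divr_ge0.
have nhT : n%:R * hh = T%:R by rewrite /hh mulrC divfK// pnatr_eq0 -lt0n.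
have [C C0 bounded] := hull_bounded fE j T%:R gF FE.
have p2n : 0 < 2 ^+ n :> R by rewrite exprn_gt0.
(* Gronwall's lemma is applied with a = 4 eta and returns 2 (4 eta) 2^n = e. *)
pose eta : R := e / 8 / 2 ^+ n.
have eta0 : 0 < eta by rewrite !divr_gt0.
(* Freezing y costs w times the L^1 mass of G' - G, which is at most 2 C. *)
pose w := eta / (2 * C + 1).
have C20 : 0 < 2 * C + 1 by clear - fE C0; lra.
have w0 : 0 < w by rewrite divr_gt0.
have [len len0 ylen] := yu _ w0.
have len20 : 0 < len / 2 by rewrite divr_gt0.
have [l l0 ld] := mesh_ex (2 * T%:R) len20.
set len' := 2 * T%:R / l%:R in ld.
have len'0 : 0 <= len' by rewrite divr_ge0// mulr_ge0.
have lT : l%:R * len' = 2 * T%:R by rewrite /len' mulrC divfK// pnatr_eq0 -lt0n.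
pose K : R := \sum_(i < N) \sum_(l < N) 1.
have K0 : 0 <= K by rewrite sumr_ge0// => i _; rewrite sumr_ge0.
(* On l frozen pieces the weak smallness e1 costs at most l K e1 M <= eta. *)
pose e1 := eta / (l%:R * (K * M) + 1).
have lKM : 0 < l%:R * (K * M) + 1 by rewrite ltr_wpDl// !mulr_ge0.
have e10 : 0 < e1 by rewrite divr_gt0.
have [ps1 [dd1 [h1 [dd10 h10 H1]]]] := GK_int_small fE j T gF FE GW FG e10.
have [ps2 [dd2 [h2 [dd20 h20 H2]]]] := GK_int_small fE j T gh hE kW hk eta0.
exists (ps1 ++ ps2), (Num.min dd1 dd2), (Num.min eta (Num.min h1 h2)).
split; [by rewrite lt_min dd10|by rewrite !lt_min eta0 h10|].
move=> G' k' z' y0' y' gG' FG' gk' hk' z'K nbG nbk zz y00 yS'.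
have GL' := GK_ML1loc fE gG' z'K; have kL' := GK_ML1loc fE gk' z'K.
have [yu' yE'] := yS'; have yL' := lphi_ML1loc GL' kL' yu'.
have [M' M'0 yM'] := isol_bounded yS' yL'.
have nb1 : nb th ps1 dd1 G G'.
  apply: nb_sub nbG; last by rewrite ge_min lexx.
  by move=> x xps; rewrite mem_cat xps.
have nb2 : nb th ps2 dd2 k k'.
  apply: nb_sub nbk; last by rewrite ge_min lexx orbT.
  by move=> x xps; rewrite mem_cat xps orbT.
have {}H1 a b : - T%:R <= a -> a <= b -> b <= T%:R ->
    enorm (Mint a b (fun s => G' s (z' s) - G s (z s))) <= e1.
  move=> Ta ab bT; apply: (H1 _ gG' FG' nb1 _ _ z'K zK) => // t.
  by apply: (le_trans (zz t)); rewrite !ge_min lexx !orbT.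
have {}H2 a b : - T%:R <= a -> a <= b -> b <= T%:R ->
    enorm (Mint a b (fun s => k' s (z' s) - k s (z s))) <= eta.
  move=> Ta ab bT; apply: (H2 _ gk' hk' nb2 _ _ z'K zK) => // t.
  by apply: (le_trans (zz t)); rewrite !ge_min lexx !orbT.
pose D s := G' s (z' s) - G s (z s).
have DL : ML1loc D by exact: ML1locB.
have DyL := mulmx_ML1loc DL yu.
have kkL := ML1locB kL' kL.
have H3 a b : - T%:R <= a -> a <= b -> b <= T%:R ->
    enorm (Mint a b (fun s => D s *m y s)) <= 2 * eta.
  move=> Ta ab bT.
  have yw s t : `|t - s| <= len' -> enorm (y t - y s) <= w.
    move=> st; apply/ltW/ylen; apply: (le_lt_trans st); apply: (lt_trans ld).
    by clear - fE len0; lra.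
  have bal : b - a <= l%:R * len' by rewrite lT; clear - fE Ta bT; lra.
  apply: (le_trans (Mint_mulmx_small DL yu len'0 M0 (ltW w0) yw yM H1 Ta ab bT bal)).
  have -> : 2 * eta = eta + eta by clear - fE eta0; lra.
  apply: lerD; rewrite -/K.
    have -> : l%:R * (K * e1 * M) = l%:R * (K * M) * e1 by ring.
    rewrite /e1 mulrA ler_pdivrMr// mulrC ler_wpM2l ?(ltW eta0)//.
    by rewrite lerDl.
  rewrite /w mulrAC ler_pdivrMr// ler_wpM2l ?(ltW eta0)//.
  apply: (@le_trans _ _ (2 * C)); last by rewrite lerDl.
  apply: (@le_trans _ _ (Rint a b (fun s => lsum (fun s => G' s (z' s)) s +
      lsum (fun s => G s (z s)) s))).
    apply: Rint_le; [exact: lsum_L1loc|by apply: L1locD; exact: lsum_L1loc|].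
    apply: aeW => s _; rewrite /lsum -big_split ler_sum// => i _ /=.
    rewrite -big_split ler_sum// => i' _ /=; rewrite !mxE.
    by apply: (le_trans (ler_normD _ _)); rewrite normrN.
  rewrite RintD; [|exact: lsum_L1loc|exact: lsum_L1loc].
  have := bounded _ _ a b gG' FG' z'K Ta ab bT; have := bounded _ _ a b gG FG zK Ta ab bT.
  by clear - fE eta0; lra.
pose phi s := G' s (z' s) *m (y' s - y s).
have phiL : ML1loc phi.
  have -> : phi = (fun s => G' s (z' s) *m y' s - G' s (z' s) *m y s).
    by apply/funext => s; rewrite /phi mulmxBr.
  by apply: ML1locB; exact: mulmx_ML1loc.
have main t : - T%:R <= t <= T%:R -> enorm (y' t - y t) <= 2 * (4 * eta) * 2 ^+ n.
  apply: (@gronwall _ n hh (lsum (fun s => G' s (z' s))) _ _ (fun t => y' t - y t) phi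
    (4 * eta) (M' + M) (- T%:R) T%:R) => //; rewrite ?nhT ?oppr_le0//.
  - exact: lsum_L1loc.
  - by move=> s; exact: lsum_ge0.
  - move=> a b Ta ab bT bah; apply: small => //.
    exact: le_lt_trans nd.
  - by rewrite mulr_ge0// ltW.
  - move=> s _; apply: (le_trans (ler_enormD _ _)); rewrite enormN.
    by rewrite lerD.
  - move=> s sT; rewrite (isol_eq yS sT) (isol_eq yS' sT).
    (* Splitting of the integrand: G' y' + k' = (G y + k) + G' (y' - y) + (G' - G) y + (k' - k). The
       second term feeds the Gronwall kernel, the last two are the defect. *)
    have -> : oMint 0 s (fun r => lphi G' k' z' r (y' r)) =
        oMint 0 s (fun r => lphi G k z r (y r)) + (oMint 0 s phi +
          (oMint 0 s (fun r => D r *m y r) + oMint 0 s (fun r => k' r (z' r) - k r (z r)))).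
      have L1 := ML1locD DyL kkL; have L2 := ML1locD phiL L1.
      rewrite -(oMintD _ _ DyL kkL) -(oMintD _ _ phiL L1) -(oMintD _ _ yL L2).
      apply: oMint_eq => r _; rewrite /lphi /phi /D mulmxBr mulmxBl.
      by apply/matrixP => i i'; rewrite !mxE; ring.
    set A := oMint _ _ _; set B := oMint _ _ phi; set E1 := oMint _ _ _; set E2 := oMint _ _ _.
    have [s1 s2 s3] : [/\ - T%:R <= Num.min 0 s, Num.min 0 s <= Num.max 0 s & Num.max 0 s <= T%:R].
      move/andP : sT => [sT1 sT2]; split.
      - by rewrite le_min oppr_le0 ler0n.
      - by rewrite ge_min le_max lexx.
      - by rewrite ge_max ler0n.
    have B1 : enorm E1 <= 2 * eta by rewrite enorm_oMint; exact: H3.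
    have B2 : enorm E2 <= eta by rewrite enorm_oMint; exact: H2.
    have B3 : enorm (y0' - y0) <= eta.
      by apply/ltW/(lt_le_trans y00); rewrite ge_min lexx.
    have -> : y0' + (A + (B + (E1 + E2))) - (y0 + A) = (y0' - y0) + E1 + E2 + B.
      by apply/matrixP => i i'; rewrite !mxE; ring.
    apply: (le_trans (ler_enormD _ _)); rewrite lerD2r.
    apply: (le_trans (ler_enormD _ _)); apply: (@le_trans _ _ ((eta + 2 * eta) + eta)).
      by rewrite lerD//; apply: (le_trans (ler_enormD _ _)); rewrite lerD.
    by clear - fE eta0; lra.
  - by apply: aeW => s _; exact: enorm_mulmx_lsum.
move=> t; rewrite -(isol_clamp t yS) -(isol_clamp t yS').
apply: (le_trans (main _ (clamp_itv _ (opp_nat_le T)))).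
rewrite /eta le_eqVlt; apply/orP; left; apply/eqP; field.
by rewrite gt_eqF.
Qed.

End Linear.

(** * Maximal solutions *)

Section Solutions.
Context {R : realType} {N : nat}.
Local Notation vec := 'cV[R]_N.
Local Notation mu := (@lebesgue_measure R).
Implicit Types (g k : @field R N N 1) (G : @field R N N N) (j T : nat) (phi : R -> vec).

Lemma Mintegrable_ext m n (u : R -> 'M[R]_(m, n)) a b : Mintegrable a b u ->
  ML1loc (fun s => if a <= s <= b then u s else 0).
Proof.
move=> uI i l c d; apply: (@integrableS _ _ _ mu setT) => //.
have mI : measurable (`[a, b]%classic : set (measurableTypeR R)) by [].
have /(integrable_mkcond _ mI) H := uI i l.
apply: (eq_integrable _ _ _ _ H) => // s _; rewrite patchE /= mem_setE in_itv/=.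
by case: ifP => //= _; rewrite mxE.
Qed.

(* [u] extends the integrand, which [solves] only makes integrable between 0 and t,
   to a locally integrable function on R. *)
Definition irep phi (y0 : vec) (y : R -> vec) (a b : R) := exists2 u, ML1loc u &
  forall s, a <= s <= b -> u s = phi s /\ y s = y0 + oMint 0 s u.

(** Integrability is known on each side of 0 separately. Extended by 0 and cut by indicators of
    half-lines, the two pieces add up to one locally integrable function. *)
Lemma irep_intro phi y0 y a b : a <= 0 -> 0 <= b ->
  Mintegrable a 0 phi -> Mintegrable 0 b phi ->
  (forall s, a <= s <= b -> y s = y0 + oMint 0 s phi) -> irep phi y0 y a b.
Proof.
move=> a0 b0 /Mintegrable_ext aL /Mintegrable_ext bL yE.
pose v s : vec := if s <= 0 then (if a <= s <= 0 then phi s else 0)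
                  else (if 0 <= s <= b then phi s else 0).
have vE s : a <= s <= b -> v s = phi s.
  move=> /andP[as_ sb]; rewrite /v; case: leP => s0; first by rewrite as_.
  by rewrite (ltW s0) sb.
exists v.
  move=> i o; have -> : (fun s => v s i o) = (fun s =>
      (if a <= s <= 0 then phi s else 0) i o * \1_`]-oo, 0] s +
      (if 0 <= s <= b then phi s else 0) i o * \1_`]0, +oo[ s).
    apply/funext => s; rewrite /v !indicE !mem_setE !in_itv/= andbT.
    by case: leP => s0 /=; rewrite mulr1 mulr0 ?addr0 ?add0r.
  have i1 (A : set R) s : `|\1_A s : R| <= 1.
    by rewrite indicE; case: (_ \in _); rewrite ?normr1 ?normr0.
  apply: L1locD.
    by apply: (L1locM (aL i o) _ (i1 `]-oo, 0]%classic)); exact: measurable_indic.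
  by apply: (L1locM (bL i o) _ (i1 `]0, +oo[%classic)); exact: measurable_indic.
move=> s /[dup] sab /andP[as_ sb]; rewrite vE// yE//; split => //; congr (_ + _).
apply: oMint_eq => r; case: (leP 0 s) => s0 /andP[r1 r2]; rewrite vE//; apply/andP; split.
- exact: le_trans r1.
- exact: le_trans sb.
- exact: le_trans r1.
- exact: (le_trans r2).
Qed.

Lemma irep_elim phi y0 y a b s : irep phi y0 y a b -> a <= 0 -> 0 <= b -> a <= s <= b ->
  Mintegrable (Num.min 0 s) (Num.max 0 s) phi /\ y s = y0 + oMint 0 s phi.
Proof.
move=> [u uL uy] a0 b0 /[dup] sab /andP[as_ sb].
have uE r : Num.min 0 s <= r <= Num.max 0 s -> u r = phi r.
  case: (leP 0 s) => s0 /andP[r1 r2]; apply: (uy _ _).1; apply/andP; split.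
  - exact: le_trans r1.
  - exact: le_trans sb.
  - exact: le_trans r1.
  - exact: (le_trans r2).
split=> [i o|]; last by rewrite (uy _ sab).2; congr (_ + _); exact: oMint_eq.
apply: eq_integrable (uL i o _ _) => // r; rewrite inE/= in_itv/= => rI.
by rewrite /= uE.
Qed.

Lemma irep_sub phi y0 y a b c d : irep phi y0 y a b -> a <= c -> d <= b ->
  irep phi y0 y c d.
Proof.
move=> [u uL uy] ac db; exists u => // s /andP[cs sd]; apply: uy.
by rewrite (le_trans ac)// (le_trans sd).
Qed.

Lemma irep_eq phi psi y0 y a b : irep phi y0 y a b ->
  (forall s, a <= s <= b -> phi s = psi s) -> irep psi y0 y a b.
Proof. by move=> [u uL uy] pp; exists u => // s sab; rewrite -pp//; exact: uy. Qed.

Lemma irep_shift phi y0 y a b c : irep phi y0 y a b -> a <= c <= b ->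
  irep (fun s => phi (s + c)) (y c) (fun s => y (s + c)) (a - c) (b - c).
Proof.
move=> [u uL uy] cab; exists (fun s => u (s + c)); first exact: ML1loc_shift.
move=> s; rewrite lerBlDr lerBrDr => /uy[uE yE]; split => //.
rewrite yE oMint_shift// add0r (uy _ cab).2 -addrA; congr (_ + _).
exact: oMint_cat.
Qed.

(** Yields the radius of a ball in which truncation leaves the equation unchanged. *)
Lemma irep_bounded phi y0 y a b : irep phi y0 y a b -> a <= 0 -> 0 <= b ->
  exists j : nat, forall s, a <= s <= b -> enorm (y s) <= j%:R.
Proof.
move=> [u uL uy] a0 b0.
pose T := Num.max `|a| `|b|; pose M := enorm y0 + Rint (- T) T (lsum u).
exists (Num.bound `|M|) => s /[dup] sab /andP[as_ sb]; rewrite (uy _ sab).2.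
apply: (@le_trans _ _ M); last first.
  by rewrite (le_trans (ler_norm _))// ltW// archi_boundP.
apply: (le_trans (ler_enormD _ _)); rewrite lerD2l.
apply: (le_trans (primitive_lip _ _ uL)); apply: Rint_half_lsum => //.
rewrite ler_norml; apply/andP; split.
  by rewrite lerNl (le_trans _ (_ : `|a| <= _)) ?le_max ?lexx// -normrN (le_trans _ (ler_norm _))// lerN2.
by rewrite (le_trans sb)// (le_trans (ler_norm _))// le_max lexx orbT.
Qed.

(** Gronwall's lemma with a = 0; the a priori bound it asks for comes from [irep_bounded]. *)
Lemma lip_unique (phi : R -> vec -> vec) l y0 y1 y2 a b : L1loc l ->
  (forall s, 0 <= l s) ->
  {ae mu, forall s, forall x y, enorm (phi s x - phi s y) <= l s * enorm (x - y)} ->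
  a <= 0 -> 0 <= b ->
  irep (fun s => phi s (y1 s)) y0 y1 a b -> irep (fun s => phi s (y2 s)) y0 y2 a b ->
  forall s, a <= s <= b -> y1 s = y2 s.
Proof.
move=> lL l0 lip a0 b0 r1 r2; have [j1 y1j] := irep_bounded r1 a0 b0.
have [j2 y2j] := irep_bounded r2 a0 b0.
have [u1 u1L uy1] := r1; have [u2 u2L uy2] := r2.
pose T := Num.max (- a) b.
have T0 : 0 <= T by rewrite le_max b0 orbT.
have [n [h [h0 nhT lh]]] := L1loc_mesh lL l0 T0.
move=> s sab; apply/eqP; rewrite -subr_eq0; apply/eqP/enorm_eq0.
have := @gronwall _ n h l _ _ (fun s => y1 s - y2 s) (fun s => u1 s - u2 s) 0
  (j1%:R + j2%:R) a b h0 lL l0 lh; rewrite mulr0 mul0r; apply => //.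
- by rewrite nhT lerNl le_max lexx.
- by rewrite nhT le_max lexx orbT.
- exact: ML1locB.
- move=> t tab; apply: (le_trans (ler_enormD _ _)); rewrite enormN.
  by rewrite lerD ?y1j ?y2j.
- move=> t tab; rewrite add0r (uy1 _ tab).2 (uy2 _ tab).2 oMintB//.
  by rewrite opprD addrACA subrr add0r.
- apply: aeS _ lip => t lt tab; rewrite (uy1 _ tab).1 (uy2 _ tab).1.
  exact: lt.
Qed.

Lemma isol_irep T (phi : R -> vec -> vec) y0 y : isol T phi y0 y -> ML1loc (fun s => phi s (y s)) ->
  irep (fun s => phi s (y s)) y0 y (- T%:R) T%:R.
Proof.
by move=> yS phiL; exists (fun s => phi s (y s)) => // s sT; split=> //; exact: (isol_eq yS sT).
Qed.

Lemma lphi_lip G k z : ML1loc (fun s => G s (z s)) ->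
  {ae mu, forall s, forall x y,
    enorm (lphi G k z s x - lphi G k z s y) <= lsum (fun s => G s (z s)) s * enorm (x - y)}.
Proof.
move=> GL; apply: aeW => s y y'; rewrite /lphi opprD addrACA subrr addr0 -mulmxBr.
exact: (enorm_mulmx_lsum (fun s => G s (z s))).
Qed.

Lemma minmax0 (t : R) : Num.min 0 t <= 0 /\ 0 <= Num.max 0 t.
Proof. by rewrite ge_min lexx le_max lexx. Qed.

Lemma minmaxt (t : R) : Num.min 0 t <= t <= Num.max 0 t.
Proof. by rewrite ge_min lexx orbT le_max lexx orbT. Qed.

Lemma solves_irep g x0 J x t : solves g x0 J x -> J t ->
  irep (fun s => g s (x s)) x0 x (Num.min 0 t) (Num.max 0 t).
Proof.
move=> [Ji [J0 xS]] Jt.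
have IJ s : Num.min 0 t <= s <= Num.max 0 t -> J s.
  case: (leP 0 t) => t0 sI; [exact: (Ji _ _ J0 Jt)|exact: (Ji _ _ Jt J0)].
have [xI _] := xS _ Jt; have [m1 m2] := minmax0 t.
apply: irep_intro => //.
- move=> i o; apply: integrableS (xI i o) => // s /=; rewrite !in_itv/= => /andP[-> s0].
  by rewrite (le_trans s0).
- move=> i o; apply: integrableS (xI i o) => // s /=; rewrite !in_itv/= => /andP[s0 ->].
  by rewrite (le_trans m1).
- by move=> s /IJ/xS[].
Qed.

Lemma irep_solves g x0 x a b : a <= 0 -> 0 <= b ->
  irep (fun s => g s (x s)) x0 x a b -> solves g x0 [set s | a <= s <= b] x.
Proof.
move=> a0 b0 xr; split; last split.
- move=> s t /= /andP[as_ sb] /andP[at_ tb] r /andP[sr rt].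
  by rewrite (le_trans as_)// (le_trans rt).
- by rewrite /= a0 b0.
- by move=> t /= tab; exact: irep_elim xr _ _ _.
Qed.

Lemma irep_tphi g j x0 x a b : irep (fun s => g s (x s)) x0 x a b ->
  (forall s, a <= s <= b -> Bj j (x s)) -> irep (fun s => tphi g j s (x s)) x0 x a b.
Proof. by move=> xr xj; apply: irep_eq xr _ => s /xj xs; rewrite /tphi bproj_id. Qed.

Lemma Imax_irep g x0 t : Imax g x0 t -> exists2 x,
  irep (fun s => g s (x s)) x0 x (Num.min 0 t) (Num.max 0 t) &
  forall s, Num.min 0 t <= s <= Num.max 0 t -> Imax g x0 s.
Proof.
move=> [J [x [xS Jt]]]; exists x; first exact: solves_irep xS Jt.
move=> s sI; exists J, x; split => //; case: xS => Ji [J0 _].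
by move: sI; case: (leP 0 t) => t0 sI; [exact: (Ji _ _ J0 Jt)|exact: (Ji _ _ Jt J0)].
Qed.

(** g is Lipschitz on balls only. Both solutions stay in a common ball on [a, b], so they solve the
    same truncated, globally Lipschitz equation. *)
Lemma irep_unique g x0 x x' a b : LC g -> a <= 0 -> 0 <= b ->
  irep (fun s => g s (x s)) x0 x a b -> irep (fun s => g s (x' s)) x0 x' a b ->
  forall s, a <= s <= b -> x s = x' s.
Proof.
move=> gLC a0 b0 xr xr'; have [j1 xj1] := irep_bounded xr a0 b0.
have [j2 xj2] := irep_bounded xr' a0 b0; pose j := maxn j1 j2.
have [l [lL l0 gl]] := tphi_lip j gLC.
apply: (lip_unique lL l0 gl a0 b0 (irep_tphi xr _) (irep_tphi xr' _)) => s sab.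
  by apply: (le_trans (xj1 s sab)); rewrite ler_nat leq_maxl.
by apply: (le_trans (xj2 s sab)); rewrite ler_nat leq_maxr.
Qed.

Lemma xsol_eq g x0 x t : LC g ->
  irep (fun s => g s (x s)) x0 x (Num.min 0 t) (Num.max 0 t) -> xsol g x0 t = x t.
Proof.
move=> gLC xr; have [m1 m2] := minmax0 t; apply: xget_unique.
  exists [set s | Num.min 0 t <= s <= Num.max 0 t], x; split => //.
    exact: irep_solves.
  exact: minmaxt.
move=> v [J [x' [xS' Jt <-]]].
exact: (irep_unique gLC m1 m2 (solves_irep xS' Jt) xr (minmaxt t)).
Qed.

Lemma irep_xsol g x0 x a b s : LC g -> a <= 0 -> 0 <= b ->
  irep (fun s => g s (x s)) x0 x a b -> a <= s <= b -> Imax g x0 s /\ xsol g x0 s = x s.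
Proof.
move=> gLC a0 b0 xr /[dup] sab /andP[as_ sb]; split.
  by exists [set s | a <= s <= b], x; split => //; exact: irep_solves.
apply: xsol_eq => //; apply: irep_sub xr _ _.
  by rewrite le_min a0.
by rewrite ge_max b0.
Qed.

Lemma tsol_xsol g j T x0 x a b : LC g -> isol T (tphi g j) x0 x ->
  - T%:R <= a -> a <= 0 -> 0 <= b -> b <= T%:R -> (forall s, a <= s <= b -> Bj j (x s)) ->
  irep (fun s => g s (x s)) x0 x a b.
Proof.
move=> gLC xS Ta a0 b0 bT xj.
have xL := tphi_ML1loc j (LC_good gLC) xS.1.
apply: irep_eq (irep_sub (isol_irep xS xL) Ta bT) _ => s /xj xs.
by rewrite /tphi bproj_id.
Qed.

(** Confinement is asked of the true solution x; uniqueness for the truncated equation then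
    transfers it to X. *)
Lemma irep_tsol g j T x0 x X a b : LC g -> isol T (tphi g j) x0 X ->
  - T%:R <= a -> a <= 0 -> 0 <= b -> b <= T%:R -> (forall s, a <= s <= b -> Bj j (x s)) ->
  irep (fun s => g s (x s)) x0 x a b -> forall s, a <= s <= b -> X s = x s.
Proof.
move=> gLC XS Ta a0 b0 bT xj xr.
have XL := tphi_ML1loc j (LC_good gLC) XS.1.
have [l [lL l0 gl]] := tphi_lip j gLC.
exact: (lip_unique lL l0 gl a0 b0 (irep_sub (isol_irep XS XL) Ta bT) (irep_tphi xr xj)).
Qed.

End Solutions.

(** * Maximal solutions through truncation, and the linear equation along them *)

Section LinearSolutions.
Context {R : realType} {N : nat}.
Local Notation vec := 'cV[R]_N.
Implicit Types (g k : @field R N N 1) (G : @field R N N N) (j T : nat).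

Definition lin g G k x0 (y : R -> vec) (s : R) : vec :=
  G s (xsol g x0 s) *m y s + k s (xsol g x0 s).

Lemma lsolves_irep g G k x0 y0 y t : lsolves g G k x0 y0 y -> Imax g x0 t ->
  irep (lin g G k x0 y) y0 y (Num.min 0 t) (Num.max 0 t).
Proof.
move=> yS It; have [x _ II] := Imax_irep It; have [yI _] := yS _ It.
have [m1 m2] := minmax0 t; apply: irep_intro => //.
- move=> i o; apply: integrableS (yI i o) => // s /=; rewrite !in_itv/= => /andP[-> s0].
  by rewrite (le_trans s0).
- move=> i o; apply: integrableS (yI i o) => // s /=; rewrite !in_itv/= => /andP[s0 ->].
  by rewrite (le_trans m1).
- by move=> s /II/yS[].
Qed.

Lemma bound_nat (r : R) : exists T : nat, r <= T%:R.
Proof.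
by exists (Num.bound `|r|); rewrite (le_trans (ler_norm _))// ltW// archi_boundP.
Qed.

Lemma minmax_bound (t T : R) : `|t| <= T -> - T <= Num.min 0 t /\ Num.max 0 t <= T.
Proof.
move=> tT; have T0 : 0 <= T by exact: le_trans tT.
by move: tT; rewrite ler_norml le_min ge_max oppr_le0 T0 => /andP[-> ->].
Qed.

(** j0 bounds the true solution between 0 and t. Allowing every j >= j0 leaves room to enlarge the
    ball later, for a margin or for a second piece of trajectory. *)
Lemma Imax_tsol g x0 t : LC g -> Imax g x0 t -> exists j0 : nat, forall j T X,
  (j0 <= j)%N -> `|t| <= T%:R -> isol T (tphi g j) x0 X ->
  forall s, Num.min 0 t <= s <= Num.max 0 t -> xsol g x0 s = X s /\ enorm (X s) <= j0%:R.
Proof.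
move=> gLC It; have [x xr _] := Imax_irep It; have [m1 m2] := minmax0 t.
have [j0 xj0] := irep_bounded xr m1 m2; exists j0 => j T X jj tT XS s sI.
have [b1 b2] := minmax_bound tT.
have [_ ->] := irep_xsol gLC m1 m2 xr sI.
have -> : X s = x s; last by split => //; exact: xj0.
apply: (irep_tsol gLC XS b1 m1 m2 b2 _ xr sI) => r rI.
by apply: (le_trans (xj0 _ rI)); rewrite ler_nat.
Qed.

Lemma lin_lphi g G k x0 y0 y j X a b :
  irep (lin g G k x0 y) y0 y a b ->
  (forall s, a <= s <= b -> xsol g x0 s = X s /\ Bj j (X s)) ->
  irep (fun s => lphi G k (fun s => bproj j (X s)) s (y s)) y0 y a b.
Proof.
by move=> yr H; apply: irep_eq yr _ => s /H[xs Xs]; rewrite /lin /lphi xs bproj_id.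
Qed.

Lemma lphi_lin g G k x0 y0 y j X a b :
  irep (fun s => lphi G k (fun s => bproj j (X s)) s (y s)) y0 y a b ->
  (forall s, a <= s <= b -> xsol g x0 s = X s /\ Bj j (X s)) ->
  irep (lin g G k x0 y) y0 y a b.
Proof.
by move=> yr H; apply: irep_eq yr _ => s /H[xs Xs]; rewrite /lin /lphi xs bproj_id.
Qed.

Lemma lin_irep_unique g G k x0 y0 y1 y2 t : LC g -> good G -> Imax g x0 t ->
  irep (lin g G k x0 y1) y0 y1 (Num.min 0 t) (Num.max 0 t) ->
  irep (lin g G k x0 y2) y0 y2 (Num.min 0 t) (Num.max 0 t) ->
  forall s, Num.min 0 t <= s <= Num.max 0 t -> y1 s = y2 s.
Proof.
move=> gLC [GC1 GC2] It r1 r2; have [m1 m2] := minmax0 t.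
have [j jP] := Imax_tsol gLC It; have [T tT] := bound_nat `|t|.
have [X XS] := tsol_ex j T x0 gLC.
have XP s : Num.min 0 t <= s <= Num.max 0 t -> xsol g x0 s = X s /\ Bj j (X s).
  by move=> sI; have [] := jP j T X (leqnn j) tT XS s sI.
have GL := comp_bproj_ML1loc j GC1 GC2 XS.1.
exact: (lip_unique (lsum_L1loc GL) (lsum_ge0 _) (lphi_lip k GL) m1 m2
  (lin_lphi r1 XP) (lin_lphi r2 XP)).
Qed.

Lemma lin_irep_ex g G k x0 y0 t : LC g -> good G -> good k -> Imax g x0 t ->
  exists y, irep (lin g G k x0 y) y0 y (Num.min 0 t) (Num.max 0 t).
Proof.
move=> gLC [GC1 GC2] [kC1 kC2] It; have [j jP] := Imax_tsol gLC It.
have [T tT] := bound_nat `|t|; have [X XS] := tsol_ex j T x0 gLC.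
have XP s : Num.min 0 t <= s <= Num.max 0 t -> xsol g x0 s = X s /\ Bj j (X s).
  by move=> sI; have [] := jP j T X (leqnn j) tT XS s sI.
have GL := comp_bproj_ML1loc j GC1 GC2 XS.1; have kL := comp_bproj_ML1loc j kC1 kC2 XS.1.
have [y yS] := lsol_ex T y0 GL kL; exists y.
have [b1 b2] := minmax_bound tT.
have yL := lphi_ML1loc GL kL yS.1.
exact: lphi_lin (irep_sub (isol_irep yS yL) b1 b2) XP.
Qed.

Lemma lsolves_ex g G k x0 y0 : LC g -> good G -> good k ->
  exists y, lsolves g G k x0 y0 y.
Proof.
move=> gLC gG gk.
have /choice[Y YP] : forall t, exists y, Imax g x0 t ->
    irep (lin g G k x0 y) y0 y (Num.min 0 t) (Num.max 0 t).
  move=> t; have [It|It] := pselect (Imax g x0 t); last by exists (fun=> 0).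
  by have [y yr] := lin_irep_ex y0 gLC gG gk It; exists y.
(* Each t has its own solution Y t between 0 and t; by uniqueness the diagonal agrees with all of
   them. *)
pose y t := Y t t; exists y => t It u.
have [x _ II] := Imax_irep It; have [m1 m2] := minmax0 t.
have yY s : Num.min 0 t <= s <= Num.max 0 t -> y s = Y t s.
  move=> sI; have Is := II _ sI; have /andP[s1 s2] := sI.
  apply: (lin_irep_unique gLC gG Is (YP _ Is) (irep_sub (YP _ It) _ _) (minmaxt s)).
    by rewrite le_min m1.
  by rewrite ge_max m2.
have yr : irep (lin g G k x0 y) y0 y (Num.min 0 t) (Num.max 0 t).
  have [v vL vP] := YP _ It; exists v => // s sI; rewrite /lin yY//; exact: vP.
exact: (irep_elim yr m1 m2 (minmaxt t)).
Qed.

Lemma ysol_eq g G k x0 y0 y t : LC g -> good G -> good k -> Imax g x0 t ->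
  irep (lin g G k x0 y) y0 y (Num.min 0 t) (Num.max 0 t) ->
  ysol g G k x0 y0 t = y t.
Proof.
move=> gLC gG gk It yr; have U y' : lsolves g G k x0 y0 y' -> y' t = y t.
  move=> yS'; exact: (lin_irep_unique gLC gG It (lsolves_irep yS' It) yr (minmaxt t)).
apply: xget_unique; last by move=> v [y' [/U yt' <-]].
by have [y' yS'] := lsolves_ex x0 y0 gLC gG gk; exists y'; split => //; exact: U.
Qed.

(** Lets the bound of a solution between 0 and t0 be carried over to times slightly beyond t0. *)
Lemma clamp_between (t0 t s : R) : Num.min 0 t <= s <= Num.max 0 t ->
  `|s - clamp (Num.min 0 t0) (Num.max 0 t0) s| <= `|t - t0|.
Proof.
rewrite /clamp => /andP[]; have := ler_norm (t - t0); have := ler_norm (- (t - t0)).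
rewrite normrN; move: (`|t - t0|) => d.
case: (leP 0 t) => ht; case: (leP 0 t0) => ht0 h1 h2 s1 s2; rewrite ler_norml.
- have [c|c] := leP t0 s; first by rewrite max_r//; apply/andP; split; lra.
  by rewrite max_r//; apply/andP; split; lra.
- have -> : Num.min 0 s = 0 by rewrite min_l.
  by rewrite max_r ?(ltW ht0)//; apply/andP; split; lra.
- have -> : Num.min t0 s = s by rewrite min_r// (le_trans s2).
  by rewrite max_l//; apply/andP; split; lra.
- have -> : Num.min 0 s = s by rewrite min_r.
  by have [c|c] := leP t0 s; apply/andP; split; lra.
Qed.

Lemma tube g x0 t0 : LC g -> Imax g x0 t0 -> exists (j T : nat) X (h : R),
  [/\ isol T (tphi g j) x0 X, 0 < h, forall t, `|t - t0| < h -> `|t| <= T%:R &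
   forall t, `|t - t0| < h -> forall s, Num.min 0 t <= s <= Num.max 0 t ->
     enorm (X s) + 1 <= j%:R].
Proof.
move=> gLC It; have [j0 jP] := Imax_tsol gLC It.
have [T tT] := bound_nat (`|t0| + 1).
(* Of the margin 2, one unit allows X to move when t passes beyond t0, the other is reserved for the
   deviation of a perturbed solution. *)
have [X XS] := tsol_ex j0.+2 T x0 gLC.
have [d d0 Xd] := XS.1 1 ltr01.
have tT0 : `|t0| <= T%:R by apply: le_trans tT; rewrite lerDl.
exists j0.+2, T, X, (Num.min d 1); split => //.
- by rewrite lt_min d0 ltr01.
- move=> t; rewrite lt_min => /andP[_ t1]; apply: le_trans tT.
  by rewrite -[t](subrK t0) (le_trans (ler_normD _ _))// addrC lerD2l ltW.
move=> t; rewrite lt_min => /andP[td _] s sI.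
have [m1 m2] := minmax0 t0.
pose s' := clamp (Num.min 0 t0) (Num.max 0 t0) s.
have s'I : Num.min 0 t0 <= s' <= Num.max 0 t0 by apply: clamp_itv; exact: (le_trans m1).
have ss' : `|s - s'| < d.
  exact: (le_lt_trans (clamp_between t0 sI) td).
have [_ Xs'] := jP j0.+2 T X (leqW (leqnSn _)) tT0 XS s' s'I.
have := Xd s' s ss'; have := ler_enormD (X s - X s') (X s').
rewrite subrK -natr1 -natr1; move: Xs'; clear.
by move: (enorm _) (enorm _) (enorm _) => a b c; lra.
Qed.

End LinearSolutions.

(** * The skew-product flows *)

Section Flow.
Context {R : realType} {N : nat} (f : @field R N N 1) (F : @field R N N N)
  (h : @field R N N 1).
Local Notation th := (Theta f).
Hypotheses (fLC : LC f) (FW : WTC th F) (hW : WTC th h)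
  (fE : equi_mbounds f) (FE : equi_mbounds F) (hE : equi_mbounds h).
Implicit Types (g k : @field R N N 1) (G : @field R N N N).

Let gf : good f := LC_good fLC.

Lemma trans_trans m n (G : @field R N m n) s t : trans (trans G s) t = trans G (t + s).
Proof. by apply/funext => r; apply/funext => x; rewrite /trans addrA. Qed.

Lemma trans0 m n (G : @field R N m n) : trans G 0 = G.
Proof. by apply/funext => r; apply/funext => x; rewrite /trans addr0. Qed.

(** If f_tau is close enough to g, continuity of translation makes f_(t + tau) close to g_t. *)
Lemma Hull1_trans g t : Hull1 th f g -> Hull1 th f (trans g t).
Proof.
move=> [gLC fg]; split; first exact: LC_trans.
move=> ps d d0; have [ps' [d' [r [d'0 r0 H]]]] :=
  nb_trans_continuous fE t ps gf fE (LC_WTC fE gLC) fg d0.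
have [tau ft] := fg ps' d' d'0; exists (t + tau); rewrite -trans_trans.
have tt : `|t - t| < r by rewrite subrr normr0.
exact: (H _ _ (good_trans tau gf) (tapprox_refl fE tau gf) tt ft).
Qed.

Lemma Hull3_Hull1 gGk : Hull3 th f F h gGk -> Hull1 th f gGk.1.1.
Proof.
move=> [gLC [_ [_ H]]]; split => // ps d d0.
by have [tau [ft _ _]] := H ps d d0; exists tau.
Qed.

Lemma Hull3_tapprox gGk : Hull3 th f F h gGk -> tapprox f F gGk.1.2 /\ tapprox f h gGk.2.
Proof.
move=> [_ [_ [_ H]]]; split => ps d d0.
  by have [tau [_ Ft _]] := H ps d d0; exists tau.
by have [tau [_ _ ht]] := H ps d d0; exists tau.
Qed.

Lemma nb3_trans_continuous gGk t ps (e : R) : Hull3 th f F h gGk -> 0 < e ->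
  exists ps' d r, [/\ 0 < d, 0 < r & forall p t',
    [/\ good p.1.1, good p.1.2 & good p.2] ->
    [/\ tapprox f f p.1.1, tapprox f F p.1.2 & tapprox f h p.2] ->
    `|t' - t| < r -> nb3 th ps' d gGk p -> nb3 th ps e (trans3 gGk t) (trans3 p t')].
Proof.
move=> H3 e0; have [gLC fg] := Hull3_Hull1 H3; have [FG hk] := Hull3_tapprox H3.
have [_ [GW [kW _]]] := H3.
have [ps1 [d1 [r1 [d10 r10 H1]]]] := nb_trans_continuous fE t ps gf fE (LC_WTC fE gLC) fg e0.
have [ps2 [d2 [r2 [d20 r20 H2]]]] := nb_trans_continuous fE t ps (WTC_good FW) FE GW FG e0.
have [ps3 [d4 [r3 [d40 r30 H4]]]] := nb_trans_continuous fE t ps (WTC_good hW) hE kW hk e0.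
exists (ps1 ++ ps2 ++ ps3), (Num.min d1 (Num.min d2 d4)), (Num.min r1 (Num.min r2 r3)).
split; [by rewrite !lt_min d10 d20|by rewrite !lt_min r10 r20|].
move=> p t' [g1 g2 g3] [a1 a2 a3]; rewrite !lt_min => /and3P[t1 t2 t3] [n1 n2 n3].
split.
- apply: H1 => //; apply: nb_sub n1; last by rewrite ge_min lexx.
  by move=> x xps; rewrite mem_cat xps.
- apply: H2 => //; apply: nb_sub n2; last by rewrite !ge_min lexx orbT.
  by move=> x xps; rewrite !mem_cat xps orbT.
- apply: H4 => //; apply: nb_sub n3; last by rewrite !ge_min lexx !orbT.
  by move=> x xps; rewrite !mem_cat xps !orbT.
Qed.

Lemma Hull3_trans gGk t : Hull3 th f F h gGk -> Hull3 th f F h (trans3 gGk t).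
Proof.
move=> /[dup] H3 [gLC [GW [kW H]]]; split; first exact: LC_trans.
split; [exact: WTC_trans|split; first exact: WTC_trans].
move=> ps d d0; have [ps' [d' [r [d'0 r0 K]]]] := nb3_trans_continuous t ps H3 d0.
have [tau [n1 n2 n3]] := H ps' d' d'0; exists (t + tau); rewrite -!trans_trans.
have gF := WTC_good FW; have gh := WTC_good hW.
have tt : `|t - t| < r by rewrite subrr normr0.
exact: (K (trans f tau, trans F tau, trans h tau) t
  (And3 (good_trans tau gf) (good_trans tau gF) (good_trans tau gh))
  (And3 (tapprox_refl fE tau gf) (tapprox_refl fE tau gF) (tapprox_refl fE tau gh))
  tt (And3 n1 n2 n3)).
Qed.

(** X' uses the reserved unit of the margin and stays in B_j, where truncation is invisible; it is
    therefore the true solution, and t belongs to its maximal interval. *)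
Lemma tube_xsol t0 j T X (r : R) g' x0' X' t :
  (forall t, `|t - t0| < r -> `|t| <= T%:R) ->
  (forall t, `|t - t0| < r -> forall s, Num.min 0 t <= s <= Num.max 0 t ->
     enorm (X s) + 1 <= j%:R) ->
  LC g' -> isol T (tphi g' j) x0' X' -> (forall s, enorm (X' s - X s) <= 1) ->
  `|t - t0| < r -> forall s, Num.min 0 t <= s <= Num.max 0 t ->
  [/\ Imax g' x0' s, xsol g' x0' s = X' s & Bj j (X' s)].
Proof.
move=> tT Xj gLC' XS' XX tr s sI; have [m1 m2] := minmax0 t.
have [b1 b2] := minmax_bound (tT _ tr).
have X'j u : Num.min 0 t <= u <= Num.max 0 t -> Bj j (X' u).
  move=> /(Xj _ tr); have := XX u; have := ler_enormD (X' u - X u) (X u).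
  rewrite subrK /Bj /=; move: (enorm _) (enorm _) (enorm _) => a b c.
  by clear - fLC FW hW fE FE hE; lra.
have [Is xs] := irep_xsol gLC' m1 m2 (tsol_xsol gLC' XS' b1 m1 m2 b2 X'j) sI.
by split => //; exact: X'j.
Qed.

(** Existence up to time t is part of the conclusion, so openness of the domain and continuity come
    from one estimate. The distance splits into X' - X at time t and X between t and t0. *)
Lemma xsol_continuous g x0 t0 (e : R) : Hull1 th f g -> Imax g x0 t0 -> 0 < e ->
  exists ps d r, [/\ 0 < d, 0 < r & forall g' x0' t, Hull1 th f g' ->
    `|t - t0| < r -> nb th ps d g g' -> enorm (x0' - x0) < r ->
    Imax g' x0' t /\ enorm (xsol g' x0' t - xsol g x0 t0) < e].
Proof.
move=> [gLC fg] It e0; have [j [T [X [r [XS r0 tT Xj]]]]] := tube gLC It.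
pose e1 := Num.min (e / 3) 1.
have e10 : 0 < e1 by rewrite lt_min ltr01 divr_gt0.
have [ps [d [r1 [d0 r10 cmp]]]] := tsol_compare fE gf j T x0 gLC fg e10.
have e30 : 0 < e / 3 by rewrite divr_gt0.
have [r2 r20 Xr2] := XS.1 _ e30.
exists ps, d, (Num.min r (Num.min r1 r2)); split => //; first by rewrite !lt_min r0 r10.
move=> g' x0' t [gLC' fg']; rewrite !lt_min => /and3P[tr _ tr2] gg' /and3P[_ xr1 _].
have [X' XS'] := tsol_ex j T x0' gLC'.
have XX := cmp g' x0' X X' gLC' fg' gg' xr1 XS XS'.
have XX1 s : enorm (X' s - X s) <= 1 by rewrite (le_trans (XX s))// ge_min lexx orbT.
have [It' -> _] := tube_xsol tT Xj gLC' XS' XX1 tr (minmaxt t).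
have t00 : `|t0 - t0| < r by rewrite subrr normr0.
have X1 s : enorm (X s - X s) <= 1 by rewrite subrr enorm0.
have [_ -> _] := tube_xsol tT Xj gLC XS X1 t00 (minmaxt t0).
split => //; apply: (le_lt_trans (ler_enorm_dist (X t) _ _)).
have H1 : enorm (X' t - X t) <= e / 3 by rewrite (le_trans (XX t))// ge_min lexx.
have := Xr2 t0 t tr2; move: H1; clear - fLC FW hW fE FE hE e0.
by move: (enorm _) (enorm _) => a b; lra.
Qed.

Lemma ysol_continuous gGk x0 y0 t0 (e : R) : Hull3 th f F h gGk ->
  Imax gGk.1.1 x0 t0 -> 0 < e ->
  exists ps d r, [/\ 0 < d, 0 < r & forall p x0' y0' t, Hull3 th f F h p ->
    `|t - t0| < r -> nb3 th ps d gGk p -> enorm (x0' - x0) < r -> enorm (y0' - y0) < r ->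
    enorm (ysol p.1.1 p.1.2 p.2 x0' y0' t -
           ysol gGk.1.1 gGk.1.2 gGk.2 x0 y0 t0) < e].
Proof.
move: gGk => [[g G] k] H3 /= It e0; have [/= gLC fg] := Hull3_Hull1 H3.
have [/= FG hk] := Hull3_tapprox H3; have [_ [/= GW [kW _]]] := H3.
have gG := WTC_good GW; have gk := WTC_good kW.
have [j [T [X [r [XS r0 tT Xj]]]]] := tube gLC It.
pose z s := bproj j (X s); have zK : GK f j z by exact: tsol_GK fg XS.
have GL := GK_ML1loc fE gG zK; have kL := GK_ML1loc fE gk zK.
have [Y YS] := lsol_ex T y0 GL kL.
have e30 : 0 < e / 3 by rewrite divr_gt0.
have [ps1 [d1 [r1 [d10 r10 Ycmp]]]] := lsol_compare fE (WTC_good FW) FE (WTC_good hW) hE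
  GW FG kW hk zK YS e30.
(* The closeness of paths demanded by the comparison of the y-solutions becomes the accuracy
   demanded of the x-solutions; the bound 1 keeps X' in the tube. *)
pose e1 := Num.min r1 1.
have e10 : 0 < e1 by rewrite lt_min ltr01 r10.
have [ps2 [d2 [r2 [d20 r20 Xcmp]]]] := tsol_compare fE gf j T x0 gLC fg e10.
have [r3 r30 Yr3] := YS.1 _ e30.
exists (ps1 ++ ps2), (Num.min d1 d2), (Num.min r (Num.min r1 (Num.min r2 r3))).
split => //; [by rewrite lt_min d10|by rewrite !lt_min r0 r10 r20|].
move=> [[g' G'] k'] x0' y0' t H3' /=; rewrite !lt_min => /and4P[tr _ _ tr3] [/= n1 n2 n3].
move=> /and4P[_ _ xr2 _] /and4P[_ yr1 _ _].
have [/= gLC' fg'] := Hull3_Hull1 H3'; have [/= FG' hk'] := Hull3_tapprox H3'.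
have [_ [/= GW' [kW' _]]] := H3'; have gG' := WTC_good GW'; have gk' := WTC_good kW'.
have s1 : {subset ps1 <= ps1 ++ ps2} by move=> x xps; rewrite mem_cat xps.
have s2 : {subset ps2 <= ps1 ++ ps2} by move=> x xps; rewrite mem_cat xps orbT.
have m1 : Num.min d1 d2 <= d1 by rewrite ge_min lexx.
have m2 : Num.min d1 d2 <= d2 by rewrite ge_min lexx orbT.
have [X' XS'] := tsol_ex j T x0' gLC'.
have XX := Xcmp g' x0' X X' gLC' fg' (nb_sub s2 m2 n1) xr2 XS XS'.
have XX1 s : enorm (X' s - X s) <= 1 by rewrite (le_trans (XX s))// ge_min lexx orbT.
pose z' s := bproj j (X' s); have z'K : GK f j z' by exact: tsol_GK fg' XS'.
have GL' := GK_ML1loc fE gG' z'K; have kL' := GK_ML1loc fE gk' z'K.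
have [Y' YS'] := lsol_ex T y0' GL' kL'.
have YY s : enorm (Y' s - Y s) <= e / 3.
  apply: (Ycmp G' k' z' y0' Y' gG' FG' gk' hk' z'K (nb_sub s1 m1 n2) (nb_sub s1 m1 n3) _ yr1 YS').
  move=> u; apply: (le_trans (bproj_lip _ _ _)); apply: (le_trans (XX u)).
  by rewrite ge_min lexx.
have t00 : `|t0 - t0| < r by rewrite subrr normr0.
have X1 s : enorm (X s - X s) <= 1 by rewrite subrr enorm0.
have A' := tube_xsol tT Xj gLC' XS' XX1 tr; have A := tube_xsol tT Xj gLC XS X1 t00.
have -> : ysol g' G' k' x0' y0' t = Y' t.
  have [It' _ _] := A' t (minmaxt t); apply: ysol_eq => //.
  have [b1 b2] := minmax_bound (tT _ tr).
  apply: lphi_lin (irep_sub (isol_irep YS' (lphi_ML1loc GL' kL' YS'.1)) b1 b2) _.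
  by move=> u /A'[].
have -> : ysol g G k x0 y0 t0 = Y t0.
  apply: ysol_eq => //; have [b1 b2] := minmax_bound (tT _ t00).
  apply: lphi_lin (irep_sub (isol_irep YS (lphi_ML1loc GL kL YS.1)) b1 b2) _.
  by move=> u /A[].
apply: (le_lt_trans (ler_enorm_dist (Y t) _ _)).
have := Yr3 t0 t tr3; move: (YY t); clear - fLC FW hW fE FE hE e0.
by move: (enorm _) (enorm _) => a b; lra.
Qed.

(* The truncated solution through x0, restarted at time s, is also the solution
   of the translated equation, so no gluing of solutions is needed. *)
Lemma cocycle g x0 s t : LC g -> Imax g x0 s -> Imax (trans g s) (xsol g x0 s) t ->
  exists j T X, [/\ isol T (tphi g j) x0 X, `|s| + `|t| <= T%:R,
    forall r, Num.min 0 t <= r <= Num.max 0 t ->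
      xsol (trans g s) (xsol g x0 s) r = X (r + s) /\ Bj j (X (r + s)),
    forall r, Num.min 0 s <= r <= Num.max 0 s -> xsol g x0 r = X r /\ Bj j (X r) &
    forall r, Num.min 0 (t + s) <= r <= Num.max 0 (t + s) ->
      [/\ Imax g x0 r, xsol g x0 r = X r & Bj j (X r)]].
Proof.
move=> gLC Is It; have gLCs := LC_trans s gLC.
have [j1 P1] := Imax_tsol gLC Is; have [z zr _] := Imax_irep It.
have [m1 m2] := minmax0 t; have [m3 m4] := minmax0 s.
have [j2 zj] := irep_bounded zr m1 m2; pose j := maxn j1 j2.
have [T sT] := bound_nat (`|s| + `|t|).
have [X XS] := tsol_ex j T x0 gLC; exists j, T, X.
have sT' : `|s| <= T%:R by apply: le_trans sT; rewrite lerDl.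
have [Xs _] := P1 j T X (leq_maxl _ _) sT' XS s (minmaxt s).
have XL := tphi_ML1loc j (LC_good gLC) XS.1.
have /andP[sT1 sT2] : - T%:R <= s <= T%:R by rewrite -ler_norml.
have sI : - T%:R <= s <= T%:R by rewrite sT1.
have Xr := irep_shift (isol_irep XS XL) sI.
have [l [lL l0 gl]] := tphi_lip j gLCs.
have [c1 c2] : - T%:R - s <= Num.min 0 t /\ Num.max 0 t <= T%:R - s.
  have := ler_norm s; have := ler_norm (- s); have := ler_norm t; have := ler_norm (- t).
  rewrite !normrN; move: sT sT1 sT2; clear - fLC FW hW fE FE hE.
  by move: (T%:R : R) => T'; case: (leP 0 t) => ?; split; lra.
have Xz r : Num.min 0 t <= r <= Num.max 0 t -> X (r + s) = z r.
  apply: (lip_unique (y1 := fun r => X (r + s)) lL l0 gl m1 m2); first exact: irep_sub Xr c1 c2.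
  rewrite -Xs; apply: irep_tphi zr _ => u /zj zu; apply: (le_trans zu).
  by rewrite ler_nat leq_maxr.
have Q2 r : Num.min 0 t <= r <= Num.max 0 t ->
    xsol (trans g s) (xsol g x0 s) r = X (r + s) /\ Bj j (X (r + s)).
  move=> rI; have [_ ->] := irep_xsol gLCs m1 m2 zr rI; rewrite Xz//; split => //.
  by apply: (le_trans (zj _ rI)); rewrite ler_nat leq_maxr.
have Q1 r : Num.min 0 s <= r <= Num.max 0 s -> xsol g x0 r = X r /\ Bj j (X r).
  move=> rI; have [-> Xj] := P1 j T X (leq_maxl _ _) sT' XS r rI; split => //.
  by apply: (le_trans Xj); rewrite ler_nat leq_maxl.
split => //; have [n1 n2] := minmax0 (t + s).
have tsT : `|t + s| <= T%:R.
  by apply: le_trans sT; rewrite addrC; exact: ler_normD.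
have [b1 b2] := minmax_bound tsT.
have Xj r : Num.min 0 (t + s) <= r <= Num.max 0 (t + s) -> Bj j (X r).
  (* A time between 0 and t + s that is not between 0 and s lies between s and t + s, where the
     restarted solution is confined. *)
  move=> rI; have [rs|rs] := boolP (Num.min 0 s <= r <= Num.max 0 s).
    exact: (Q1 _ rs).2.
  rewrite -[r](subrK s); apply: (Q2 _ _).2; move: rI rs; clear - fLC FW hW fE FE hE.
  case: (leP 0 s) => ?; case: (leP 0 t) => ?; case: (leP 0 (t + s)) => ? /andP[? ?];
    rewrite negb_and -!ltNge => /orP[] ?; apply/andP; split; lra.
move=> r rI.
have [Ir xr] := irep_xsol gLC n1 n2 (tsol_xsol gLC XS b1 n1 n2 b2 Xj) rI.
by split => //; exact: Xj.
Qed.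

Lemma Imax0 g x0 : LC g -> Imax g x0 0 /\ xsol g x0 0 = x0.
Proof.
(* With T = 0 and a radius above |x0|, the truncated solution is the constant x0, inside the
   ball. *)
move=> gLC; have [X XS] := tsol_ex (Num.bound (enorm x0)) 0 x0 gLC.
have X0 : X 0 = x0 by rewrite (isol_eq XS) ?oppr0 ?lexx// oMint_nil addr0.
have Xr : irep (fun s => g s (X s)) x0 X 0 0.
  apply: (tsol_xsol gLC XS); rewrite ?oppr0// => s /le_anti <-.
  by rewrite X0 /Bj /= ltW// archi_boundP// enorm_ge0.
have [|I0 xs] := @irep_xsol _ _ g x0 X 0 0 0 gLC (lexx 0) (lexx 0) Xr; first by rewrite !lexx.
by rewrite xs X0.
Qed.

Lemma ysol0 g G k x0 y0 : LC g -> good G -> good k -> ysol g G k x0 y0 0 = y0.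
Proof.
move=> gLC gG gk; have [I0 _] := Imax0 x0 gLC.
have [y yr] := lin_irep_ex y0 gLC gG gk I0.
rewrite (ysol_eq gLC gG gk I0 yr); have [u _ uP] := yr.
by have [_ ->] := uP 0 (minmaxt 0); rewrite oMint_nil addr0.
Qed.

(** A single Y solves the linear equation along the truncated path on [- T, T]. Its restart at time
    s solves the translated equation, so both sides equal Y (t + s). *)
Lemma ysol_cocycle g G k x0 y0 s t : LC g -> good G -> good k ->
  Imax g x0 s -> Imax (trans g s) (xsol g x0 s) t ->
  ysol g G k x0 y0 (t + s) =
  ysol (trans g s) (trans G s) (trans k s) (xsol g x0 s) (ysol g G k x0 y0 s) t.
Proof.
move=> gLC gG gk Is It; have [j [T [X [XS sT Q2 Q1 Q3]]]] := cocycle gLC Is It.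
have GL := comp_bproj_ML1loc j gG.1 gG.2 XS.1; have kL := comp_bproj_ML1loc j gk.1 gk.2 XS.1.
have [Y YS] := lsol_ex T y0 GL kL.
have Yr := isol_irep YS (lphi_ML1loc GL kL YS.1).
have sT' : `|s| <= T%:R by apply: le_trans sT; rewrite lerDl.
have tsT : `|t + s| <= T%:R by apply: le_trans sT; rewrite addrC; exact: ler_normD.
have [b1 b2] := minmax_bound sT'; have [b3 b4] := minmax_bound tsT.
have [Its _ _] := Q3 _ (minmaxt (t + s)).
rewrite (ysol_eq gLC gG gk Is (lphi_lin (irep_sub Yr b1 b2) Q1)).
rewrite (ysol_eq gLC gG gk Its (lphi_lin (irep_sub Yr b3 b4) (x0 := x0) _)); last first.
  by move=> r /Q3[].
apply/esym; apply: (ysol_eq (y := fun r => Y (r + s))) => //.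
- exact: LC_trans.
- exact: good_trans.
- exact: good_trans.
have sI : - T%:R <= s <= T%:R by rewrite -ler_norml.
have [c1 c2] : - T%:R - s <= Num.min 0 t /\ Num.max 0 t <= T%:R - s.
  have := ler_norm s; have := ler_norm (- s); have := ler_norm t; have := ler_norm (- t).
  rewrite !normrN; move: sT; clear - fLC FW hW fE FE hE.
  by move: (T%:R : R) => T'; case: (leP 0 t) => ?; split; lra.
apply: irep_eq (irep_sub (irep_shift Yr sI) c1 c2) _ => r /Q2[xr Xr].
by rewrite /lphi /lin xr bproj_id.
Qed.

Lemma open1_U1 : open1 th f (U1 th f).
Proof.
move=> [[t0 g] x0] [/= Hg It].
have [ps [d [r [d0 r0 H]]]] := xsol_continuous Hg It ltr01.
exists ps, d, r; split => // -[[t g'] x0'] /= Hg' tr gg' xr; split => //=.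
by have [] := H g' x0' t Hg' tr gg' xr.
Qed.

Lemma cont1_U1 : cont1 th f.
Proof.
move=> [[t0 g] x0] [/= Hg It] ps d e d0 e0; have [gLC fg] := Hg.
have [ps1 [d1 [r1 [d10 r10 H1]]]] := xsol_continuous Hg It e0.
have [ps2 [d2 [r2 [d20 r20 H2]]]] :=
  nb_trans_continuous fE t0 ps gf fE (LC_WTC fE gLC) fg d0.
exists (ps1 ++ ps2), (Num.min d1 d2), (Num.min r1 r2).
split; [by rewrite lt_min d10|by rewrite lt_min r10|].
move=> [[t g'] x0'] [/= Hg' _]; rewrite !lt_min => /andP[t1 t2] gg' /andP[x1 _].
have s1 : {subset ps1 <= ps1 ++ ps2} by move=> x xps; rewrite mem_cat xps.
have s2 : {subset ps2 <= ps1 ++ ps2} by move=> x xps; rewrite mem_cat xps orbT.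
have m1 : Num.min d1 d2 <= d1 by rewrite ge_min lexx.
have m2 : Num.min d1 d2 <= d2 by rewrite ge_min lexx orbT.
have [gLC' fg'] := Hg'; split.
  exact: (H2 g' t (LC_good gLC') fg' t2 (nb_sub s2 m2 gg')).
by have [] := H1 g' x0' t Hg' t1 (nb_sub s1 m1 gg') x1.
Qed.

Lemma flow1_Pi : flow1 th f.
Proof.
split=> [g x0 [gLC fg]|s t g x0 [/= Hg Is] [/= Hgs It]].
  by have [I0 x00] := Imax0 x0 gLC; rewrite /Pi /= trans0 x00; split.
have [gLC _] := Hg; have [j [T [X [XS sT Q2 Q1 Q3]]]] := cocycle gLC Is It.
have [Its xts _] := Q3 _ (minmaxt (t + s)); split; first exact: (conj Hg Its).
by rewrite /Pi /= trans_trans xts (Q2 _ (minmaxt t)).1.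
Qed.

Lemma open2_U2 : open2 th f F h (U2 th f F h).
Proof.
move=> [[[t0 p] x0] y0] [/= Hp It].
have [ps [d [r [d0 r0 H]]]] := xsol_continuous (Hull3_Hull1 Hp) It ltr01.
exists ps, d, r; split => // -[[[t q] x0'] y0'] /= Hq tr [pq _ _] xr _; split => //=.
by have [] := H _ x0' t (Hull3_Hull1 Hq) tr pq xr.
Qed.

Lemma cont2_U2 : cont2 th f F h.
Proof.
move=> [[[t0 [[g G] k]] x0] y0] [/= Hp It] ps d e d0 e0.
have [ps1 [d1 [r1 [d10 r10 H1]]]] := xsol_continuous (Hull3_Hull1 Hp) It e0.
have [ps2 [d2 [r2 [d20 r20 H2]]]] := ysol_continuous y0 Hp It e0.
have [ps3 [d3 [r3 [d30 r30 H3]]]] := nb3_trans_continuous t0 ps Hp d0.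
exists (ps1 ++ ps2 ++ ps3), (Num.min d1 (Num.min d2 d3)), (Num.min r1 (Num.min r2 r3)).
split; [by rewrite !lt_min d10 d20|by rewrite !lt_min r10 r20|].
move=> [[[t [[g' G'] k']] x0'] y0'] [/= Hq _]; rewrite !lt_min.
move=> /and3P[t1 t2 t3] [/= n1 n2 n3] /and3P[x1 x2 _] /and3P[_ y2 _].
have s1 : {subset ps1 <= ps1 ++ ps2 ++ ps3} by move=> x xps; rewrite mem_cat xps.
have s2 : {subset ps2 <= ps1 ++ ps2 ++ ps3} by move=> x xps; rewrite !mem_cat xps orbT.
have s3 : {subset ps3 <= ps1 ++ ps2 ++ ps3} by move=> x xps; rewrite !mem_cat xps !orbT.
have m1 : Num.min d1 (Num.min d2 d3) <= d1 by rewrite ge_min lexx.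
have m2 : Num.min d1 (Num.min d2 d3) <= d2 by rewrite !ge_min lexx orbT.
have m3 : Num.min d1 (Num.min d2 d3) <= d3 by rewrite !ge_min lexx !orbT.
have [/= gLC' fg'] := Hull3_Hull1 Hq; have [/= FG' hk'] := Hull3_tapprox Hq.
have [_ [/= GW' [kW' _]]] := Hq.
split.
- exact: (H3 (g', G', k') t (And3 (LC_good gLC') (WTC_good GW') (WTC_good kW'))
    (And3 fg' FG' hk') t3 (And3 (nb_sub s3 m3 n1) (nb_sub s3 m3 n2) (nb_sub s3 m3 n3))).
- by have [] := H1 g' x0' t (Hull3_Hull1 Hq) t1 (nb_sub s1 m1 n1) x1.
- exact: (H2 (g', G', k') x0' y0' t Hq t2
    (And3 (nb_sub s2 m2 n1) (nb_sub s2 m2 n2) (nb_sub s2 m2 n3)) x2 y2).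
Qed.

Lemma flow2_Psi : flow2 th f F h.
Proof.
split=> [[[g G] k] x0 y0 Hp|s t [[g G] k] x0 y0 [/= Hp Is] [/= Hps It]].
  have [gLC [/= GW [kW _]]] := Hp; have [I0 x00] := Imax0 x0 gLC.
  by rewrite /Psi /trans3 /= !trans0 x00 (ysol0 x0 y0 gLC (WTC_good GW) (WTC_good kW)); split.
have [gLC [/= GW [kW _]]] := Hp.
have [j [T [X [XS sT Q2 Q1 Q3]]]] := cocycle gLC Is It.
have [Its xts _] := Q3 _ (minmaxt (t + s)); split; first exact: (conj Hp Its).
rewrite /Psi /trans3 /= !trans_trans xts (Q2 _ (minmaxt t)).1.
by rewrite (ysol_cocycle y0 gLC (WTC_good GW) (WTC_good kW) Is It).
Qed.

End Flow.

Theorem theorem3p8 (R : realType) (N : nat)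
  (f : @field R N N 1) (F : @field R N N N) (h : @field R N N 1) :
  LC f -> WTC (Theta f) F -> WTC (Theta f) h ->
  equi_mbounds f -> equi_mbounds F -> equi_mbounds h ->
  (* (i) *)
  [/\ open1 (Theta f) f (U1 (Theta f) f),
      (forall p, U1 (Theta f) f p -> Hull1 (Theta f) f (Pi p).1),
      cont1 (Theta f) f & flow1 (Theta f) f] /\
  (* (ii) *)
  [/\ open2 (Theta f) f F h (U2 (Theta f) f F h),
      (forall p, U2 (Theta f) f F h p -> Hull3 (Theta f) f F h (Psi p).1.1),
      cont2 (Theta f) f F h & flow2 (Theta f) f F h].
Proof.
move=> fLC FW hW fE FE hE; split; split.
- exact: open1_U1.
- by move=> [[t g] x0] [/= Hg _]; exact: Hull1_trans.
- exact: cont1_U1.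
- exact: flow1_Pi.
- exact: open2_U2.
- by move=> [[[t [[g G] k]] x0] y0] [/= Hp _]; exact: Hull3_trans.
- exact: cont2_U2.
- exact: flow2_Psi.
Qed.
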